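(* Suppose the bids satisfy the standing assumption below and the kernel $K$ satisfies Assumption 2, and let $h=h_n\to 0$ with $nh_n\to\infty$. Then $$Z_n(u)=Z_n^*(u)+R_n(u),\qquad u\in[h,1-h],$$ where $$Z_n(u)=\frac{\sqrt{nh}\,(\hat v_h(u)-v(u))}{\hat q_h(u)},\qquad Z_n^*(u)=-A(u)\,\mathbb G_{n,h}(u),$$ and $\sup_{u\in[h,1-h]}|R_n(u)|=O_{a.s.}\big(n^{1/2}h^{3/2}+h^{1/2}+h^{-1/2}n^{-1/4}\ell(n)\big)$.
   Context: Standing assumption: $b_1,\dots,b_n$ are i.i.d. bids with continuous CDF $F$ whose quantile function $Q=F^{-1}$ is twice continuously differentiable on $[0,1]$ with $q=Q'>0$ on $[0,1]$. $p_1,\dots,p_M$ are fixed known nonnegative numbers ($M\ge 2$), $A_1(u)=\sum_{m=1}^M p_m u^{m-1}$ with $A_1'(u)\neq0$ on $[0,1]$, and $A(u)=A_1(u)/A_1'(u)$ (a known function). The value quantile function is $v(u)=Q(u)+A(u)q(u)$. Estimators: $b_{(1)}\le\dots\le b_{(n)}$ are the order statistics; $\hat Q(u)=b_{(\lfloor nu\rfloor+1)}$ for $u\in[0,1)$ and $\hat Q(1)=b_{(n)}$; $K_h(z)=h^{-1}K(z/h)$; $\hat q_h(u)=\int_0^1 K_h(u-z)\,d\hat Q(z)=\sum_{i=1}^{n-1}K_h(u-i/n)(b_{(i+1)}-b_{(i)})$; $\hat v_h(u)=\hat Q(u)+A(u)\hat q_h(u)$. $\mathbb G_{n,h}(u)=\sqrt{nh}\,\frac1n\sum_{i=1}^n\big[K_h(u-F(b_i))-\mathbb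 E K_h(u-F(b_i))\big]$. $\ell(n)=(\log n)^{1/2}(\log\log n)^{1/4}$. Assumption 2 (kernel): $K:\mathbb R\to\mathbb R$ is nonnegative, $\int K=1$, $R_K=\int K^2<\infty$, and $K$ is Lipschitz and supported on $[-1,1]$. Notation: for a deterministic sequence $r_n$, $X_n=O_{a.s.}(r_n)$ means there is an a.s. finite random variable $C$ with $|X_n|\le C r_n$ for all sufficiently large $n$, almost surely. *)

(* Defs.v *)
From HB Require Import structures.
From mathcomp Require Import all_boot all_order all_algebra.
From mathcomp Require Import all_classical all_reals all_analysis.
Set Implicit Arguments. Unset Strict Implicit. Unset Printing Implicit Defensive.
Import Order.TTheory GRing.Theory Num.Theory.
Import numFieldNormedType.Exports.
Local Open Scope classical_set_scope.
Local Open Scope ring_scope.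

Section defs.
Context {R : realType}.

Definition A1 (p : nat -> R) (M : nat) (u : R) : R :=
  \sum_(1 <= m < M.+1) p m * u ^+ (m - 1).
Definition A1' (p : nat -> R) (M : nat) (u : R) : R :=
  \sum_(1 <= m < M.+1) p m * (m - 1)%:R * u ^+ (m - 2).
Definition Afun (p : nat -> R) (M : nat) (u : R) : R := A1 p M u / A1' p M u.

Definition Kh (K : R -> R) (h z : R) : R := h^-1 * K (z / h).

(* order statistic b_(k), k = 1..n, of the sample b_0(w),...,b_{n-1}(w) *)
Definition ord_stat {T : Type} (b : nat -> T -> R) (n : nat) (w : T) (k : nat) : R :=
  nth 0 (sort <=%R [seq b i w | i <- iota 0 n]) k.-1.

Definition Qhat {T : Type} (b : nat -> T -> R) (n : nat) (u : R) (w : T) : R :=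
  if u < 1 then ord_stat b n w (Num.truncn (n%:R * u)).+1 else ord_stat b n w n.

Definition qhat {T : Type} (K : R -> R) (b : nat -> T -> R) (n : nat) (h u : R) (w : T) : R :=
  \sum_(1 <= i < n) Kh K h (u - i%:R / n%:R) * (ord_stat b n w i.+1 - ord_stat b n w i).

Definition vhat {T : Type} (p : nat -> R) (M : nat) (K : R -> R) (b : nat -> T -> R)
  (n : nat) (h u : R) (w : T) : R :=
  Qhat b n u w + Afun p M u * qhat K b n h u w.

Definition ell (n : nat) : R := Num.sqrt (ln n%:R) * (ln (ln n%:R)) `^ (1 / 4).

End defs.

Section prob.
Context {d : measure_display} {T : measurableType d} {R : realType}.

Definition mutually_independent (P : probability T R) (b : nat -> T -> R) : Prop :=
  forall (s : seq nat) (B : nat -> set R), uniq s -> (forall i, measurable (B i)) ->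
    P (\bigcap_(i in [set i | i \in s]) (b i @^-1` B i)) =
    (\prod_(i <- s) P (b i @^-1` B i))%E.

Definition Gnh (P : probability T R) (K : R -> R) (F : R -> R) (b : nat -> T -> R)
  (n : nat) (h u : R) (w : T) : R :=
  Num.sqrt (n%:R * h) * (n%:R^-1 *
    \sum_(0 <= i < n) (Kh K h (u - F (b i w))
       - fine ('E_P[fun w' => Kh K h (u - F (b i w'))])%E)).

End prob.

(* Main.v *)
Require Import Defs.
From HB Require Import structures.
From mathcomp Require Import all_boot all_order all_algebra.
From mathcomp Require Import all_classical all_reals all_analysis.
From mathcomp Require Import measurable_realfun ring lra.
Import Order.TTheory GRing.Theory Num.Theory.
Import numFieldNormedType.Exports.
Local Open Scope classical_set_scope.
Local Open Scope ring_scope.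

(* Put U_l = F (b_l), so that b_l = Q (U_l) almost surely, and let al_n be the
   difference between the empirical distribution function of U_0, ..., U_{n-1}
   and the identity.  Two almost sure facts drive the proof: the modulus of
   continuity of al_n at scale delta is of order sqrt (delta * ln n / n), and
   al_n is uniformly of order sqrt (ln (ln n) / n).  Since
   al_n (U_(k)) = k/n - U_(k), they give Bahadur's representation
   U_(k) = k/n - al_n (k/n) + O (n^(-3/4) * ell n).  Inserted into
   qhat = sum_i K_h (u - i/n) (Q (U_(i+1)) - Q (U_(i))), Abel summation costs a
   factor 1/h and leaves qhat = q (1 - Y) + error, where
   Y = sum_i K_h (u - i/n) (al_n ((i+1)/n) - al_n (i/n)) is a Riemann-Stieltjes
   sum for G_{n,h} (u) / sqrt (n h).  Dividing by qhat, which is bounded below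
   because no interval of length of order h contains too many observations, yields the
   claim as long as n h is at least a multiple of ln n.  For smaller n h the rate
   exceeds n^(1/4) / sqrt (n h), and it is enough to know that qhat is at least
   n^(-1/8) / (n h) up to a constant: no interval of length n^(-9/8) contains 40
   observations. *)
Set Implicit Arguments.
Unset Strict Implicit.
Unset Printing Implicit Defensive.

(** * Borel-Cantelli and exponential bounds for counts *)

(** The bandwidth is an arbitrary sequence and [u] ranges over an interval, so no event below
    mentions [h] or [u]: three almost sure bounds on counts of sample points in grid intervals are
    established, and all that follows them is a deterministic estimate for one sample, one [n] and
    one [u]. The probabilistic tool behind the three is Chernoff's bound for independent indicators.
    A union over polynomially many grid intervals in [n] produces the logarithm in the modulus; a
    union over polynomially many blocks and levels in [j], of order [ln n], produces the iterated
    logarithm. The centering of the kernel sums and the integral of [K] are compared with one and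
    the same Riemann sum over the grid [i / n]. The obstacle is that [n h] may grow arbitrarily
    slowly: below [ln n] the count deviations are of Poisson type, no longer small relative to
    [n h], so [Y] need not stay bounded and the linearization is lost. This forces a second regime,
    in which nothing is expanded. *)

Section small_events.
Context {d : measure_display} {T : measurableType d} {R : realType}.
Variable P : probability T R.

(* Avoids proving measurability of the events that are only bounded from above. *)
Definition small (E : set T) (e : R) : Prop :=
  exists A, [/\ measurable A, E `<=` A & (P A <= e%:E)%E].

Lemma small_sub (E E' : set T) (e e' : R) :
  E `<=` E' -> e' <= e -> small E' e' -> small E e.
Proof.
move=> EE' ee' [A [mA E'A PA]]; exists A; split=> //; first exact: subset_trans E'A.
by apply: le_trans PA _; rewrite lee_fin.
Qed.

Lemma small_setU (E E' : set T) (e e' : R) :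
  small E e -> small E' e' -> small (E `|` E') (e + e').
Proof.
move=> [A [mA EA PA]] [B [mB EB PB]]; exists (A `|` B); split.
- exact: measurableU.
- exact: setUSS.
- apply: le_trans (measureU2 _ mA mB) _.
  by rewrite EFinD leeD.
Qed.

Lemma small_bigU (I : eqType) (s : seq I) (E : I -> set T) (e : I -> R) :
  (forall i, i \in s -> small (E i) (e i)) ->
  small [set w | exists2 i, i \in s & E i w] (\sum_(i <- s) e i).
Proof.
elim: s => [|i s IH] sE.
  rewrite big_nil; exists set0; split=> //; last by rewrite measure0.
  by move=> w [].
rewrite big_cons.
have h1 : small (E i) (e i) by apply: sE; rewrite mem_head.
have h2 := IH (fun j (js : j \in s) => sE j (@mem_behead _ (i :: s) j js)).
apply: small_sub (small_setU h1 h2) => // w [j].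
by rewrite inE => /orP[/eqP->|js] Ej; [left|right; exists j].
Qed.

Lemma small_bigU_const (I : eqType) (s : seq I) (E : I -> set T) (e : R) :
  (forall i, i \in s -> small (E i) e) ->
  small [set w | exists2 i, i \in s & E i w] ((size s)%:R * e).
Proof.
by move=> /small_bigU; rewrite big_const_seq count_predT iter_addr_0 mulr_natl.
Qed.

(** Induction on the sharper telescoping bound [2 - 2 / n]; the term [k = 0] vanishes because
    [0^-1 = 0]. *)
Lemma sum_inv_sqr_le2 n : \sum_(0 <= k < n) (k%:R ^+ 2 : R)^-1 <= 2.
Proof.
suff : \sum_(0 <= k < n.+1) (k%:R ^+ 2 : R)^-1 <= 2 - 2 / n.+1%:R.
  move=> /le_trans h; apply: (@le_trans _ _ (\sum_(0 <= k < n.+1) (k%:R ^+ 2)^-1)).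
    by rewrite big_nat_recr //= lerDl invr_ge0 exprn_ge0.
  by apply: h; rewrite gerBl divr_ge0.
elim: n => [|n IH]; first by rewrite big_nat1 expr0n invr0 divr1 subrr.
rewrite big_nat_recr //=; apply: le_trans (lerD IH (lexx _)) _.
have -> : n.+2%:R = n.+1%:R + 1 :> R by rewrite -(natrD _ n.+1 1) addn1.
have : 1 <= n.+1%:R :> R by rewrite ler1n.
set x : R := n.+1%:R => x1.
rewrite -subr_ge0.
have -> : 2 - 2 / (x + 1) - (2 - 2 / x + (x ^+ 2)^-1) = (x - 1) / (x ^+ 2 * (x + 1)).
  by field; apply/andP; split; apply/eqP; lra.
by rewrite divr_ge0 ?mulr_ge0 ?exprn_ge0 //; lra.
Qed.

Lemma borel_cantelli (E : nat -> set T) (c : R) (N : nat) :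
  0 <= c -> (forall n, (N <= n)%N -> small (E n) (c / n%:R ^+ 2)) ->
  {ae P, forall w, exists M, forall n, (M <= n)%N -> ~ E n w}.
Proof.
move=> c0 sE.
(* Each event gets a measurable cover, empty below [N], so that the series of probabilities is
   bounded from index 0 on. *)
have /choice[A mA] : forall n, exists A, [/\ measurable A,
    (N <= n)%N -> E n `<=` A & (P A <= (c / n%:R ^+ 2)%:E)%E].
  move=> n; case: (leqP N n) => Nn.
    by have [A [mA EA PA]] := sE _ Nn; exists A; split.
  exists set0; split=> //; rewrite measure0 lee_fin.
  by rewrite divr_ge0 // exprn_ge0.
exists (lim_sup_set A); split.
- apply: bigcapT_measurable => k; apply: bigcup_measurable => j _.
  by have [] := mA j.
- apply: lim_sup_set_cvg0 => [k|]; first by have [] := mA k.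
  apply: (@le_lt_trans _ _ (c * 2)%:E); last exact: ltry.
  apply: lime_le; first by apply: is_cvg_nneseries => n _ _; exact: measure_ge0.
  apply: nearW => n.
  apply: (@le_trans _ _ (\sum_(0 <= k < n) (c / k%:R ^+ 2)%:E)%E).
    by apply: lee_sum => k _; have [] := mA k.
  rewrite sumEFin lee_fin -mulr_sumr ler_wpM2l //.
  exact: sum_inv_sqr_le2.
- move=> w /= nE n _; apply: contrapT => nA; apply: nE.
  exists (maxn n N) => k; rewrite geq_max => /andP[nk Nk] Ek.
  apply: nA; exists k => //=; have [_ + _] := mA k.
  exact.
Qed.

End small_events.

(** The starting index [m] is kept because sample sizes are compared later: the indices in [[m, n[]
    are what the sample gains in passing from size [m] to size [n]. *)
Definition cnt {R : realType} (x : nat -> R) (B : pred R) (m n : nat) : nat :=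
  \sum_(m <= l < n) B (x l).

Section independent_counts.
Context {d : measure_display} {T : measurableType d} {R : realType}.
Variables (P : probability T R) (b : nat -> T -> R).
Hypothesis b_meas : forall i, measurable_fun setT (b i).
Hypothesis b_indep : mutually_independent P b.

Lemma measurable_preim l (C : set R) : measurable C -> measurable (b l @^-1` C).
Proof. by move=> mC; rewrite -[X in measurable X]setTI; exact: (b_meas _ measurableT). Qed.

(** The law of a whole success-failure pattern is all that the exponential bound below takes from
    independence. *)
Lemma prob_pattern (B : pred R) (p : R) (m k : nat) (f : {ffun 'I_k -> bool}) :
  measurable [set r | B r] ->
  (forall l, P (b l @^-1` [set r | B r]) = p%:E) ->
  small P [set w | forall i : 'I_k, B (b (m + i)%N w) = f i]
    (\prod_(i < k) (if f i then p else 1 - p)).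
Proof.
move=> mB PB.
(* [g] carries the pattern to absolute indices; the default [true] only completes the family of
   sets, which independence wants for every index. *)
pose g l := odflt true (omap f (insub (l - m)%N)).
have gE (i : 'I_k) : g (m + i)%N = f i by rewrite /g addKn valK.
pose C l := if g l then [set r | B r] else ~` [set r | B r].
have mC l : measurable (C l) by rewrite /C; case: (g l) => //; exact: measurableC.
have mbC l : measurable (b l @^-1` C l) by exact: measurable_preim.
have PC l : P (b l @^-1` C l) = (if g l then p else 1 - p)%:E.
  rewrite /C; case: (g l); first exact: PB.
  rewrite preimage_setC probability_setC; first by rewrite PB EFinB.
  exact: (measurable_preim l mB).
exists (\bigcap_(i in [set i | i \in iota m k]) (b i @^-1` C i)); split.
- by apply: bigcap_measurableType => l _.
- move=> w /= wf l /=; rewrite mem_iota => /andP[ml lk].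
  have lmk : (l - m < k)%N by rewrite ltn_subLR.
  have := wf (Ordinal lmk); rewrite /= subnKC // => Bl.
  rewrite /C; have := gE (Ordinal lmk); rewrite /= subnKC // => ->.
  by rewrite -Bl; case: ifP => //= ->.
- rewrite b_indep ?iota_uniq //.
  under eq_bigr do rewrite PC.
  rewrite prodEFin lee_fin -{1}[m]addn0 iotaDl big_map.
  rewrite -{1}[k]subn0 -/(index_iota 0 k) big_mkord.
  by under eq_bigr do rewrite gE.
Qed.

Lemma cnt_ord (x : nat -> R) (B : pred R) m k :
  cnt x B m (m + k) = (\sum_(i < k) B (x (m + i)%N))%N.
Proof.
rewrite /cnt -{1}[m]add0n big_addn addKn big_mkord.
by apply: eq_bigr => i _; rewrite addnC.
Qed.

(** Chernoff's inequality by finite summation: the weight of each pattern in the event is multiplied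
    by [expR (th * (count - a)) >= 1], the sum is extended to all patterns, and it factorizes into
    [(1 - p + p * expR th) ^ k]. Positive [th] gives the upper tail, negative [th] the lower one. *)
Lemma cnt_chernoff (B : pred R) (p th a : R) (m k : nat) :
  measurable [set r | B r] ->
  (forall l, P (b l @^-1` [set r | B r]) = p%:E) ->
  small P [set w | 0 <= th * ((cnt (b^~ w) B m (m + k))%:R - a)]
    (expR (k%:R * p * (expR th - 1) - th * a)).
Proof.
move=> mB PB.
have p0 : 0 <= p by rewrite -lee_fin -(PB 0%N) measure_ge0.
have p1 : p <= 1.
  rewrite -lee_fin -(PB 0%N) probability_le1 //.
  exact: (measurable_preim 0 mB).
pose wt (f : {ffun 'I_k -> bool}) : R := \prod_(i < k) (if f i then p else 1 - p).
pose s := [seq f : {ffun 'I_k -> bool} <- enum {ffun 'I_k -> bool} | 0 <= th * ((\sum_(i < k) f i)%N%:R - a)].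
have h : forall f, f \in s ->
    small P [set w | forall i : 'I_k, B (b (m + i)%N w) = f i] (wt f).
  by move=> f _; exact: prob_pattern.
have := small_bigU h; apply: small_sub.
  move=> w /= wth; exists [ffun i : 'I_k => B (b (m + i)%N w)]; last first.
    by move=> i; rewrite ffunE.
  rewrite mem_filter mem_enum andbT.
  rewrite (eq_bigr (fun i : 'I_k => nat_of_bool (B (b (m + i)%N w)))) => [|i _].
    by rewrite -(cnt_ord (b^~ w)).
  by rewrite ffunE.
rewrite big_filter big_enum_cond /=.
have wt0 f : 0 <= wt f by apply: prodr_ge0 => i _; case: ifP => _ //; lra.
apply: (@le_trans _ _ (\sum_(f : {ffun 'I_k -> bool}) expR (- (th * a)) * 
    \prod_(i < k) (if f i then p * expR th else 1 - p))).
  apply: (@le_trans _ _ (\sum_(f : {ffun 'I_k -> bool} | 0 <= th * ((\sum_(i < k) f i)%N%:R - a))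
     (expR (- (th * a)) * \prod_(i < k) (if f i then p * expR th else 1 - p)))).
    apply: ler_sum => f; rewrite mulrBr => thf.
    have -> : \prod_(i < k) (if f i then p * expR th else 1 - p) =
       wt f * expR (th * (\sum_(i < k) f i)%N%:R).
      rewrite natr_sum mulr_sumr expR_sum -big_split /=.
      by apply: eq_bigr => i _; case: (f i); rewrite ?mulr1 ?mulr0 ?expR0 ?mulr1.
    rewrite mulrCA -expRD -[leLHS]mulr1 ler_wpM2l //.
    by rewrite -[leLHS]expR0 ler_expR addrC.
  rewrite [leRHS](bigID (fun f : {ffun 'I_k -> bool} => 0 <= th * ((\sum_(i < k) f i)%N%:R - a))) /=.
  rewrite lerDl sumr_ge0 // => f _; rewrite mulr_ge0 ?expR_ge0 //.
  apply: prodr_ge0 => i _; case: ifP => _; last lra.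
  by rewrite mulr_ge0 ?expR_ge0.
rewrite -mulr_sumr -(bigA_distr_bigA (fun (i : 'I_k) (c : bool) => if c then p * expR th else 1 - p)).
rewrite expRD mulrC ler_wpM2r ?expR_ge0 //.
under eq_bigr do rewrite big_bool /=.
rewrite prodr_const card_ord -mulrA expRM_natl.
rewrite lerXn2r ?nnegrE ?expR_ge0 //.
  by rewrite addr_ge0 ?mulr_ge0 ?expR_ge0 //; lra.
have := expR_ge1Dx (p * (expR th - 1)).
lra.
Qed.

(** From [1 - x <= expR (- x)] one gets [expR x <= (1 - x)^-1], and the quadratic exceeds
    [(1 - x)^-1] by [x^2 (1 - 2 x) / (1 - x)]. *)
Lemma expR_le_quad (x : R) : `|x| <= 2^-1 -> expR x <= 1 + x + 2 * x ^+ 2.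
Proof.
rewrite ler_norml => /andP[x1 x2].
have h := expR_ge1Dx (- x).
have y0 : 0 < 1 - x by lra.
have : expR x <= (1 - x)^-1.
  rewrite -[expR x]invrK -expRN lef_pV2 ?posrE ?expR_gt0 //.
move=> /le_trans; apply.
rewrite -subr_ge0.
have -> : 1 + x + 2 * x ^+ 2 - (1 - x)^-1 = x ^+ 2 * (1 - 2 * x) / (1 - x).
  by field; apply/eqP; lra.
have z0 : 0 <= 1 - 2 * x by lra.
apply: divr_ge0 (ltW y0); exact: mulr_ge0 (sqr_ge0 _) z0.
Qed.

(** [cnt_chernoff] with [|th| = sqrt (lam / (mu + lam)) / 2 <= 1/2] and either sign. The quadratic
    term costs [2 th^2 mu <= lam / 2] and the threshold gains [13/2 lam], so 13 leaves the exponent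
    [-6 lam]. For [lam = ln n] this is [n^-6], enough for a union over all triples of grid
    indices. *)
Lemma cnt_bernstein (B : pred R) (p lam : R) (m n : nat) :
  measurable [set r | B r] ->
  (forall l, P (b l @^-1` [set r | B r]) = p%:E) ->
  0 < lam -> (m <= n)%N ->
  let mu := (n - m)%:R * p in
  small P [set w | 13 * Num.sqrt ((mu + lam) * lam) <
                   `|(cnt (b^~ w) B m n)%:R - mu| ]
    (2 * expR (- (6 * lam))).
Proof.
move=> mB PB lam0 mn mu.
have p0 : 0 <= p by rewrite -lee_fin -(PB 0%N) measure_ge0.
have mu0 : 0 <= mu by rewrite mulr_ge0.
set t := 13 * _.
pose th := Num.sqrt (lam / (mu + lam)) / 2.
have ml : 0 < mu + lam by lra.
have th0 : 0 <= th by rewrite divr_ge0 ?sqrtr_ge0.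
have th2 : th ^+ 2 = lam / (mu + lam) / 4.
  by rewrite /th exprMn sqr_sqrtr ?divr_ge0 ?ltW //; field; rewrite gt_eqF.
have th1 : th <= 2^-1.
  have : Num.sqrt (lam / (mu + lam)) <= 1.
    by rewrite -[leRHS]sqrtr1 ler_wsqrtr // ler_pdivrMr // mul1r lerDr.
  rewrite /th; lra.
have tht : th * t = 13 / 2 * lam.
  have xy : Num.sqrt (lam / (mu + lam)) * Num.sqrt ((mu + lam) * lam) = lam.
    rewrite -sqrtrM ?divr_ge0 ?(ltW lam0) ?(ltW ml) //.
    have -> : lam / (mu + lam) * ((mu + lam) * lam) = lam ^+ 2.
      by field; rewrite gt_eqF.
    by rewrite sqrtr_sqr gtr0_norm.
  by rewrite -[in RHS]xy /th /t; field.
have key (e : R) : `|e| = 1 ->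
    small P [set w | 0 <= e * th * ((cnt (b^~ w) B m n)%:R - (mu + e * t))]
      (expR (- (6 * lam))).
  move=> e1; rewrite -{1}(subnKC mn); apply: small_sub (cnt_chernoff (e * th) (mu + e * t) m (n - m) mB PB) => //.
  rewrite ler_expR -/mu.
  have e2 : e ^+ 2 = 1 by rewrite -real_normK ?num_real // e1 expr1n.
  have -> : e * th * (mu + e * t) = e * th * mu + e ^+ 2 * (th * t) by ring.
  rewrite e2 mul1r tht.
  have : expR (e * th) <= 1 + e * th + 2 * (e * th) ^+ 2.
    by apply: expR_le_quad; rewrite normrM e1 mul1r ger0_norm.
  rewrite exprMn e2 mul1r th2 => h.
  have : mu * (expR (e * th) - 1) <= mu * (e * th + 2 * (lam / (mu + lam) / 4)).
    by rewrite ler_wpM2l //; lra.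
  have : mu * (2 * (lam / (mu + lam) / 4)) <= lam / 2.
    have -> : mu * (2 * (lam / (mu + lam) / 4)) = lam / 2 * (mu / (mu + lam)).
      by field; rewrite gt_eqF.
    rewrite -[leRHS]mulr1 ler_wpM2l //; first lra.
    by rewrite ler_pdivrMr //; lra.
  lra.
have k1 := key 1 (normr1 _).
have k2 := key (-1) (normrN1 _).
have -> : 2 * expR (- (6 * lam)) = expR (- (6 * lam)) + expR (- (6 * lam)) by ring.
apply: small_sub (small_setU k1 k2) => // w /=; rewrite ltr_normr => /orP[h|h].
- by left => /=; rewrite mul1r mul1r mulr_ge0 //; lra.
- right => /=; have -> : -1 * th * ((cnt (b^~ w) B m n)%:R - (mu + -1 * t))
    = th * (- ((cnt (b^~ w) B m n)%:R - mu) - t) by ring.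
  by rewrite mulr_ge0 //; lra.
Qed.

End independent_counts.

(** * Almost sure bounds for counts on grids *)

Section as_events.
Context {R : realType}.
Implicit Types U : nat -> R.

Definition cnt_itv U (x y : R) (m n : nat) : nat := cnt U (fun r => x < r <= y) m n.

(** Order of the deviation in Bernstein's inequality: [sqrt (m * lam)] while the mean [m] dominates
    [lam], and [lam] itself in the Poisson range. *)
Definition dev (lam : R) (m : R) : R := Num.sqrt ((m + lam) * lam).

(** The unit in which rates are measured: [n^(1/8)], [n^(1/4)] and [n^(1/2)] are its powers, and
    [ln n <= 16 * root16 n]. The exponent 1/16 keeps [(ln n)^2 * n^(1/8)] below a multiple of
    [n^(1/4)], as small bandwidths require. *)
Definition root16 (n : nat) : R := n%:R `^ 16^-1.

Definition mesh (n : nat) : R := (n%:R * root16 n ^+ 2)^-1.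

(* Starting points of the blocks into which [2^j, 2^(j+1)[ is cut; there are
   about j of them, few enough for a union bound with probabilities polynomial
   in 1/j. *)
Definition block (j i : nat) : nat := (2 ^ j + i * (2 ^ j %/ j))%N.

(** The index [i] runs to [2 * j] because rounding in [2 ^ j %/ j] can create more than [j]
    blocks. *)
Definition block_bound U : Prop := exists J, forall j, (J <= j)%N ->
  forall i g, (i <= 2 * j)%N -> (g <= j)%N ->
  `|(cnt_itv U 0 (g%:R / j%:R) 0 (block j i))%:R - (block j i)%:R * (g%:R / j%:R)|
    <= 13 * dev (ln j%:R) ((block j i)%:R * (g%:R / j%:R)).

Definition grid_bound U : Prop := exists N, forall n, (N <= n)%N ->
  forall m i j, (m <= n)%N -> (i <= j)%N -> (j <= n)%N ->
  `|(cnt_itv U (i%:R / n%:R) (j%:R / n%:R) m n)%:R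
     - (n - m)%:R * (j%:R / n%:R - i%:R / n%:R)|
    <= 13 * dev (ln n%:R) ((n - m)%:R * (j%:R / n%:R - i%:R / n%:R)).

(** Two neighbouring cells are joined so that an interval of length [mesh n] inside the unit
    interval always lies in one of the unions; the cut at 1 keeps the endpoints where the law of [U]
    is known. *)
Definition mesh_bound U : Prop := exists N, forall n, (N <= n)%N ->
  forall i, (i <= n ^ 2)%N -> i%:R * mesh n <= 1 ->
  (cnt_itv U (i%:R * mesh n) (Num.min 1 (i.+2%:R * mesh n))%R 0 n < 40)%N.

Lemma root16_exp n : root16 n ^+ 16 = n%:R.
Proof.
rewrite /root16 -powR_mulrn ?powR_ge0 // -powRrM mulVf ?pnatr_eq0 //.
by rewrite powRr1.
Qed.

Lemma root16_ge1 n : (0 < n)%N -> 1 <= root16 n.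
Proof.
move=> n0; rewrite leNgt; apply/negP => h.
have : root16 n ^+ 16 < 1 by rewrite exprn_ilt1 // powR_ge0.
by rewrite root16_exp ltrn1 ltnNge n0.
Qed.

Lemma root16_large (a : R) : exists N, forall n, (N <= n)%N -> a <= root16 n.
Proof.
exists (Num.truncn (`|a| ^+ 16)).+1 => n nN; rewrite leNgt; apply/negP => h.
have : root16 n ^+ 16 < `|a| ^+ 16.
  by rewrite ltrXn2r ?nnegrE ?powR_ge0 // (lt_le_trans h) // ler_norm.
rewrite root16_exp ltNge => /negP; apply.
apply: le_trans (ltW (truncnS_gt _)) _.
by rewrite ler_nat.
Qed.

End as_events.

(** * Probabilities of the exceptional grid events *)

Section as_events_prob.
Context {d : measure_display} {T : measurableType d} {R : realType}.
Variables (P : probability T R) (b : nat -> T -> R) (F Q : R -> R).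
Hypothesis b_meas : forall i, measurable_fun setT (b i).
Hypothesis b_indep : mutually_independent P b.
Let U w l := F (b l w).
Let I x y := [pred r | Q x < r <= Q y].
Hypothesis prob_itv : forall l (x y : R), 0 <= x -> x <= y -> y <= 1 ->
  P (b l @^-1` [set r | I x y r]) = (y - x)%:E.
Hypothesis itvE : {ae P, forall w, forall l (x y : R), 0 <= x -> x <= y -> y <= 1 ->
  I x y (b l w) = (x < U w l <= y)}.

Lemma measurable_quantile_itv x y : measurable [set r | I x y r].
Proof.
have -> : [set r | I x y r] = `]Q x, Q y]%classic by apply/seteqP; split => r /=; rewrite in_itv.
exact: measurable_itv.
Qed.

(** Independence and probabilities are available for the bid events [Q x < b <= Q y], whereas the
    analysis counts [U = F b]; almost surely both counts agree, for all intervals at once. *)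
Lemma cnt_itvE : {ae P, forall w, forall (x y : R), 0 <= x -> x <= y -> y <= 1 ->
   forall m n, cnt_itv (U w) x y m n = cnt (b^~ w) (I x y) m n}.
Proof.
move: itvE; apply: filterS => w wE x y x0 xy y1 m n.
by apply: eq_bigr => l _; rewrite wE.
Qed.

Lemma expRN6ln n : (0 < n)%N -> expR (- (6 * ln n%:R)) = (n%:R ^+ 6 : R)^-1.
Proof.
by move=> n0; rewrite expRN expRM_natl lnK // posrE ltr0n.
Qed.

(** There are [(n + 1)^3 <= 8 n^3] triples, each failing with probability at most [2 n^-6]. *)
Lemma ae_grid_bound : {ae P, forall w, grid_bound (U w)}.
Proof.
pose E n : set T := [set w | exists2 t : 'I_n.+1 * ('I_n.+1 * 'I_n.+1),
  t \in enum {: 'I_n.+1 * ('I_n.+1 * 'I_n.+1)} &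
  (t.2.1 <= t.2.2)%N /\
  (13 : R) * dev (ln n%:R) ((n - t.1)%:R * (t.2.2%:R / n%:R - t.2.1%:R / n%:R)) <
  `|(cnt (b^~ w) (I (t.2.1%:R / n%:R) (t.2.2%:R / n%:R)) t.1 n)%:R
     - (n - t.1)%:R * (t.2.2%:R / n%:R - t.2.1%:R / n%:R)|].
have sE n : (2 <= n)%N -> small P (E n) (16 / n%:R ^+ 2).
  move=> n2; have n0 : (0 < n)%N by apply: leq_trans n2.
  have ln0 : 0 < ln n%:R :> R by rewrite ln_gt0 // ltr1n.
  have h := @small_bigU_const _ _ _ P _ (enum {: 'I_n.+1 * ('I_n.+1 * 'I_n.+1)})
    (fun t => [set w | (t.2.1 <= t.2.2)%N /\
  (13 : R) * dev (ln n%:R) ((n - t.1)%:R * (t.2.2%:R / n%:R - t.2.1%:R / n%:R)) <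
  `|(cnt (b^~ w) (I (t.2.1%:R / n%:R) (t.2.2%:R / n%:R)) t.1 n)%:R
     - (n - t.1)%:R * (t.2.2%:R / n%:R - t.2.1%:R / n%:R)|]) (2 * expR (- (6 * ln n%:R))).
  apply: small_sub (h _) => //.
    rewrite expRN6ln // -cardE !card_prod card_ord.
    have n1 : 1 <= n%:R :> R by rewrite ler1n.
    have nn0 : 0 < n%:R :> R by rewrite ltr0n.
    have -> : 16 / n%:R ^+ 2 = (8 * n%:R ^+ 4) * (2 * (n%:R ^+ 6)^-1) :> R.
      by field; rewrite gt_eqF.
    rewrite ler_wpM2r ?mulr_ge0 ?invr_ge0 ?exprn_ge0 //.
    rewrite !natrM -[n.+1]addn1 natrD.
    apply: (@le_trans _ _ ((2 * n%:R) * ((2 * n%:R) * (2 * n%:R)))).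
      by rewrite !ler_pM ?mulr_ge0 ?addr_ge0 //; lra.
    have -> : 2 * n%:R * (2 * n%:R * (2 * n%:R)) = 8 * n%:R ^+ 3 * 1 :> R by ring.
    have -> : 8 * n%:R ^+ 4 = 8 * n%:R ^+ 3 * n%:R :> R by ring.
    by rewrite ler_wpM2l // mulr_ge0 // exprn_ge0.
  move=> [m [i j]] _ /=.
  case: (leqP i j) => ij; last by exists set0; split => //; rewrite ?measure0 ?lee_fin ?mulr_ge0 ?expR_ge0 // => w [].
  have nn0 : 0 < n%:R :> R by rewrite ltr0n.
  have mn : (m <= n)%N by rewrite -ltnS.
  have := cnt_bernstein b_meas b_indep (measurable_quantile_itv (i%:R / n%:R) (j%:R / n%:R)) _ ln0 mn.
  move=> /(_ (j%:R / n%:R - i%:R / n%:R)) /=.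
  move=> hh; apply: small_sub (hh _) => // [w [_]//|l].
  apply: prob_itv; rewrite ?divr_ge0 ?ler_pM2r ?invr_gt0 ?ler_nat //.
  by rewrite ler_pdivrMr // mul1r ler_nat -ltnS.
have := borel_cantelli (ler0n R 16) sE.
apply: filterS2 cnt_itvE => w cE [N0 hN]; exists (maxn N0 1) => n.
rewrite geq_max => /andP[Nn n0] m i j mn ij jn.
have nn0 : 0 < n%:R :> R by rewrite ltr0n.
rewrite cE; last first.
- by rewrite ler_pdivrMr // mul1r ler_nat.
- by rewrite ler_pM2r ?invr_gt0 // ler_nat.
- by rewrite divr_ge0.
rewrite leNgt; apply/negP => h; apply: (hN n Nn).
have im : (i <= n)%N by apply: leq_trans jn.
exists (inord m, (inord i, inord j)); first by rewrite mem_enum.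
by rewrite /= !inordK.
Qed.

(** Borel-Cantelli runs over the dyadic exponent [j]: of order [j^2] events, each of probability at
    most [2 j^-6], are summable although [lam] is only [ln j], which is of order [ln (ln n)]. *)
Lemma ae_block_bound : {ae P, forall w, block_bound (U w)}.
Proof.
pose S j : seq (nat * nat) := [seq (i, g) | i <- iota 0 (2 * j).+1, g <- iota 0 j.+1].
pose E j (t : nat * nat) : set T := [set w | 
  (13 : R) * dev (ln j%:R) ((block j t.1)%:R * (t.2%:R / j%:R)) <
  `|(cnt (b^~ w) (I 0 (t.2%:R / j%:R)) 0 (block j t.1))%:R - (block j t.1)%:R * (t.2%:R / j%:R)|].
have sE j : (2 <= j)%N -> small P [set w | exists2 t, t \in S j & E j t w] (12 / j%:R ^+ 2).
  move=> j2; have j0 : (0 < j)%N by apply: leq_trans j2.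
  have ln0 : 0 < ln j%:R :> R by rewrite ln_gt0 // ltr1n.
  have nn0 : 0 < j%:R :> R by rewrite ltr0n.
  have h := @small_bigU_const _ _ _ P _ (S j) (E j) (2 * expR (- (6 * ln j%:R))).
  apply: small_sub (h _) => //.
    rewrite expRN6ln // size_allpairs !size_iota.
    have n1 : 1 <= j%:R :> R by rewrite ler1n.
    have -> : 12 / j%:R ^+ 2 = (6 * j%:R ^+ 4) * (2 * (j%:R ^+ 6)^-1) :> R.
      by field; rewrite gt_eqF.
    rewrite ler_wpM2r ?mulr_ge0 ?invr_ge0 ?exprn_ge0 //.
    rewrite natrM -[j.+1]addn1 natrD -[(2 * j).+1]addn1 natrD natrM.
    apply: (@le_trans _ _ ((3 * j%:R) * (2 * j%:R))).
      by rewrite !ler_pM ?mulr_ge0 ?addr_ge0 ?mulr_ge0 //; lra.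
    have -> : 3 * j%:R * (2 * j%:R) = 6 * j%:R ^+ 2 * 1 :> R by ring.
    have -> : 6 * j%:R ^+ 4 = 6 * j%:R ^+ 2 * j%:R ^+ 2 :> R by ring.
    by rewrite ler_wpM2l ?exprn_ege1 // mulr_ge0 // exprn_ge0.
  move=> _ /allpairsP[[i g] [_ + ->]]; rewrite mem_iota add0n ltnS => /andP[_ gj].
  have := cnt_bernstein b_meas b_indep (measurable_quantile_itv 0 (g%:R / j%:R)) _ ln0 (leq0n (block j i)).
  move=> /(_ (g%:R / j%:R)) /=; rewrite subn0.
  move=> hh; apply: small_sub (hh _) => // l.
  rewrite -[in RHS](subr0 (g%:R / j%:R)); apply: prob_itv; rewrite ?divr_ge0 //.
  by rewrite ler_pdivrMr // mul1r ler_nat.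
have := borel_cantelli (ler0n R 12) sE.
apply: filterS2 cnt_itvE => w cE [N0 hN]; exists (maxn N0 1) => j.
rewrite geq_max => /andP[Nn j0] i g ij gj.
have nn0 : 0 < j%:R :> R by rewrite ltr0n.
rewrite cE //; last by rewrite ler_pdivrMr // mul1r ler_nat.
rewrite leNgt; apply/negP => h; apply: (hN j Nn).
exists (i, g) => //; apply/allpairsP; exists (i, g).
by rewrite !mem_iota !add0n !ltnS ij gj.
Qed.

(** A union of two cells has expected count at most [2 n^(-1/8)], so 40 points occur with
    probability of order [(n^(-1/8))^40 = n^-5]; this survives the union over [n^2 + 1] starting
    cells and the summation over [n]. *)
Lemma ae_mesh_bound : {ae P, forall w, mesh_bound (U w)}.
Proof.
pose E (n i : nat) : set T := [set w | i%:R * mesh n <= (1 : R) /\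
  (40 <= cnt (b^~ w) (I (i%:R * mesh n) (Num.min 1 (i.+2%:R * mesh n))%R) 0 n)%N].
pose c : R := 2 * expR 1 * 2 ^+ 40.
have c0 : 0 <= c by rewrite !mulr_ge0 ?expR_ge0 ?exprn_ge0.
have [N1 hN1] := root16_large (2 : R).
have m0 n : 0 <= mesh n :> R by rewrite invr_ge0 mulr_ge0 ?sqr_ge0.
have mle n i : i%:R * mesh n <= (1 : R) -> i%:R * mesh n <= Num.min (1 : R) (i.+2%:R * mesh n).
  by move=> i1; rewrite le_min i1 ler_wpM2r ?ler_nat //= ltnW.
have sE n : (maxn 1 N1 <= n)%N ->
    small P [set w | exists2 i, i \in iota 0 (n ^ 2).+1 & E n i w] (c / n%:R ^+ 2).
  rewrite geq_max => /andP[n0 /hN1 t2].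
  have nn0 : 0 < n%:R :> R by rewrite ltr0n.
  have n1 : 1 <= n%:R :> R by rewrite ler1n.
  have h := @small_bigU_const _ _ _ P _ (iota 0 (n ^ 2).+1) (E n) (expR 1 * 2 ^+ 40 / n%:R ^+ 5).
  apply: small_sub (h _) => //.
    rewrite size_iota.
    have -> : c / n%:R ^+ 2 = (2 * n%:R ^+ 3) * (expR 1 * 2 ^+ 40 / n%:R ^+ 5).
      by rewrite /c; field; rewrite gt_eqF.
    rewrite ler_wpM2r ?mulr_ge0 ?invr_ge0 ?expR_ge0 ?exprn_ge0 //.
    rewrite -[(n ^ 2).+1]addn1 natrD natrX.
    have : 1 <= n%:R ^+ 2 :> R by rewrite exprn_ege1.
    have : n%:R ^+ 2 <= n%:R ^+ 3 :> R by rewrite ler_weXn2l.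
    lra.
  move=> i _; rewrite /E.
  case: (leP (i%:R * mesh n) (1 : R)) => [i1|i1]; last first.
    exists set0; split => //; last first.
      by rewrite measure0 lee_fin ?mulr_ge0 ?invr_ge0 ?expR_ge0 ?exprn_ge0.
    by move=> w [].
  set x := i%:R * mesh n in i1 *; set y := Num.min 1 (i.+2%:R * mesh n).
  have xy : x <= y by exact: mle.
  have t0 : 0 < root16 n :> R by rewrite (lt_le_trans _ t2).
  have yx : y - x <= 2 * mesh n.
    apply: (@le_trans _ _ (i.+2%:R * mesh n - x)); first by rewrite lerB // ge_min lexx orbT.
    by rewrite /x -[i.+2]addn2 natrD mulrDl addrC addKr.
  (* This [th] makes [n * (2 * mesh n) * expR th = 1], so that only [expR (- (40 * th))] and a
     factor [expR 1] remain. *)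
  pose th : R := ln (root16 n ^+ 2 / 2).
  have ypos : 0 < root16 n ^+ 2 / 2 :> R by rewrite divr_gt0 // exprn_gt0.
  have eth : expR th = root16 n ^+ 2 / 2 by rewrite lnK.
  have th0 : 0 <= th.
    rewrite ln_ge0 // ler_pdivlMr // mul1r expr2.
    by rewrite (le_trans t2) // ler_peMr ?ltW //; lra.
  have hc := cnt_chernoff b_meas b_indep th 40%:R 0 n (measurable_quantile_itv x y).
  apply: small_sub (hc (y - x) _) => /=.
  - by move=> w [_ w40] /=; rewrite mulr_ge0 // subr_ge0 ler_nat add0n.
  - rewrite expRD expRN mulrC [th * _]mulrC expRM_natl eth.
    have -> : expR 1 * 2 ^+ 40 / n%:R ^+ 5 = ((root16 n ^+ 2 / 2) ^+ 40)^-1 * expR 1 :> R.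
      have -> : n%:R ^+ 5 = root16 n ^+ 80 :> R.
        by have := congr1 (fun z : R => z ^+ 5) (@root16_exp R n); rewrite -exprM => <-.
      rewrite expr_div_n -exprM invf_div [RHS]mulrC; exact/esym/mulrA.
    rewrite ler_wpM2l ?invr_ge0 ?exprn_ge0 ?(ltW ypos) // ler_expR.
    move: eth ypos; set z := root16 n ^+ 2 / 2 => _ z0.
    apply: (@le_trans _ _ (n%:R * (2 * mesh n) * z)).
      rewrite -subr_ge0.
      have -> : n%:R * (2 * mesh n) * z - n%:R * (y - x) * (z - 1) =
         n%:R * (2 * mesh n - (y - x)) * z + n%:R * (y - x) by ring.
      have h1 : 0 <= 2 * mesh n - (y - x) by rewrite subr_ge0.
      have h2 : 0 <= y - x by rewrite subr_ge0.
      by rewrite addr_ge0 // !mulr_ge0 // ltW.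
    rewrite /z /mesh.
    have -> : n%:R * (2 * (n%:R * root16 n ^+ 2)^-1) * (root16 n ^+ 2 / 2) = 1 :> R.
      by field; rewrite !gt_eqF.
    by [].
  - move=> l; apply: prob_itv => //; first by rewrite mulr_ge0.
    by rewrite ge_min lexx.
have := borel_cantelli c0 sE.
apply: filterS2 cnt_itvE => w cE [N0 hN]; exists N0 => n Nn i ni i1.
rewrite cE //; last first.
- by rewrite ge_min lexx.
- exact: mle.
- by rewrite mulr_ge0.
rewrite ltnNge; apply/negP => h; apply: (hN n Nn).
by exists i => //; rewrite mem_iota add0n ltnS.
Qed.

End as_events_prob.

(** * The empirical process *)

Section modulus.
Context {R : realType}.
Implicit Types (U : nat -> R) (x y lam : R).

Lemma dev_ge0 lam x : 0 <= dev lam x. Proof. exact: sqrtr_ge0. Qed.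

Lemma le_dev lam x y : 0 <= lam -> x <= y -> dev lam x <= dev lam y.
Proof. by move=> l0 xy; rewrite ler_wsqrtr // ler_wpM2r // lerD2r. Qed.

Lemma dev_ge lam x : 0 <= lam -> 0 <= x -> lam <= dev lam x.
Proof.
move=> l0 x0; rewrite -{1}(ger0_norm l0) -sqrtr_sqr ler_wsqrtr //.
by rewrite expr2 ler_wpM2r // lerDr.
Qed.

Lemma dev_le_sum lam x : 0 <= lam -> 0 <= x -> dev lam x <= x + lam.
Proof.
move=> l0 x0; have xl : 0 <= x + lam by rewrite addr_ge0.
by rewrite -(ger0_norm xl) -sqrtr_sqr ler_wsqrtr // expr2 ler_wpM2l // lerDr.
Qed.

Lemma dev_le_sqrt lam x z : 0 <= z -> (x + lam) * lam <= z ^+ 2 -> dev lam x <= z.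
Proof. by move=> z0 h; rewrite -(ger0_norm z0) -sqrtr_sqr ler_wsqrtr. Qed.

(** Replacing an interval by its grid hull raises the expected count by at most 2; this is the
    price. *)
Lemma dev_add2 lam x : 1 <= lam -> 0 <= x -> dev lam (x + 2) <= 2 * dev lam x.
Proof.
move=> l1 x0; apply: dev_le_sqrt; first by rewrite mulr_ge0 ?dev_ge0.
rewrite exprMn sqr_sqrtr; last by rewrite mulr_ge0; lra.
nra.
Qed.

Lemma cnt_itv_sub U x y x' y' m n : x' <= x -> y <= y' ->
  (cnt_itv U x y m n <= cnt_itv U x' y' m n)%N.
Proof.
move=> xx yy; apply: leq_sum => l _; case: (boolP (_ < _ <= _)) => // /andP[h1 h2].
by rewrite (le_lt_trans xx h1) (le_trans h2 yy).
Qed.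

Lemma cnt_itv_cat U x y z m n : x <= y -> y <= z ->
  cnt_itv U x z m n = (cnt_itv U x y m n + cnt_itv U y z m n)%N.
Proof.
move=> xy yz; rewrite /cnt_itv /cnt -big_split; apply: eq_bigr => l _ /=.
case: (ltP x (U l)) => h1; case: (leP (U l) y) => h2 /=; rewrite ?addn0 //.
- by rewrite (le_trans h2 yz).
- by have := lt_le_trans h2 (le_trans h1 xy); rewrite ltxx.
Qed.

Lemma cnt_itv_split U x y m k n : (m <= k)%N -> (k <= n)%N ->
  cnt_itv U x y m n = (cnt_itv U x y m k + cnt_itv U x y k n)%N.
Proof. by move=> mk kn; rewrite /cnt_itv /cnt (big_cat_nat mk kn). Qed.

Lemma truncn_scaled (n : nat) x : 0 <= x -> (0 < n)%N ->
  ((Num.truncn (n%:R * x))%:R / n%:R <= x) /\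
  (x < (Num.truncn (n%:R * x)).+1%:R / n%:R).
Proof.
move=> x0 n0; have nn0 : 0 < n%:R :> R by rewrite ltr0n.
have /andP[] : (Num.truncn (n%:R * x))%:R <= n%:R * x < (Num.truncn (n%:R * x)).+1%:R.
  by apply: truncn_itv; rewrite mulr_ge0.
by rewrite ler_pdivrMr // ltr_pdivlMr // [x * _]mulrC.
Qed.

Lemma truncn_scaled_le (n : nat) x : x <= 1 -> (Num.truncn (n%:R * x) <= n)%N.
Proof.
move=> x1; rewrite truncn_le_nat (@le_lt_trans _ _ n%:R) ?ltr_nat //.
by rewrite ler_piMr.
Qed.

Definition modulus_bound U n : Prop :=
  forall m x y, (m <= n)%N -> 0 <= x -> x <= y -> y <= 1 ->
  `|(cnt_itv U x y m n)%:R - (n - m)%:R * (y - x)|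
    <= 28 * dev (ln n%:R) ((n - m)%:R * (y - x)).

Lemma ln_large (a : R) : exists N, forall n, (N <= n)%N -> a <= ln n%:R.
Proof.
exists (Num.truncn (expR a)).+1 => n nN; rewrite -ler_expR lnK.
  by apply: le_trans (ltW (truncnS_gt _)) _; rewrite ler_nat.
by rewrite posrE ltr0n (leq_trans _ nN).
Qed.

(** An interval is squeezed between grid intervals whose means differ from its own by at most 2. The
    outer deviation is at most [2 * 13] times [dev], and the shift of the mean is at most [2 * dev]
    because [dev >= ln n >= 1]; this gives 28. *)
Lemma grid_modulus_bound U : grid_bound U ->
  exists N, forall n, (N <= n)%N -> modulus_bound U n.
Proof.
move=> [N0 H]; have [N1 H1] := ln_large 1; exists (maxn 1 (maxn N0 N1)) => n.
rewrite !geq_max => /andP[n0 /andP[/H {}H /H1 L1]] m x y mn x0 xy y1.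
have nn0 : 0 < n%:R :> R by rewrite ltr0n.
have y0 := le_trans x0 xy; have x1 := le_trans xy y1.
have [ix xi] := truncn_scaled x0 n0.
have [jy yj] := truncn_scaled y0 n0.
set i := Num.truncn _ in ix xi; set j := Num.truncn _ in jy yj.
have jn : (j <= n)%N by exact: truncn_scaled_le.
have i_n : (i <= n)%N by exact: truncn_scaled_le.
have ij : (i <= j)%N by apply: le_truncn; rewrite ler_pM2l.
set L := ln n%:R in L1 H *; set k : R := (n - m)%:R.
have k0 : 0 <= k by [].
have kn : k / n%:R <= 1 by rewrite ler_pdivrMr // mul1r ler_nat leq_subr.
have S1 a : a.+1%:R / n%:R = a%:R / n%:R + n%:R^-1 :> R.
  by rewrite -addn1 natrD mulrDl mul1r.
set mu := k * (y - x).
have mu0 : 0 <= mu by rewrite mulr_ge0 // subr_ge0.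
have L0 : 0 <= L by lra.
have d1 : 1 <= dev L mu by rewrite (le_trans L1) // dev_ge.
rewrite ler_norml; apply/andP; split.
- case: (leqP i.+1 j) => i1j.
  + have := H m i.+1 j mn i1j jn; rewrite ler_norml => /andP[h _].
    have c : (cnt_itv U (i.+1%:R / n%:R) (j%:R / n%:R) m n)%:R <= (cnt_itv U x y m n)%:R :> R.
      by rewrite ler_nat cnt_itv_sub // ltW.
    rewrite -/k in h.
    have le1 : k * (j%:R / n%:R - i.+1%:R / n%:R) <= mu by rewrite ler_wpM2l // lerB // ltW.
    have ge1 : mu - 2 <= k * (j%:R / n%:R - i.+1%:R / n%:R).
      have : k * ((y - x) - (j%:R / n%:R - i.+1%:R / n%:R)) <= k * (2 / n%:R).
        by rewrite ler_wpM2l //; move: yj; rewrite !S1; lra.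
      by move: kn; rewrite /mu; lra.
    have := le_dev L0 le1; lra.
  (* [x] and [y] share a grid cell: there is no inner grid interval, but the mean is at most 1. *)
  + have : mu <= 1.
      apply: le_trans kn; rewrite ler_wpM2l //.
      have : j.+1%:R / n%:R <= i.+1%:R / n%:R :> R by rewrite ler_pM2r ?invr_gt0 // ler_nat.
      by move: yj; rewrite S1; lra.
    have : 0 <= (cnt_itv U x y m n)%:R :> R by [].
    by lra.
(* At [y = 1] the outer grid point [j + 1] would leave the unit interval, hence the minimum with
   [n]. *)
- pose j' := minn n j.+1.
  have ij' : (i <= j')%N by rewrite leq_min i_n leqW.
  have yj' : y <= j'%:R / n%:R.
    by rewrite /j' /minn; case: ifP => _; [rewrite divff ?gt_eqF | exact: ltW].
  have := H m i j' mn ij' (geq_minl _ _); rewrite ler_norml => /andP[_ h].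
  have c : (cnt_itv U x y m n)%:R <= (cnt_itv U (i%:R / n%:R) (j'%:R / n%:R) m n)%:R :> R.
    by rewrite ler_nat cnt_itv_sub.
  rewrite -/k in h.
  have j'j : j'%:R / n%:R <= j.+1%:R / n%:R :> R.
    by rewrite ler_pM2r ?invr_gt0 // ler_nat geq_minr.
  have le1 : k * (j'%:R / n%:R - i%:R / n%:R) <= mu + 2.
    have : k * ((j'%:R / n%:R - i%:R / n%:R) - (y - x)) <= k * (2 / n%:R).
      by rewrite ler_wpM2l //; move: xi j'j; rewrite !S1; lra.
    by move: kn; rewrite /mu; lra.
  have := le_dev L0 le1; have := dev_add2 L1 mu0; lra.
Qed.

End modulus.

(** * Uniform deviation of iterated logarithm order *)

Section uniform_deviation.
Context {R : realType}.
Implicit Types (U : nat -> R) (x y lam : R).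

Lemma ln2_bounds : 2^-1 <= ln (2 : R) <= 1.
Proof.
apply/andP; split.
- rewrite -ler_expR lnK ?posrE //.
  have := @expR_le_quad R (2^-1); rewrite ger0_norm // => /(_ (lexx _)); lra.
- by rewrite -ler_expR lnK ?posrE //; have := expR_ge1Dx (1 : R); lra.
Qed.

Lemma ln_le_id x : 0 < x -> ln x <= x.
Proof.
move=> x0; have := @le_ln1Dx R (x - 1).
have -> : 1 + (x - 1) = x by ring.
lra.
Qed.

Lemma ln_root16 n : (0 < n)%N -> ln n%:R = 16 * ln (root16 n) :> R.
Proof.
move=> n0; rewrite -(root16_exp n) lnXn; last by rewrite (lt_le_trans _ (root16_ge1 n0)).
by rewrite mulr_natl.
Qed.

Lemma ln_le_root16 n : (0 < n)%N -> ln n%:R <= 16 * root16 n :> R.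
Proof.
move=> n0; rewrite ln_root16 // ler_pM2l //; apply: ln_le_id.
by rewrite (lt_le_trans _ (root16_ge1 n0)).
Qed.

Lemma sqr_ln_le n : (0 < n)%N -> (ln n%:R) ^+ 2 <= 256 * n%:R :> R.
Proof.
move=> n0; have t1 := @root16_ge1 R _ n0.
have l0 : 0 <= ln n%:R :> R by rewrite ln_ge0 // ler1n.
have h := ln_le_root16 n0.
apply: (@le_trans _ _ ((16 * root16 n) ^+ 2)).
  by rewrite lerXn2r // nnegrE mulr_ge0 // (le_trans ler01).
rewrite exprMn -(root16_exp n).
have -> : (16 ^+ 2 = 256 :> R) by ring.
by rewrite ler_pM2l // ler_weXn2l.
Qed.

(** 1000 rounds up [13 * 2 + 28 * 17 + 28 * 17]: the grid level at the block start, the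
    interpolation between levels, and the growth inside the block. *)
Definition uniform_bound U n : Prop := forall x, 0 <= x -> x <= 1 ->
  `|(cnt_itv U 0 x 0 n)%:R - n%:R * x| <= 1000 * Num.sqrt (n%:R * ln (ln n%:R)).

(* Deviations at the start of a block are controlled on a grid of step 1/j and
   interpolated by the modulus of continuity; inside a block the sample grows
   by a factor 1 + 1/j only, so the crude bound for the increment suffices.  This
   gives log log n instead of log n. *)
Lemma block_uniform_bound U :
  block_bound U -> (exists N, forall n, (N <= n)%N -> modulus_bound U n) ->
  exists N, forall n, (N <= n)%N -> uniform_bound U n.
Proof.
move=> [J HJ] [N0 HN].
have [N1 H1] := @ln_large R (expR 1).
(* [2 * N0] makes the block start, which is at least [n / 2], reach [N0]; [2 ^ J] makes [j] reach
   [J]. *)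
exists (maxn (maxn 4 N1) (maxn (2 * N0) (2 ^ J))) => n.
rewrite !geq_max => /andP[/andP[n4 /H1 Le] /andP[nN0 nJ]] x x0 x1.
have n0 : (0 < n)%N by apply: leq_trans n4.
have nn0 : 0 < n%:R :> R by rewrite ltr0n.
pose j := trunc_log 2 n.
have /andP[jn nj] : (2 ^ j <= n < 2 ^ j.+1)%N by apply: trunc_log_bounds.
have j2 : (2 <= j)%N.
  by rewrite leqNgt; apply/negP => h; move: nj; rewrite ltnNge (leq_trans _ n4) // (leq_trans (leq_pexp2l _ h)).
have jJ : (J <= j)%N.
  by rewrite leqNgt; apply/negP => h; move: nj; rewrite ltnNge (leq_trans _ nJ) // leq_pexp2l.
have j0 : (0 < j)%N by apply: leq_trans j2.
have jj0 : 0 < j%:R :> R by rewrite ltr0n.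
pose s := (2 ^ j %/ j)%N.
have s0 : (0 < s)%N by rewrite divn_gt0 // ltnW // ltn_expl.
(* The last block whose start is at most [n]; fewer than [s] observations follow it. *)
pose i := ((n - 2 ^ j) %/ s)%N.
have is_n : (i * s <= n - 2 ^ j)%N by exact: leq_trunc_div.
(* Rounding at most doubles the number of blocks: [2 ^ j < (s + 1) * j] and [s >= 1]. *)
have i2j : (i <= 2 * j)%N.
  have h : (2 ^ j < s.+1 * j)%N by rewrite -ltn_divLR.
  have h2 : (i * s <= 2 ^ j)%N.
    by rewrite (leq_trans is_n) // leq_subLR addnn -mul2n -expnS ltnW.
  have h3 : (i * s < s * (2 * j))%N.
    rewrite (leq_ltn_trans h2) // (leq_trans h) //.
    by rewrite mulnA leq_mul2r muln2 -addnn -addn1 leq_add2l s0 orbT.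
  by rewrite ltnW // -(ltn_pmul2l s0) mulnC.
pose M := block j i.
have Mn : (M <= n)%N by rewrite /M /block -/s -leq_subRL // ?is_n // leq_subRL.
have nM : (n - M <= s)%N.
  rewrite /M /block -/s subnDA {1}(divn_eq (n - 2 ^ j) s) -/i addKn.
  by rewrite ltnW // ltn_mod.
have M2 : (n <= 2 * M)%N.
  by rewrite (leq_trans (ltnW nj)) // expnS leq_mul2l /= /M /block leq_addr.
have MN0 : (N0 <= M)%N by rewrite -(leq_pmul2l (isT : (0 < 2)%N)) (leq_trans nN0).
have M0 : (0 < M)%N by rewrite /M /block addn_gt0 expn_gt0.
have nN0' : (N0 <= n)%N by apply: leq_trans MN0 Mn.
set L := ln n%:R : R in Le *.
have e1 : 2 <= expR 1 :> R by have := expR_ge1Dx (1 : R); lra.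
have L0 : 0 < L by lra.
have LL1 : 1 <= ln L by rewrite -ler_expR lnK.
have /andP[l2a l2b] := ln2_bounds.
have lnX2 k : ln ((2 ^ k)%N%:R) = k%:R * ln 2 :> R by rewrite natrX lnXn // mulr_natl.
have L_2j : L <= 2 * j%:R.
  apply: (@le_trans _ _ (ln ((2 ^ j.+1)%N%:R))).
    by rewrite ler_ln ?posrE ?ltr0n ?expn_gt0 // ler_nat ltnW.
  rewrite lnX2.
  apply: (@le_trans _ _ (j.+1%:R * 1)); first by rewrite ler_wpM2l.
  rewrite mulr1 -[j.+1]addn1 natrD.
  have : 1 <= j%:R :> R by rewrite ler1n.
  lra.
have j_2L : j%:R <= 2 * L.
  have : ln ((2 ^ j)%N%:R) <= L by rewrite ler_ln ?posrE ?ltr0n ?expn_gt0 // ler_nat.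
  rewrite lnX2.
  have : j%:R * 2^-1 <= j%:R * ln 2 :> R by rewrite ler_wpM2l.
  lra.
have lnj : ln j%:R <= 2 * ln L.
  apply: (@le_trans _ _ (ln (2 * L))).
    by rewrite ler_ln ?posrE // mulr_gt0.
  rewrite lnM ?posrE //; lra.
have lnj0 : 0 <= ln j%:R :> R by rewrite ln_ge0 // ler1n.
pose g := Num.truncn (j%:R * x).
have [gx xg] := truncn_scaled x0 j0; rewrite -/g in gx xg.
have gj : (g <= j)%N by exact: truncn_scaled_le.
have g0 : 0 <= g%:R / j%:R :> R by rewrite divr_ge0.
have LM : ln M%:R <= L by rewrite ler_ln ?posrE ?ltr0n // ler_nat.
have LM0 : 0 <= ln M%:R :> R by rewrite ln_ge0 // ler1n.
have nn : 0 <= n%:R :> R by [].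
have MMn : M%:R <= n%:R :> R by rewrite ler_nat.
have T1 : `|(cnt_itv U 0 (g%:R / j%:R) 0 M)%:R - M%:R * (g%:R / j%:R)|
    <= 13 * (2 * Num.sqrt (n%:R * ln L)).
  apply: le_trans (HJ j jJ i g i2j gj) _; rewrite ler_pM2l //.
  apply: dev_le_sqrt; first by rewrite mulr_ge0 ?sqrtr_ge0.
  rewrite exprMn sqr_sqrtr; last by rewrite mulr_ge0 //; lra.
  have h1 : M%:R * (g%:R / j%:R) <= n%:R :> R.
    rewrite -[leRHS]mulr1 ler_pM //; lra.
  have h2 : ln j%:R <= n%:R :> R.
    apply: le_trans (ln_le_id jj0) _; rewrite ler_nat.
    by rewrite (leq_trans _ jn) // ltnW // ltn_expl.
  apply: (@le_trans _ _ ((n%:R + n%:R) * (2 * ln L))); last lra.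
  by rewrite ler_pM // ?addr_ge0 ?mulr_ge0 // lerD.
(* [(n / j + L) * L <= 2 n + 256 n] because [L <= 2 j] and [L^2 <= 256 n], and 17 squared exceeds
   258. Both remaining pieces have mean at most [n / j]. *)
have crude lam k : 0 <= lam -> lam <= L -> 0 <= k -> k <= n%:R / j%:R ->
    dev lam k <= 17 * Num.sqrt (n%:R * ln L).
  move=> lam0 lamL k0 kn.
  apply: dev_le_sqrt; first by rewrite mulr_ge0 ?sqrtr_ge0.
  rewrite exprMn sqr_sqrtr; last by rewrite mulr_ge0 //; lra.
  apply: (@le_trans _ _ ((n%:R / j%:R + L) * L)).
    by rewrite ler_pM // ?addr_ge0 // lerD.
  have h1 : n%:R / j%:R * L <= 2 * n%:R.
    have -> : 2 * n%:R = n%:R / j%:R * (2 * j%:R) :> R by field; rewrite gt_eqF.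
    by rewrite ler_wpM2l // divr_ge0.
  have h2 : L ^+ 2 <= 256 * n%:R by exact: sqr_ln_le.
  have h3 : n%:R * 1 <= n%:R * ln L by rewrite ler_wpM2l.
  by rewrite mulrDl -expr2; lra.
have T2 : `|(cnt_itv U (g%:R / j%:R) x 0 M)%:R - M%:R * (x - g%:R / j%:R)|
    <= 28 * (17 * Num.sqrt (n%:R * ln L)).
  have := HN M MN0 0%N _ _ (leq0n _) g0 gx x1; rewrite subn0.
  move=> /le_trans; apply; rewrite ler_pM2l //.
  apply: crude => //; first by rewrite mulr_ge0 // subr_ge0.
  rewrite ler_pM // ?subr_ge0 //.
  by move: xg; rewrite -addn1 natrD mulrDl mul1r; lra.
have T3 : `|(cnt_itv U 0 x M n)%:R - (n - M)%:R * x|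
    <= 28 * (17 * Num.sqrt (n%:R * ln L)).
  have := HN n nN0' M _ _ Mn (lexx 0) x0 x1; rewrite subr0.
  move=> /le_trans; apply; rewrite ler_pM2l //.
  apply: crude => //; [exact: ltW | by rewrite mulr_ge0 |].
  apply: (@le_trans _ _ (s%:R)).
    by rewrite -[leRHS]mulr1 ler_pM // ler_nat.
  rewrite ler_pdivlMr // -natrM ler_nat (leq_trans _ jn) //.
  exact: leq_trunc_div.
rewrite (cnt_itv_split _ _ _ (leq0n _) Mn) (cnt_itv_cat _ _ _ g0 gx) !natrD.
have nE : n%:R = M%:R + (n - M)%:R :> R by rewrite -natrD subnKC.
move: T1 T2 T3; move: (Num.sqrt _) => S.
set A := (cnt_itv U 0 (_ / _) 0 M)%:R; set B := (cnt_itv U _ x 0 M)%:R.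
set C := (cnt_itv U 0 x M n)%:R.
have -> : A + B + C - n%:R * x = (A - M%:R * (g%:R / j%:R))
   + (B - M%:R * (x - g%:R / j%:R)) + (C - (n - M)%:R * x) by rewrite nE; ring.
move=> T1 T2 T3; apply: le_trans (ler_normD _ _) _.
have := ler_normD (A - M%:R * (g%:R / j%:R)) (B - M%:R * (x - g%:R / j%:R)).
have := normr_ge0 (A - M%:R * (g%:R / j%:R)).
lra.
Qed.

End uniform_deviation.

(** * Order statistics *)

Section order_statistics.
Context {R : realType}.
Implicit Types (U : nat -> R) (x y : R).

Definition ostat U (n k : nat) : R :=
  nth 0 (sort <=%R [seq U i | i <- iota 0 n]) k.-1.

Lemma size_sample U n : size (sort <=%R [seq U i | i <- iota 0 n]) = n.
Proof. by rewrite size_sort size_map size_iota. Qed.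

Lemma sorted_sample U n : sorted <=%R (sort <=%R [seq U i | i <- iota 0 n]).
Proof. exact: (sort_sorted (@le_total _ R)). Qed.

Lemma ostat_mono U n k k' : (0 < k)%N -> (k <= k')%N -> (k' <= n)%N ->
  ostat U n k <= ostat U n k'.
Proof.
case: k k' => // k [//|k'] _ kk' kn.
apply: (sorted_leq_nth le_trans le_refl _ (sorted_sample U n)) => //.
- by rewrite inE size_sample (leq_trans _ kn).
- by rewrite inE size_sample.
Qed.

Lemma ostat_in U n k : (0 < k)%N -> (k <= n)%N -> exists l, ostat U n k = U l.
Proof.
case: k => // k _ kn.
have : ostat U n k.+1 \in sort <=%R [seq U i | i <- iota 0 n].
  by apply: mem_nth; rewrite size_sample.
by rewrite mem_sort => /mapP[l _ ->]; exists l.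
Qed.

Lemma cnt_itv_count U n x : (forall l, 0 < U l) ->
  cnt_itv U 0 x 0 n = count (fun r => r <= x) (sort <=%R [seq U i | i <- iota 0 n]).
Proof.
move=> U0; rewrite (permP (permEl (perm_sort _ _))) count_map -sum1_count big_mkcond.
rewrite /cnt_itv /cnt /index_iota subn0; apply: eq_bigr => l _ /=.
by rewrite U0 /=; case: ifP.
Qed.

(** Together with [cnt_lt_ostat] this inverts the empirical distribution function. Both are
    inequalities, so they hold in the presence of ties. *)
Lemma cnt_ostat_ge U n k : (forall l, 0 < U l) -> (0 < k)%N -> (k <= n)%N ->
  (k <= cnt_itv U 0 (ostat U n k) 0 n)%N.
Proof.
move=> U0; case: k => // k _ kn; rewrite cnt_itv_count //.
set s := sort _ _; set a := (fun r => _).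
rewrite -(cat_take_drop k.+1 s) count_cat.
have : all a (take k.+1 s).
  apply/(all_nthP 0) => i; rewrite size_takel ?size_sample // => ik.
  rewrite nth_take // /a /ostat /=.
  apply: (sorted_leq_nth le_trans le_refl _ (sorted_sample U n)) => //.
  - by rewrite inE size_sample (leq_trans ik).
  - by rewrite inE size_sample.
by rewrite all_count => /eqP ->; rewrite size_takel ?size_sample // leq_addr.
Qed.

Lemma cnt_lt_ostat U n k x : (forall l, 0 < U l) -> (0 < k)%N -> (k <= n)%N ->
  x < ostat U n k -> (cnt_itv U 0 x 0 n < k)%N.
Proof.
move=> U0; case: k => // k _ kn xk; rewrite cnt_itv_count //.
set s := sort _ _; set a := (fun r => _).
rewrite -(cat_take_drop k s) count_cat.
have : ~~ has a (drop k s).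
  apply/negP => /(has_nthP 0)[i]; rewrite size_drop size_sample ltn_subRL => ik.
  rewrite nth_drop /a leNgt => /negP; apply; apply: lt_le_trans xk _.
  apply: (sorted_leq_nth le_trans le_refl _ (sorted_sample U n)) => //.
  - by rewrite inE size_sample.
  - by rewrite inE size_sample.
  - exact: leq_addr.
rewrite has_count -leqNgt leqn0 => /eqP ->; rewrite addn0 ltnS.
by rewrite (leq_trans (count_size _ _)) // size_takel // size_sample ltnW.
Qed.

(** A nondecreasing map sends the sorted sample to a sorted permutation of the image sample, and
    sorted permutations of one another coincide. Monotonicity is asked on the sample values only,
    since [Q] is controlled just on the unit interval. *)
Lemma ostat_map U n k (Q : R -> R) :
  (forall l l', (U l <= U l') -> Q (U l) <= Q (U l')) -> (0 < k)%N -> (k <= n)%N ->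
  ostat (fun l => Q (U l)) n k = Q (ostat U n k).
Proof.
move=> QU; case: k => // k _ kn.
have -> : ostat (fun l => Q (U l)) n k.+1 =
   nth 0 (map Q (sort <=%R [seq U i | i <- iota 0 n])) k.
  congr nth; apply: (sorted_eq le_trans le_anti).
  - exact: sorted_sample.
  - apply: (homo_sorted_in (P := [pred r | `[< exists l, r = U l >]]) (e := <=%R)).
    + by move=> r r' /asboolP[l ->] /asboolP[l' ->]; exact: QU.
    + by rewrite all_sort; apply/allP => r /mapP[l _ ->]; apply/asboolP; exists l.
    + exact: sorted_sample.
  - rewrite perm_sort (map_comp Q U); apply: perm_map.
    by rewrite perm_sym perm_sort.
by rewrite (nth_map 0) ?size_sample.
Qed.

End order_statistics.

(** * Riemann sums of the kernel *)

Section step_functions.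
Context {d : measure_display} {T : measurableType d} {R : realType}.
Variables (mu : {measure set T -> \bar R}) (A : nat -> set T) (c : R) (n : nat).
Hypothesis mA : forall i, measurable (A i).
Hypothesis muA : forall i, (i < n)%N -> mu (A i) = c%:E.

Definition step (a : nat -> R) (x : T) : R := \sum_(0 <= i < n) a i * \1_(A i) x.

Lemma step_ge0 a x : (forall i, 0 <= a i) -> 0 <= step a x.
Proof. by move=> a0; rewrite sumr_ge0 // => i _; rewrite mulr_ge0. Qed.

Lemma measurable_step a : measurable_fun setT (step a).
Proof.
by apply: measurable_sum => i; apply: measurable_funM => //.
Qed.

Lemma integral_step a : (forall i, 0 <= a i) ->
  (\int[mu]_x (step a x)%:E = (c * \sum_(0 <= i < n) a i)%:E)%E.
Proof.
move=> a0; under eq_integral do rewrite -sumEFin.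
rewrite ge0_integral_sum //; last 2 first.
- move=> i; apply/measurable_EFinP; exact: measurable_funM.
- by move=> i x _; rewrite lee_fin mulr_ge0.
rewrite mulr_sumr -sumEFin; apply: eq_big_nat => i /andP[_ ni].
under eq_integral do rewrite EFinM.
have m1 : measurable_fun setT (EFin \o \1_(A i) : T -> \bar R) by apply/measurable_EFinP.
rewrite (ge0_integralZl mu measurableT m1) ?lee_fin //; last first.
  by move=> x _; rewrite lee_fin.
by rewrite integral_indic // setIT muA // -EFinM mulrC.
Qed.

(** Used for Lebesgue measure, to handle the integral of [K], and for [P], to handle the kernel
    expectation: both integrands are close to step functions on sets of equal measure. *)
Lemma integral_near_step (f : T -> R) (k e : nat -> R) :
  measurable_fun setT f -> (forall x, 0 <= f x) -> (forall i, 0 <= k i) ->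
  (forall i, 0 <= e i) ->
  {ae mu, forall x, `|f x - step k x| <= step e x} ->
  `|fine (\int[mu]_x (f x)%:E) - c * \sum_(0 <= i < n) k i|
    <= c * \sum_(0 <= i < n) e i.
Proof.
move=> mf f0 k0 e0 fke.
have mF : measurable_fun setT (EFin \o f) by apply/measurable_EFinP.
have mS a : measurable_fun setT (EFin \o step a).
  by apply/measurable_EFinP; exact: measurable_step.
have S0 a : (forall i, 0 <= a i) -> forall x, setT x -> (0 <= (EFin \o step a) x)%E.
  by move=> a0 x _; rewrite lee_fin step_ge0.
have F0 : forall x, setT x -> (0 <= (EFin \o f) x)%E by move=> x _; rewrite lee_fin.
have h1 : (\int[mu]_x (f x)%:E <= (c * \sum_(0 <= i < n) k i + c * \sum_(0 <= i < n) e i)%:E)%E.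
  rewrite EFinD -!integral_step // -(ge0_integralD mu measurableT (S0 k k0) (mS k) (S0 e e0) (mS e)).
  apply: (ae_ge0_le_integral measurableT F0 mF).
  - by move=> x _; rewrite adde_ge0 // S0.
  - exact: emeasurable_funD.
  move: fke; apply: filterS => x + _; rewrite -EFinD lee_fin.
  by move=> /ler_normlP[_]; lra.
have h2 : ((c * \sum_(0 <= i < n) k i)%:E <= \int[mu]_x (f x)%:E + (c * \sum_(0 <= i < n) e i)%:E)%E.
  rewrite -!integral_step // -(ge0_integralD mu measurableT F0 mF (S0 e e0) (mS e)).
  apply: (ae_ge0_le_integral measurableT (S0 k k0) (mS k)).
  - by move=> x _; rewrite adde_ge0 ?F0 // S0.
  - exact: emeasurable_funD.
  move: fke; apply: filterS => x + _; rewrite -EFinD lee_fin.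
  by move=> /ler_normlP[]; lra.
have h0 : (0 <= \int[mu]_x (f x)%:E)%E by apply: integral_ge0 => x _; rewrite lee_fin.
(* The two bounds exclude the infinite values, so [fine] is faithful. *)
move: h0 h1 h2; case: (\int[mu]_x _)%E => [r| |] //=.
rewrite -EFinD !lee_fin => _ h1 h2; rewrite ler_norml; apply/andP; split; lra.
Qed.

End step_functions.

Section grid_cells.
Context {R : realType}.
Implicit Types (x u h : R).

Definition cell n i x : bool := i%:R / n%:R < x <= i.+1%:R / n%:R.

Lemma exists_cell n x : (0 < n)%N -> 0 < x -> x <= 1 -> exists2 i, (i < n)%N & cell n i x.
Proof.
move=> n0 x0 x1; have nn0 : 0 < n%:R :> R by rewrite ltr0n.
have [ix xi] := truncn_scaled (ltW x0) n0.
have i_n := truncn_scaled_le n x1.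
set i := Num.truncn _ in ix xi i_n.
(* Cells are closed on the right: a grid point belongs to the cell before the one found by
   truncation. *)
move: ix; rewrite le_eqVlt => /orP[/eqP ix|ix]; last first.
  exists i; last by rewrite /cell ix ltW.
  by rewrite -(ltr_nat R) -(ltr_pM2r (x:=n%:R^-1)) ?invr_gt0 // (lt_le_trans ix) // divff // gt_eqF.
move: ix xi i_n; case: i => [|i] ix xi i_n; first by move: x0; rewrite -ix mul0r ltxx.
by exists i => //; rewrite /cell -ix lexx ltr_pM2r ?invr_gt0 // ltr_nat ltnSn.
Qed.

Lemma cell_inj n i j x : (0 < n)%N -> cell n i x -> cell n j x -> i = j.
Proof.
move=> n0 /andP[i1 i2] /andP[j1 j2]; have nn0 : 0 < n%:R :> R by rewrite ltr0n.
have le a c : a%:R / n%:R < c.+1%:R / n%:R :> R -> (a <= c)%N.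
  by rewrite ltr_pM2r ?invr_gt0 // ltr_nat ltnS.
by apply/eqP; rewrite eqn_leq !le // ?(lt_le_trans i1 j2) ?(lt_le_trans j1 i2).
Qed.

Lemma sum_cell n x (a : nat -> R) i : (0 < n)%N -> (i < n)%N -> cell n i x ->
  \sum_(0 <= j < n) a j * (cell n j x)%:R = a i.
Proof.
move=> n0 i_n ci; rewrite (bigD1_seq i) ?mem_index_iota ?iota_uniq //= ci mulr1.
rewrite big1 ?addr0 // => j ji.
case: (boolP (cell n j x)) => cj; last by rewrite mulr0.
by move: ji; rewrite (cell_inj n0 cj ci) eqxx.
Qed.

Lemma sum_cell0 n x (a : nat -> R) : (0 < n)%N -> (x <= 0 \/ 1 < x) ->
  \sum_(0 <= j < n) a j * (cell n j x)%:R = 0.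
Proof.
move=> n0 hx; rewrite big_nat big1 // => j /andP[_ jn].
have nn0 : 0 < n%:R :> R by rewrite ltr0n.
case: (boolP (cell n j x)) => [/andP[c1 c2]|_]; last by rewrite mulr0.
case: hx => hx.
  have : 0 <= j%:R / n%:R :> R by rewrite divr_ge0.
  lra.
have : j.+1%:R / n%:R <= 1 :> R by rewrite ler_pdivrMr // mul1r ler_nat.
lra.
Qed.

Lemma count_nat_itv (n : nat) (y z : R) : y <= z ->
  \sum_(0 <= i < n) (y <= i%:R <= z)%R%:R <= z - y + 1 :> R.
Proof.
move=> yz.
(* Strengthened for the induction: [m - y] bounds the count while [m] is still below [z + 1]. *)
suff h m : \sum_(0 <= i < m) (y <= i%:R <= z)%R%:R <= Num.max 0 (Num.min (m%:R - y) (z - y + 1)) :> R.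
  apply: le_trans (h n) _; rewrite ge_max ge_min lexx orbT andbT; lra.
elim: m => [|m IH]; first by rewrite big_nil le_max lexx.
rewrite big_nat_recr //=; apply: le_trans (lerD IH (lexx _)) _.
rewrite -[m.+1]addn1 natrD.
case: (boolP (y <= m%:R <= z)) => [/andP[h1 h2]|_] /=.
  rewrite max_r; last by rewrite le_min; apply/andP; split; lra.
  rewrite min_l; last lra.
  by rewrite le_max le_min; apply/orP; right; apply/andP; split; lra.
rewrite addr0 ge_max le_max lexx /= le_max le_min !ge_min.
by apply/orP; right; apply/andP; split; apply/orP; [left|right]; lra.
Qed.

End grid_cells.

Section kernel_riemann.
Context {R : realType}.
Variables (K : R -> R) (Lk : R).
Hypothesis K_ge0 : forall x, 0 <= K x.
Hypothesis K_lip : forall x y, `|K x - K y| <= Lk * `|x - y|.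
Hypothesis K_supp : forall x, 1 < `|x| -> K x = 0.
Hypothesis Lk_gt0 : 0 < Lk.
Implicit Types x u h : R.

(** The support hypothesis is silent at [|x| = 1]; the Lipschitz bound settles it by comparison with
    points just outside. Hence the weights at both ends of the grid vanish even for [u = h] and
    [u = 1 - h]. *)
Lemma kernel_out x : 1 <= `|x| -> K x = 0.
Proof.
rewrite le_eqVlt => /orP[/eqP x1|/K_supp //].
apply/eqP; rewrite eq_le K_ge0 andbT; apply/ler_addgt0Pl => e e0; rewrite addr0.
have := K_lip x (x * (1 + e / Lk)).
have el : 0 < e / Lk by rewrite divr_gt0.
rewrite (K_supp (x := x * _)); last by rewrite normrM -x1 mul1r ger0_norm; lra.
rewrite subr0 (ger0_norm (K_ge0 _)) => /le_trans; apply.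
have -> : x - x * (1 + e / Lk) = - x * (e / Lk) by ring.
by rewrite normrM normrN -x1 mul1r gtr0_norm // mulrC divfK // gt_eqF.
Qed.

Lemma kernel_le x : K x <= 2 * Lk.
Proof.
case: (leP 1 `|x|) => [/kernel_out ->|x1]; first by rewrite mulr_ge0 // ltW.
have := K_lip x 1; rewrite (kernel_out (x := 1)) ?normr1 // subr0 (ger0_norm (K_ge0 _)).
move=> /le_trans; apply; rewrite mulrC ler_pM2r //.
by move: x1; rewrite ltr_norml => /andP[? ?]; rewrite ler_norml; apply/andP; split; lra.
Qed.

Lemma Kh_ge0 h x : 0 < h -> 0 <= Kh K h x.
Proof. by move=> h0; rewrite mulr_ge0 // invr_ge0 ltW. Qed.

Lemma Kh_le h x : 0 < h -> Kh K h x <= 2 * Lk / h.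
Proof. by move=> h0; rewrite /Kh mulrC ler_pM2r ?invr_gt0 // kernel_le. Qed.

Lemma Kh_out h x : 0 < h -> h <= `|x| -> Kh K h x = 0.
Proof.
move=> h0 hx; rewrite /Kh kernel_out ?mulr0 //.
by rewrite normrM normfV (gtr0_norm h0) ler_pdivlMr // mul1r.
Qed.

Lemma Kh_lip h x y : 0 < h -> `|Kh K h x - Kh K h y| <= Lk / h ^+ 2 * `|x - y|.
Proof.
move=> h0; rewrite /Kh -mulrBr normrM (gtr0_norm (x := h^-1)) ?invr_gt0 //.
have -> : Lk / h ^+ 2 * `|x - y| = h^-1 * (Lk * `|x / h - y / h|).
  by rewrite -mulrBl normrM normfV (gtr0_norm h0); field; rewrite gt_eqF.
by rewrite ler_pM2l ?invr_gt0.
Qed.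

Definition near_cell n h u i : bool := `|i%:R / n%:R - u| <= h + n%:R^-1.

(** Left-endpoint rule: [x] is within [1 / n] of the left end of its cell, and [K_h] has Lipschitz
    constant [Lk / h^2]; off the near cells both kernel values vanish. Points outside []0, 1]] lie
    in no cell, but there [h <= u <= 1 - h] forces [K_h (u - x) = 0]. *)
Lemma Kh_cell n h u x : (0 < n)%N -> 0 < h -> h <= u -> u <= 1 - h ->
  `|Kh K h (u - x) - \sum_(0 <= i < n) Kh K h (u - i%:R / n%:R) * (cell n i x)%:R|
   <= \sum_(0 <= i < n) (Lk / (n%:R * h ^+ 2) * (near_cell n h u i)%:R) * (cell n i x)%:R.
Proof.
move=> n0 h0 hu uh; have nn0 : 0 < n%:R :> R by rewrite ltr0n.
case: (leP x 0) => x0.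
  rewrite !sum_cell0 //; try by left.
  by rewrite Kh_out ?subrr ?normr0 // ger0_norm; lra.
case: (leP x 1) => x1; last first.
  rewrite !sum_cell0 //; try by right.
  by rewrite Kh_out ?subrr ?normr0 // distrC ger0_norm; lra.
have [i i_n ci] := exists_cell n0 x0 x1.
rewrite !(sum_cell _ n0 i_n ci).
move: ci; rewrite /cell -addn1 natrD mulrDl mul1r => /andP[c1 c2].
have xi : `|x - i%:R / n%:R| <= n%:R^-1 by rewrite ler_norml; apply/andP; split; lra.
case: (boolP (near_cell n h u i)) => ci /=.
  rewrite mulr1; apply: le_trans (Kh_lip _ _ h0) _.
  have -> : u - x - (u - i%:R / n%:R) = - (x - i%:R / n%:R) by ring.
  rewrite normrN.
  have -> : Lk / (n%:R * h ^+ 2) = Lk / h ^+ 2 * n%:R^-1 by field; rewrite !gt_eqF.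
  by rewrite ler_wpM2l // divr_ge0 ?sqr_ge0 // ltW.
rewrite mulr0.
move: ci; rewrite /near_cell -ltNge => ci.
have ni : 0 < (n%:R : R)^-1 by rewrite invr_gt0.
rewrite !Kh_out ?subrr ?normr0 // distrC; first lra.
have := ler_distD x (i%:R / n%:R) u; rewrite [`|_ - x|]distrC; lra.
Qed.

Lemma near_cell_count n h u : (0 < n)%N -> 0 < h -> 
  \sum_(0 <= i < n) (near_cell n h u i)%:R <= 2 * (n%:R * h) + 3.
Proof.
move=> n0 h0; have nn0 : 0 < n%:R :> R by rewrite ltr0n.
have yz : n%:R * u - n%:R * h - 1 <= n%:R * u + n%:R * h + 1.
  have : 0 < n%:R * h by rewrite mulr_gt0.
  by lra.
have := count_nat_itv n yz.
have h1 : \sum_(0 <= i < n) (near_cell n h u i)%:R <=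
    \sum_(0 <= i < n) (n%:R * u - n%:R * h - 1 <= i%:R <= n%:R * u + n%:R * h + 1)%R%:R :> R.
  apply: ler_sum => i _; rewrite ler_nat.
  case: (boolP (near_cell _ _ _ _)) => // /ler_normlP[c1 c2].
  have e1 : n%:R * (i%:R / n%:R - u) = i%:R - n%:R * u by field; rewrite gt_eqF.
  have e2 : n%:R * (h + n%:R^-1) = n%:R * h + 1 by field; rewrite gt_eqF.
  have := ler_wpM2l (ltW nn0) c1; have := ler_wpM2l (ltW nn0) c2.
  rewrite mulrN e1 e2 => h1 h2; rewrite lt0b; apply/andP; split; lra.
by move: h1; lra.
Qed.

End kernel_riemann.

Section kernel_integrals.
Context {R : realType}.
Variables (K : R -> R) (Lk : R).
Hypothesis K_ge0 : forall x, 0 <= K x.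
Hypothesis K_lip : forall x y, `|K x - K y| <= Lk * `|x - y|.
Hypothesis K_supp : forall x, 1 < `|x| -> K x = 0.
Hypothesis Lk_gt0 : 0 < Lk.
Implicit Types x u h : R.

Lemma kernel_continuous : continuous K.
Proof.
move=> x; apply/cvgrPdist_lt => e e0; near=> y.
apply: le_lt_trans (K_lip _ _) _.
rewrite mulrC -ltr_pdivlMr //; near: y.
apply: (@cvgr_dist_lt _ R^o); [exact: cvg_id|exact: divr_gt0].
Unshelve. all: by end_near. Qed.

(** At most [2 n h + 3 <= 5 n h] cells are near, which is the origin of the recurring factor 5. *)
Lemma sum_near_cell n h u : (0 < n)%N -> 0 < h -> 1 <= n%:R * h ->
  n%:R^-1 * \sum_(0 <= i < n) Lk / (n%:R * h ^+ 2) * (near_cell n h u i)%:R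
    <= 5 * Lk / (n%:R * h).
Proof.
move=> n0 h0 nh; have nn0 : 0 < n%:R :> R by rewrite ltr0n.
rewrite -mulr_sumr.
have -> : 5 * Lk / (n%:R * h) = n%:R^-1 * (Lk / (n%:R * h ^+ 2) * (5 * (n%:R * h))).
  by field; rewrite !gt_eqF.
rewrite ler_pM2l ?invr_gt0 // ler_wpM2l //.
  by rewrite divr_ge0 ?mulr_ge0 ?sqr_ge0 // ltW.
by apply: le_trans (near_cell_count u n0 h0) _; lra.
Qed.

(** The substitution [x = u - h z] is applied to the cells rather than to the integral: their
    preimages are intervals of length [1 / (n h)], on which [K] is compared with a step function. *)
Lemma kernel_riemann_sum n h u : (\int[lebesgue_measure]_x (K x)%:E = 1)%E ->
  (0 < n)%N -> 0 < h -> 1 <= n%:R * h -> h <= u -> u <= 1 - h ->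
  `|1 - n%:R^-1 * \sum_(0 <= i < n) Kh K h (u - i%:R / n%:R)| <= 5 * Lk / (n%:R * h).
Proof.
move=> K1 n0 h0 nh hu uh; have nn0 : 0 < n%:R :> R by rewrite ltr0n.
pose A i := [set z | cell n i (u - h * z)].
have AE i : A i = `[(u - i.+1%:R / n%:R) / h, (u - i%:R / n%:R) / h[%classic.
  apply/seteqP; split => z /=; rewrite in_itv /= /cell ler_pdivrMr // ltr_pdivlMr //
    [z * h]mulrC => /andP[c1 c2]; apply/andP; split; lra.
have mA i : measurable (A i) by rewrite AE; exact: measurable_itv.
have muA i : (i < n)%N -> @lebesgue_measure R (A i) = ((n%:R * h)^-1)%:E.
  move=> _; rewrite AE lebesgue_measure_itv /= lte_fin ltr_pM2r ?invr_gt0 //.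
  have ii : i%:R / n%:R < i.+1%:R / n%:R :> R by rewrite ltr_pM2r ?invr_gt0 // ltr_nat.
  rewrite ifT; last lra.
  rewrite -EFinD; congr (_%:E); rewrite -addn1 natrD; field.
  by rewrite !gt_eqF.
have mK : measurable_fun setT K by apply: continuous_measurable_fun; exact: kernel_continuous.
have k0 i : 0 <= h * Kh K h (u - i%:R / n%:R) by rewrite mulr_ge0 ?Kh_ge0 // ltW.
have e0 i : 0 <= h * (Lk / (n%:R * h ^+ 2) * (near_cell n h u i)%:R).
  by rewrite !mulr_ge0 ?invr_ge0 ?mulr_ge0 ?sqr_ge0 // ltW.
have := @integral_near_step _ _ R (@lebesgue_measure R) A _ n mA muA K _ _ mK K_ge0 k0 e0.
rewrite K1 /= -!mulr_sumr.
have -> s : (n%:R * h)^-1 * (h * s) = n%:R^-1 * s.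
  by field; rewrite !gt_eqF.
have -> s : (n%:R * h)^-1 * (h * s) = n%:R^-1 * s.
  by field; rewrite !gt_eqF.
move=> /(_ _) H; apply: le_trans (H _) _; last by rewrite mulr_sumr; exact: sum_near_cell.
apply: aeW => z.
have -> : K z = h * Kh K h (u - (u - h * z)).
  rewrite /Kh mulrA divff ?gt_eqF // mul1r; congr K; field.
  by rewrite gt_eqF.
have stepE s : step A n (fun i => h * s i) z =
    h * \sum_(0 <= i < n) s i * (cell n i (u - h * z))%:R.
  rewrite mulr_sumr; apply: eq_bigr => i _; rewrite mulrA indicE.
  by rewrite mem_setE.
pose k i := Kh K h (u - i%:R / n%:R).
pose e i := Lk / (n%:R * h ^+ 2) * (near_cell n h u i)%:R.
suff : `|h * Kh K h (u - (u - h * z)) - h * (\sum_(0 <= i < n) k i * (cell n i (u - h * z))%:R)|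
    <= h * \sum_(0 <= i < n) e i * (cell n i (u - h * z))%:R by rewrite -!stepE.
rewrite -mulrBr normrM (gtr0_norm h0) ler_pM2l //.
exact: (Kh_cell K_ge0 K_lip K_supp Lk_gt0).
Qed.

(** The comparison of [kernel_riemann_sum] under [P], where each cell has probability [1 / n]. The
    events [A i] are kept apart from the cells because probabilities are known for bid events, which
    match the cells only almost surely. *)
Lemma kernel_expectation (d : measure_display) (T : measurableType d)
    (P : probability T R) (X : T -> R) (A : nat -> set T) n h u :
  measurable_fun setT X -> (forall i, measurable (A i)) ->
  (forall i, (i < n)%N -> P (A i) = (n%:R^-1)%:E) ->
  {ae P, forall w, forall i, (i < n)%N -> (w \in A i) = cell n i (X w)} ->
  (0 < n)%N -> 0 < h -> 1 <= n%:R * h -> h <= u -> u <= 1 - h ->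
  `|fine ('E_P[fun w => Kh K h (u - X w)])%E
     - n%:R^-1 * \sum_(0 <= i < n) Kh K h (u - i%:R / n%:R)| <= 5 * Lk / (n%:R * h).
Proof.
move=> mX mA PA AX n0 h0 nh hu uh; rewrite unlock.
have mK : measurable_fun setT (fun w => Kh K h (u - X w)).
  apply: measurable_funM => //.
  apply: measurableT_comp; first by apply: continuous_measurable_fun; exact: kernel_continuous.
  apply: measurable_funM => //; exact: measurable_funB.
have k0 i : 0 <= Kh K h (u - i%:R / n%:R) by rewrite Kh_ge0.
have e0 i : 0 <= Lk / (n%:R * h ^+ 2) * (near_cell n h u i)%:R.
  by rewrite !mulr_ge0 ?invr_ge0 ?mulr_ge0 ?sqr_ge0 // ltW.
have f0 w : 0 <= Kh K h (u - X w) by exact: Kh_ge0.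
have H := integral_near_step mA PA mK f0 k0 e0.
apply: le_trans (H _) _; last exact: sum_near_cell.
move: AX; apply: filterS => w AX.
have stepE s : step A n s w = \sum_(0 <= i < n) s i * (cell n i (X w))%:R.
  by rewrite /step !big_nat; apply: eq_bigr => i /andP[_ i_n]; rewrite indicE AX.
rewrite !stepE; exact: (Kh_cell K_ge0 K_lip K_supp Lk_gt0).
Qed.

End kernel_integrals.

(** * The quantile density estimator *)

Lemma abel_sum (R : realType) (k r : nat -> R) m :
  \sum_(0 <= i < m) k i * (r i.+1 - r i) =
  k m * r m - k 0%N * r 0%N - \sum_(0 <= i < m) (k i.+1 - k i) * r i.+1.
Proof.
elim: m => [|m IH]; first by rewrite !big_nil; ring.
by rewrite !big_nat_recr //= IH; ring.
Qed.

Section weighted_increments.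
Context {R : realType}.
Variables (K : R -> R) (Lk : R).
Hypothesis K_ge0 : forall x, 0 <= K x.
Hypothesis K_lip : forall x y, `|K x - K y| <= Lk * `|x - y|.
Hypothesis K_supp : forall x, 1 < `|x| -> K x = 0.
Hypothesis Lk_gt0 : 0 < Lk.
Variables (n : nat) (h u : R).
Hypothesis n_gt0 : (0 < n)%N.
Hypothesis h_gt0 : 0 < h.
Hypothesis hu : h <= u.
Hypothesis uh : u <= 1 - h.
Hypothesis nh_ge1 : 1 <= n%:R * h.

Lemma sizeR_gt0 : 0 < n%:R :> R. Proof. by rewrite ltr0n. Qed.

Lemma sizeV_gt0 : 0 < n%:R^-1 :> R. Proof. by rewrite invr_gt0 sizeR_gt0. Qed.

Lemma sizeV_le : n%:R^-1 <= h.
Proof. by rewrite -[leLHS]mul1r ler_pdivrMr ?sizeR_gt0 // mulrC. Qed.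

Definition kweight i : R := Kh K h (u - i%:R / n%:R).

Lemma kweight_ge0 i : 0 <= kweight i. Proof. exact: Kh_ge0. Qed.

Lemma kweight0 : kweight 0 = 0.
Proof.
have h0 := h_gt0; have hu1 := hu.
rewrite /kweight mul0r subr0 (Kh_out K_ge0 K_lip K_supp Lk_gt0) // ger0_norm //.
lra.
Qed.

Lemma kweightn : kweight n = 0.
Proof.
have h0 := h_gt0; have uh1 := uh; have nn0 := sizeR_gt0.
rewrite /kweight divff ?gt_eqF // (Kh_out K_ge0 K_lip K_supp Lk_gt0) // distrC ger0_norm; lra.
Qed.

Lemma kweight_out i : h <= `|i%:R / n%:R - u| -> kweight i = 0.
Proof. by move=> hi; rewrite /kweight (Kh_out K_ge0 K_lip K_supp Lk_gt0) // distrC. Qed.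

Lemma succ_div i : i.+1%:R / n%:R = i%:R / n%:R + n%:R^-1 :> R.
Proof. by rewrite -addn1 natrD mulrDl mul1r. Qed.

Lemma kweight_diff i :
  `|kweight i.+1 - kweight i| <= Lk / (n%:R * h ^+ 2) * (near_cell n h u i)%:R.
Proof.
have h0 := h_gt0; have nn0 := sizeR_gt0; have ni0 := sizeV_gt0.
case: (boolP (near_cell n h u i)) => ci.
  rewrite mulr1; apply: le_trans (Kh_lip K_lip _ _ h_gt0) _.
  have -> : u - i.+1%:R / n%:R - (u - i%:R / n%:R) = - n%:R^-1 by rewrite succ_div; ring.
  rewrite normrN (gtr0_norm ni0).
  by have -> : Lk / (n%:R * h ^+ 2) = Lk / h ^+ 2 * n%:R^-1 by field; rewrite !gt_eqF.
move: ci; rewrite /near_cell -ltNge => ci.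
have o1 : h <= `|i%:R / n%:R - u| by lra.
have o2 : h <= `|i.+1%:R / n%:R - u|.
  have := ler_distD (i.+1%:R / n%:R) (i%:R / n%:R) u.
  have -> : i%:R / n%:R - i.+1%:R / n%:R = - n%:R^-1 :> R by rewrite succ_div; ring.
  by rewrite normrN (gtr0_norm ni0); lra.
by rewrite (kweight_out o1) (kweight_out o2) subrr normr0 mulr0.
Qed.

(** The boundary terms of Abel summation vanish, and the total variation of the weights is at most
    [5 * Lk / h]; only values of [r] next to near cells count. *)
Lemma kweight_abel (r : nat -> R) (rho : R) : 0 <= rho ->
  (forall i, (i < n)%N -> near_cell n h u i -> `|r i.+1| <= rho) ->
  `|\sum_(0 <= i < n) kweight i * (r i.+1 - r i)| <= 5 * Lk / h * rho.
Proof.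
have nn0 := sizeR_gt0; have h0 := h_gt0.
move=> rho0 rr; rewrite abel_sum kweight0 kweightn !mul0r subrr sub0r normrN.
apply: le_trans (ler_norm_sum _ _ _) _.
apply: (@le_trans _ _ (\sum_(0 <= i < n) Lk / (n%:R * h ^+ 2) * (near_cell n h u i)%:R * rho)).
  rewrite !big_nat; apply: ler_sum => i /andP[_ i_n]; rewrite normrM.
  case: (boolP (near_cell n h u i)) (kweight_diff i) => ci /= kd.
    by rewrite ler_pM // rr.
  have -> : `|kweight i.+1 - kweight i| = 0.
    by apply/eqP; rewrite eq_le normr_ge0 andbT; move: kd; rewrite mulr0.
  by rewrite mulr0 !mul0r.
rewrite -mulr_suml ler_wpM2r //.
have := sum_near_cell Lk_gt0 u n_gt0 h_gt0 nh_ge1.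
rewrite mulrC ler_pdivrMr // => /le_trans; apply.
by have -> : 5 * Lk / (n%:R * h) * n%:R = 5 * Lk / h by field; rewrite !gt_eqF.
Qed.

Section sample.
Variable U : nat -> R.
Hypothesis U_gt0 : forall l, 0 < U l.
Hypothesis U_le1 : forall l, U l <= 1.
Hypothesis U_mod : modulus_bound U n.
Hypothesis L_ge1 : 1 <= ln n%:R :> R.
Let L : R := ln n%:R.

Definition ecdf x : R := (cnt_itv U 0 x 0 n)%:R / n%:R.
Definition edev x : R := ecdf x - x.

Lemma ecdf_diff x y : 0 <= x -> x <= y ->
  ecdf y - ecdf x = (cnt_itv U x y 0 n)%:R / n%:R.
Proof. by move=> x0 xy; rewrite /ecdf (cnt_itv_cat U 0 n x0 xy) natrD; ring. Qed.

Lemma edev_diff x y : 0 <= x -> x <= 1 -> 0 <= y -> y <= 1 ->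
  `|edev y - edev x| <= 28 * dev L (n%:R * `|y - x|) / n%:R.
Proof.
have nn0 := sizeR_gt0; have ni0 := sizeV_gt0.
wlog xy : x y / x <= y.
  move=> H x0 x1 y0 y1; case: (leP x y) => xy; first exact: H.
  by rewrite distrC [`|y - x|]distrC H // ltW.
move=> x0 x1 y0 y1; have := U_mod (leq0n n) x0 xy y1; rewrite subn0.
have -> : edev y - edev x = ((cnt_itv U x y 0 n)%:R - n%:R * (y - x)) / n%:R.
  rewrite /edev; have := ecdf_diff x0 xy => e.
  have -> : ecdf y - y - (ecdf x - x) = (ecdf y - ecdf x) - (y - x) by ring.
  by rewrite e; field; rewrite gt_eqF.
rewrite normrM (gtr0_norm ni0) ler_pM2r // (ger0_norm (x := y - x)) // subr_ge0.
exact: xy.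
Qed.

(** Number of sample points in near cells, at most: such a cell starts within [h + 1 / n] of [u] and
    ends [1 / n] later. The cut to the unit interval allows [modulus_bound] to be applied. *)
Definition window : R :=
  (cnt_itv U (Num.max 0 (u - h - n%:R^-1)) (Num.min 1 (u + h + 2 / n%:R)) 0 n)%:R.

(** The mean is at most [2 n h + 3] and the deviation at most 28 times the mean plus [L], by
    [dev_le_sum]; 29 is 28 + 1. *)
Lemma window_le : window <= 29 * (2 * (n%:R * h) + 3 + L).
Proof.
have h0 := h_gt0; have hu1 := hu; have uh1 := uh.
have nn0 := sizeR_gt0; have ni0 := sizeV_gt0.
rewrite /window; set x := Num.max _ _; set y := Num.min _ _.
have x0 : 0 <= x by rewrite le_max lexx.
have y1 : y <= 1 by rewrite ge_min lexx.
have n20 : 0 < 2 / n%:R :> R by rewrite divr_gt0.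
have xy : x <= y.
  by rewrite ge_max !le_min; apply/andP; split; apply/andP; split; lra.
have := U_mod (leq0n n) x0 xy y1; rewrite subn0 -/L.
have yx : n%:R * (y - x) <= 2 * (n%:R * h) + 3.
  have -> : 2 * (n%:R * h) + 3 = n%:R * ((u + h + 2 / n%:R) - (u - h - n%:R^-1)).
    by field; rewrite gt_eqF.
  rewrite ler_pM2l // lerB //; first by rewrite ge_min lexx orbT.
  by rewrite le_max lexx orbT.
have yx0 : 0 <= n%:R * (y - x) by rewrite mulr_ge0 // ?subr_ge0 // ltW.
have L0 : 0 <= L by apply: le_trans L_ge1.
have := dev_le_sum L0 yx0.
move=> h1 /ler_normlP[_ h2].
move: h1 h2 yx L0; move: (dev _ _) => D.
lra.
Qed.

Lemma near_in_window x : 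
  \sum_(0 <= i < n) (near_cell n h u i)%:R * (cell n i x)%:R
   <= (Num.max 0 (u - h - n%:R^-1) < x <= Num.min 1 (u + h + 2 / n%:R))%R%:R :> R.
Proof.
have ni0 := sizeV_gt0.
case: (leP x 0) => x0; first by rewrite sum_cell0 //; left.
case: (leP x 1) => x1; last by rewrite sum_cell0 //; right.
have [i i_n ci] := exists_cell n_gt0 x0 x1.
rewrite (sum_cell _ n_gt0 i_n ci) ler_nat.
case: (boolP (near_cell n h u i)) => // /ler_normlP[n1 n2].
move: ci; rewrite /cell succ_div => /andP[c1 c2].
by rewrite gt_max le_min x0 x1 lt0b /=; apply/andP; split; lra.
Qed.

(** The increment of [edev] over a cell is the proportion of sample points in it minus [1 / n]. The
    Stieltjes sum is thus the sample mean of the left-endpoint kernel values minus the Riemann sum;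
    what remains is the error of [Kh_cell], paid once for each sample point in the window. *)
Lemma kernel_sum_repr :
  `|n%:R^-1 * \sum_(0 <= l < n) Kh K h (u - U l)
    - n%:R^-1 * \sum_(0 <= i < n) kweight i
    - \sum_(0 <= i < n) kweight i * (edev (i.+1%:R / n%:R) - edev (i%:R / n%:R))|
   <= Lk / (n%:R * h) ^+ 2 * window.
Proof.
have h0 := h_gt0; have nn0 := sizeR_gt0; have ni0 := sizeV_gt0.
have e1 : \sum_(0 <= i < n) kweight i * (edev (i.+1%:R / n%:R) - edev (i%:R / n%:R)) =
   n%:R^-1 * \sum_(0 <= l < n) \sum_(0 <= i < n) kweight i * (cell n i (U l))%:R
   - n%:R^-1 * \sum_(0 <= i < n) kweight i.
  rewrite exchange_big_nat /= -mulrBr -sumrB mulr_sumr; apply: eq_bigr => i _.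
  rewrite -mulr_sumr.
  have -> : \sum_(0 <= l < n) (cell n i (U l))%:R =
     (cnt_itv U (i%:R / n%:R) (i.+1%:R / n%:R) 0 n)%:R :> R by rewrite natr_sum.
  have i0 : 0 <= i%:R / n%:R :> R by rewrite divr_ge0.
  have ii : i%:R / n%:R <= i.+1%:R / n%:R :> R by rewrite succ_div; lra.
  rewrite /edev.
  have -> : ecdf (i.+1%:R / n%:R) - i.+1%:R / n%:R - (ecdf (i%:R / n%:R) - i%:R / n%:R)
     = (ecdf (i.+1%:R / n%:R) - ecdf (i%:R / n%:R)) - n%:R^-1 by rewrite succ_div; ring.
  by rewrite ecdf_diff //; ring.
rewrite e1.
have -> (a c e : R) : a - c - (e - c) = a - e by ring.
rewrite -mulrBr -sumrB normrM (gtr0_norm ni0).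
have -> : Lk / (n%:R * h) ^+ 2 * window = n%:R^-1 * (Lk / (n%:R * h ^+ 2) * window).
  by field; rewrite !gt_eqF.
rewrite ler_pM2l //; apply: le_trans (ler_norm_sum _ _ _) _.
rewrite /window /cnt_itv /cnt natr_sum mulr_sumr; apply: ler_sum => l _.
apply: le_trans (Kh_cell K_ge0 K_lip K_supp Lk_gt0 _ n_gt0 h_gt0 hu uh) _.
apply: le_trans (_ : _ <= Lk / (n%:R * h ^+ 2) *
   \sum_(0 <= i < n) (near_cell n h u i)%:R * (cell n i (U l))%:R) _.
  by rewrite mulr_sumr; apply: ler_sum => i _; rewrite mulrA.
apply: ler_wpM2l; last exact: near_in_window.
by rewrite divr_ge0 ?mulr_ge0 ?sqr_ge0 // ltW.
Qed.

(** Crude substitute for [kernel_sum_repr] when [n h] is small: each point of the window contributes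
    at most the maximum of [K_h]. *)
Lemma kernel_sum_le : n%:R^-1 * \sum_(0 <= l < n) Kh K h (u - U l) <=
  2 * Lk / (n%:R * h) * window.
Proof.
have h0 := h_gt0; have nn0 := sizeR_gt0; have ni0 := sizeV_gt0.
have -> : 2 * Lk / (n%:R * h) * window = n%:R^-1 * (2 * Lk / h * window).
  by field; rewrite !gt_eqF.
rewrite ler_pM2l // /window /cnt_itv /cnt natr_sum mulr_sumr; apply: ler_sum => l _.
case: (boolP (_ < U l <= _)) => Ul.
  by rewrite mulr1; exact: (Kh_le K_ge0 K_lip K_supp Lk_gt0).
rewrite (Kh_out K_ge0 K_lip K_supp Lk_gt0) ?mulr0 //.
rewrite leNgt; apply/negP; rewrite ltr_norml => /andP[h1 h2].
move/negP: Ul; apply; rewrite gt_max le_min U_gt0 U_le1 /=.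
have n20 : 0 < 2 / n%:R :> R by rewrite divr_gt0.
apply/andP; split; lra.
Qed.

Lemma edev_increment_sum : L <= n%:R * h ->
  `|\sum_(0 <= i < n) kweight i * (edev (i.+1%:R / n%:R) - edev (i%:R / n%:R))|
    <= 5 * Lk / h * (28 * (2 * Num.sqrt (n%:R * h * L)) / n%:R).
Proof.
have h0 := h_gt0; have hu1 := hu; have uh1 := uh.
have nn0 := sizeR_gt0; have ni0 := sizeV_gt0; have nih := sizeV_le.
move=> Lnh; have L0 : 0 <= L by apply: le_trans L_ge1.
(* Subtracting the constant [edev u] leaves the increments unchanged and makes [r] as small as the
   modulus at scale [3 h]. *)
pose r i := edev (i%:R / n%:R) - edev u.
rewrite (eq_bigr (fun i => kweight i * (r i.+1 - r i))); last first.
  by move=> i _; rewrite /r; congr (_ * _); ring.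
apply: kweight_abel.
  by rewrite !mulr_ge0 ?sqrtr_ge0 // ltW.
move=> i i_n /ler_normlP[c1 c2].
have i1 : i.+1%:R / n%:R <= 1 :> R by rewrite ler_pdivrMr // mul1r ler_nat.
have i0 : 0 <= i.+1%:R / n%:R :> R by rewrite divr_ge0.
apply: le_trans (edev_diff _ _ i0 i1) _; [lra|lra|].
rewrite ler_pM2r // ler_pM2l //.
apply: dev_le_sqrt; first by rewrite mulr_ge0 ?sqrtr_ge0.
rewrite exprMn sqr_sqrtr; last by rewrite mulr_ge0 // mulr_ge0 // ltW.
have : n%:R * `|i.+1%:R / n%:R - u| <= 3 * (n%:R * h).
  have -> : 3 * (n%:R * h) = n%:R * (3 * h) by ring.
  rewrite ler_pM2l // ler_norml succ_div; apply/andP; split; lra.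
move: (_ * `|_|) => z z3.
have : (z + L) * L <= 4 * (n%:R * h) * L by apply: ler_wpM2r => //; lra.
lra.
Qed.

End sample.

End weighted_increments.

(** * Inversion of the empirical distribution function *)

Section spacings.
Context {R : realType}.
Variables (n : nat) (U : nat -> R).
Hypothesis n_gt0 : (0 < n)%N.
Hypothesis U_gt0 : forall l, 0 < U l.
Hypothesis U_le1 : forall l, U l <= 1.

Lemma ostat_gt0 k : (0 < k)%N -> (k <= n)%N -> 0 < ostat U n k.
Proof. by move=> k0 kn; have [l ->] := ostat_in U k0 kn. Qed.

Lemma ostat_le1 k : (0 < k)%N -> (k <= n)%N -> ostat U n k <= 1.
Proof. by move=> k0 kn; have [l ->] := ostat_in U k0 kn. Qed.

Lemma ecdf_ostat_ge k : (0 < k)%N -> (k <= n)%N -> k%:R / n%:R <= ecdf n U (ostat U n k).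
Proof.
move=> k0 kn; rewrite /ecdf ler_pM2r ?invr_gt0 ?ltr0n // ler_nat.
exact: cnt_ostat_ge.
Qed.

Lemma ecdf_lt_ostat k x : (0 < k)%N -> (k <= n)%N -> x < ostat U n k ->
  ecdf n U x <= k%:R / n%:R - n%:R^-1.
Proof.
move=> k0 kn xk; have -> : k%:R / n%:R - n%:R^-1 = (k%:R - 1) / n%:R :> R by ring.
rewrite /ecdf ler_pM2r ?invr_gt0 ?ltr0n //.
by rewrite lerBrDr natr1 ler_nat; exact: cnt_lt_ostat.
Qed.

Lemma cnt_between_ostat i k x : (0 < i)%N -> (i <= k)%N -> (k <= n)%N ->
  0 <= x -> x < ostat U n i -> (k - i < cnt_itv U x (ostat U n k) 0 n)%N.
Proof.
move=> i0 ik kn x0 xi.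
have i_n := leq_trans ik kn; have k0 := leq_trans i0 ik.
have xk : x <= ostat U n k by rewrite (le_trans (ltW xi)) // ostat_mono.
have := cnt_ostat_ge U_gt0 k0 kn; rewrite (cnt_itv_cat U 0 n x0 xk).
have := cnt_lt_ostat U_gt0 i0 i_n xi.
move: (cnt_itv U 0 x 0 n) (cnt_itv U x _ 0 n) => a c ai kac.
by rewrite ltn_subLR //; apply: leq_ltn_trans kac _; rewrite ltn_add2r.
Qed.

Variables D om : R.
Hypothesis edevD : forall x : R, 0 <= x -> x <= 1 -> `|edev n U x| <= D.
Hypothesis edev_om : forall x y : R, 0 <= x -> x <= 1 -> 0 <= y -> y <= 1 ->
  `|y - x| <= D + n%:R^-1 -> `|edev n U y - edev n U x| <= om.

(** If the order statistic exceeded [k / n + D], the empirical distribution function at [k / n + D]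
    would be below [k / n], against [edevD]; the other side evaluates [edevD] at the order statistic
    itself. *)
Lemma ostat_close k : (0 < k)%N -> (k <= n)%N ->
  `|ostat U n k - k%:R / n%:R| <= D.
Proof.
move=> k0 kn; have x0 := ostat_gt0 k0 kn; have x1 := ostat_le1 k0 kn.
have nn0 : 0 < n%:R :> R by rewrite ltr0n.
have ni0 : 0 < n%:R^-1 :> R by rewrite invr_gt0.
have kn0 : 0 <= k%:R / n%:R :> R by rewrite divr_ge0.
have D0 : 0 <= D by apply: le_trans (edevD (lexx 0) ler01).
set x := ostat U n k in x0 x1 *.
rewrite ler_norml; apply/andP; split.
  have := ecdf_ostat_ge k0 kn; rewrite -/x.
  have := edevD (ltW x0) x1; rewrite /edev => /ler_normlP[_]; lra.
rewrite leNgt; apply/negP => xk.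
have yx : k%:R / n%:R + D < x by lra.
have y0 : 0 <= k%:R / n%:R + D by lra.
have y1 : k%:R / n%:R + D <= 1 by lra.
have := ecdf_lt_ostat k0 kn yx.
have := edevD y0 y1; rewrite /edev => /ler_normlP[]; lra.
Qed.

(** The empirical distribution function is at least [k / n] at the order statistic and at most
    [(k - 1) / n] just below it; moving [edev] from there to [k / n] costs [om]. *)
Lemma bahadur k : (0 < k)%N -> (k <= n)%N ->
  `|ostat U n k - k%:R / n%:R + edev n U (k%:R / n%:R)| <= om + n%:R^-1.
Proof.
move=> k0 kn; have x0 := ostat_gt0 k0 kn; have x1 := ostat_le1 k0 kn.
have nn0 : 0 < n%:R :> R by rewrite ltr0n.
have ni0 : 0 < n%:R^-1 :> R by rewrite invr_gt0.
have kn0 : 0 <= k%:R / n%:R :> R by rewrite divr_ge0.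
have kn1 : k%:R / n%:R <= 1 :> R by rewrite ler_pdivrMr // mul1r ler_nat.
have /ler_normlP[xD1 xD2] := ostat_close k0 kn.
have E := ecdf_ostat_ge k0 kn.
set x := ostat U n k in x0 x1 xD1 xD2 E *.
have /ler_normlP [ox1 ox2] : `|edev n U (k%:R / n%:R) - edev n U x| <= om.
  by apply: edev_om => //; [exact: ltW | rewrite ler_norml; apply/andP; split; lra].
have om0 : 0 <= om by lra.
have ex : edev n U x = ecdf n U x - x by [].
rewrite ler_norml; apply/andP; split; first lra.
(* A point less than the order statistic by at most [1 / n], cut at 0 to stay in the unit interval;
   hence the [n^-1] in the range of [edev_om]. *)
pose y := Num.max 0 (x - n%:R^-1).
have y0 : 0 <= y by rewrite le_max lexx.
have yx : y < x by rewrite gt_max x0 /=; lra.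
have xy : x - n%:R^-1 <= y by rewrite le_max lexx orbT.
have /ler_normlP[p1 p2] : `|edev n U (k%:R / n%:R) - edev n U y| <= om.
  by apply: edev_om => //; [lra | rewrite ler_norml; apply/andP; split; lra].
have := ecdf_lt_ostat k0 kn yx.
have ey : edev n U y = ecdf n U y - y by [].
lra.
Qed.

End spacings.

(** * Linearization of the quantile density estimator and its lower bounds *)

Section quantile_density.
Context {R : realType}.
Variables (K : R -> R) (Lk : R).
Hypothesis K_ge0 : forall x, 0 <= K x.
Hypothesis K_lip : forall x y, `|K x - K y| <= Lk * `|x - y|.
Hypothesis K_supp : forall x, 1 < `|x| -> K x = 0.
Hypothesis Lk_gt0 : 0 < Lk.
Variables (Q q : R -> R) (B1 B2 c1 : R).
Hypothesis B2_ge0 : 0 <= B2.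
Hypothesis c1_gt0 : 0 < c1.
Hypothesis q_bounds : forall x : R, 0 <= x -> x <= 1 -> 0 <= q x /\ q x <= B1.
Hypothesis q_lip : forall x y : R, 0 <= x -> x <= 1 -> 0 <= y -> y <= 1 ->
  `|q y - q x| <= B2 * `|y - x|.
Hypothesis Q_taylor : forall x y : R, 0 <= x -> x <= 1 -> 0 <= y -> y <= 1 ->
  `|Q y - Q x - q x * (y - x)| <= B2 * (y - x) ^+ 2.
Hypothesis Q_incr : forall x y : R, 0 <= x -> x <= y -> y <= 1 -> c1 * (y - x) <= Q y - Q x.
Variables (n : nat) (h u : R).
Hypothesis n_gt0 : (0 < n)%N.
Hypothesis h_gt0 : 0 < h.
Hypothesis hu : h <= u.
Hypothesis uh : u <= 1 - h.
Hypothesis nh_ge1 : 1 <= n%:R * h.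
Variable U : nat -> R.
Hypothesis U_gt0 : forall l, 0 < U l.
Hypothesis U_le1 : forall l, U l <= 1.

Let beta i : R := Q (ostat U n i).
Let k i : R := kweight K n h u i.

Definition qsum : R := \sum_(1 <= i < n) k i * (beta i.+1 - beta i).

(** The added term [i = 0] has weight zero, so the junk value [ostat U n 0] does no harm; Abel
    summation can then use the full range. *)
Lemma qsum0 : qsum = \sum_(0 <= i < n) k i * (beta i.+1 - beta i).
Proof.
rewrite /qsum [in RHS]big_ltn //.
by rewrite /k (kweight0 K_ge0 K_lip K_supp Lk_gt0 n h_gt0 hu) mul0r add0r.
Qed.

Variables D om : R.
Hypothesis edevD : forall x : R, 0 <= x -> x <= 1 -> `|edev n U x| <= D.
Hypothesis edev_om : forall x y : R, 0 <= x -> x <= 1 -> 0 <= y -> y <= 1 ->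
  `|y - x| <= D + n%:R^-1 -> `|edev n U y - edev n U x| <= om.
Hypothesis riemann : `|1 - n%:R^-1 * \sum_(0 <= i < n) k i| <= 5 * Lk / (n%:R * h).

(** Write [beta i = Q (i / n) - q u * edev (i / n) + r i]. The first part yields [q u] times the
    Riemann sum, the second the Stieltjes sum. [r] consists of the Taylor error of [Q], the Bahadur
    error times [q], and the error of freezing [q] at [u]; it has no small increments and goes
    through [kweight_abel], hence the factor [1 / h]. *)
Lemma qsum_repr :
  `|qsum - q u + q u * \sum_(0 <= i < n) k i *
      (edev n U (i.+1%:R / n%:R) - edev n U (i%:R / n%:R))|
  <= B1 * (5 * Lk / (n%:R * h)) + B2 * (h + n%:R^-1) * (1 + 5 * Lk / (n%:R * h))
     + 5 * Lk / h * (B2 * D ^+ 2 + B1 * (om + n%:R^-1) + B2 * (h + 2 / n%:R) * D).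
Proof.
have [h0 hu1 uh1 nh1] := And4 h_gt0 hu uh nh_ge1.
have nn0 : 0 < n%:R :> R by rewrite ltr0n.
have ni0 : 0 < n%:R^-1 :> R by rewrite invr_gt0.
have D0 : 0 <= D by apply: le_trans (edevD (lexx 0) ler01).
have u0 : 0 <= u by lra.
have u1 : u <= 1 by lra.
have [qu0 qu1] := q_bounds u0 u1.
have om0 : 0 <= om.
  apply: le_trans (@edev_om u u _ _ _ _ _) => //; rewrite subrr normr0; lra.
have gI i : (i <= n)%N -> 0 <= i%:R / n%:R :> R /\ i%:R / n%:R <= 1 :> R.
  by move=> i_n; split; rewrite ?divr_ge0 // ler_pdivrMr // mul1r ler_nat.
have S i : i.+1%:R / n%:R = i%:R / n%:R + n%:R^-1 :> R.
  by rewrite -addn1 natrD mulrDl mul1r.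
pose g i : R := Q (i%:R / n%:R).
pose al i : R := edev n U (i%:R / n%:R).
pose r i := beta i - g i + q u * al i.
set Y := \sum_(0 <= i < n) k i * _.
have rie := riemann; set rs := n%:R^-1 * _ in rie.
have qE : qsum = \sum_(0 <= i < n) k i * (g i.+1 - g i) - q u * Y
     + \sum_(0 <= i < n) k i * (r i.+1 - r i).
  rewrite qsum0 /Y mulr_sumr -sumrB -big_split; apply: eq_bigr => i _ /=.
  by rewrite /r /al; ring.
have T1 : `|\sum_(0 <= i < n) k i * (g i.+1 - g i) - q u * rs| <= B2 * (h + n%:R^-1) * rs.
  rewrite /rs !mulr_sumr -sumrB; apply: le_trans (ler_norm_sum _ _ _) _.
  rewrite !big_nat; apply: ler_sum => i /andP[_ i_n].
  have k0 : 0 <= k i by apply: kweight_ge0.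
  have -> : k i * (g i.+1 - g i) - q u * (n%:R^-1 * k i) =
      k i * (g i.+1 - g i - q u * n%:R^-1) by ring.
  rewrite normrM (ger0_norm k0).
  have -> : B2 * (h + n%:R^-1) * (n%:R^-1 * k i) = k i * (B2 * (h + n%:R^-1) * n%:R^-1) by ring.
  case: (leP h `|i%:R / n%:R - u|) => hi.
    by rewrite /k (kweight_out K_ge0 K_lip K_supp Lk_gt0 h_gt0 hi) !mul0r.
  rewrite ler_wpM2l //.
  have [i0 i1] := gI i (ltnW i_n); have [j0 j1] := gI i.+1 i_n.
  have := Q_taylor i0 i1 j0 j1; have := q_lip u0 u1 i0 i1.
  rewrite -/(g i) -/(g i.+1).
  have -> : i.+1%:R / n%:R - i%:R / n%:R = n%:R^-1 :> R by rewrite S; ring.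
  move=> a1 a2.
  have -> : g i.+1 - g i - q u * n%:R^-1 =
     (g i.+1 - g i - q (i%:R / n%:R) * n%:R^-1) + (q (i%:R / n%:R) - q u) * n%:R^-1 by ring.
  apply: le_trans (ler_normD _ _) _; rewrite normrM (gtr0_norm ni0).
  have : `|q (i%:R / n%:R) - q u| * n%:R^-1 <= B2 * h * n%:R^-1.
    rewrite ler_pM2r //; apply: le_trans a1 _; rewrite ler_wpM2l // ltW //.
  by move: a2; lra.
have T2 : `|\sum_(0 <= i < n) k i * (r i.+1 - r i)| <=
    5 * Lk / h * (B2 * D ^+ 2 + B1 * (om + n%:R^-1) + B2 * (h + 2 / n%:R) * D).
  have n20 : 0 < 2 / n%:R :> R by rewrite divr_gt0.
  have B10 : 0 <= B1 by lra.
  apply: (kweight_abel K_ge0 K_lip K_supp Lk_gt0 n_gt0 h_gt0 hu uh nh_ge1).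
    by rewrite !addr_ge0 ?mulr_ge0 ?sqr_ge0 //; lra.
  move=> i i_n /ler_normlP[c2 c3].
  have [j0 j1] := gI i.+1 i_n.
  have o0 := ltW (ostat_gt0 U_gt0 (ltn0Sn i) i_n).
  have o1 := ostat_le1 U_le1 (ltn0Sn i) i_n.
  have oD := ostat_close n_gt0 U_gt0 U_le1 edevD (ltn0Sn i) i_n.
  have bh := bahadur n_gt0 U_gt0 U_le1 edevD edev_om (ltn0Sn i) i_n.
  have t1 := Q_taylor j0 j1 o0 o1.
  have t2 := q_lip u0 u1 j0 j1.
  have [qj0 qj1] := q_bounds j0 j1.
  have aD := edevD j0 j1.
  set y := i.+1%:R / n%:R in j0 j1 oD bh t1 t2 qj0 qj1 aD.
  set x := ostat U n i.+1 in o0 o1 oD bh t1.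
  have -> : r i.+1 = (Q x - Q y - q y * (x - y)) + q y * (x - y + edev n U y)
      - (q y - q u) * edev n U y.
    by rewrite /r /beta /g /al -/x -/y; ring.
  apply: le_trans (ler_normB _ _) _; apply: lerD.
    apply: le_trans (ler_normD _ _) _; apply: lerD.
      apply: le_trans t1 _; rewrite ler_wpM2l //.
      by rewrite -real_normK ?num_real // lerXn2r // nnegrE.
    by rewrite normrM (ger0_norm qj0) ler_pM.
  rewrite normrM ler_pM //; apply: le_trans t2 _; rewrite ler_wpM2l //.
  have e2 : 2 / n%:R = n%:R^-1 + n%:R^-1 :> R by ring.
  by rewrite e2 ler_norml /y S; apply/andP; split; lra.
have rs1 : rs <= 1 + 5 * Lk / (n%:R * h) by move/ler_normlP: rie => [? ?]; lra.
rewrite qE.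
have -> (a c d : R) : a - q u * Y + c - d + q u * Y = (a - q u * rs) + (q u * rs - d) + c by ring.
apply: le_trans (ler_normD _ _) _; apply: lerD T2.
apply: le_trans (ler_normD _ _) _; rewrite addrC; apply: lerD.
  have -> : q u * rs - q u = - (q u * (1 - rs)) by ring.
  by rewrite normrN normrM (ger0_norm qu0) ler_pM.
apply: le_trans T1 _; rewrite ler_wpM2l //.
by rewrite mulr_ge0 //; lra.
Qed.

Variables (x0 c0 eta : R).
Hypothesis c0_gt0 : 0 < c0.
Hypothesis eta_gt0 : 0 < eta.
Hypothesis K_bump : forall z, `|z - x0| <= eta -> c0 <= K z.

Lemma beta_mono i j : (0 < i)%N -> (i <= j)%N -> (j <= n)%N ->
  c1 * (ostat U n j - ostat U n i) <= beta j - beta i.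
Proof.
move=> i0 ij jn; apply: Q_incr; last by rewrite ostat_le1 // (leq_trans i0).
  by rewrite ltW // ostat_gt0 // (leq_trans ij).
exact: ostat_mono.
Qed.

Lemma beta_incr i : (0 < i)%N -> (i < n)%N -> beta i <= beta i.+1.
Proof.
move=> i0 i_n; rewrite -subr_ge0; apply: le_trans (beta_mono i0 (leqnSn i) i_n).
by rewrite mulr_ge0 ?(ltW c1_gt0) // subr_ge0 ostat_mono.
Qed.

(** All terms are nonnegative, and on the indices seen by the bump of [K] the weight is at least
    [c0 / h]; these are consecutive, so their increments telescope to one long spacing. *)
Lemma qsum_ge_spacing : 1 <= 2 * eta * (n%:R * h) -> exists i,
  [/\ (0 < i)%N, (i + Num.truncn (2 * eta * (n%:R * h)) <= n)%N &
  c0 / h * (beta (i + Num.truncn (2 * eta * (n%:R * h))) - beta i) <= qsum].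
Proof.
move=> ge1; have [h0 hu1 uh1 nh1] := And4 h_gt0 hu uh nh_ge1.
have [c00 eta0] := conj c0_gt0 eta_gt0.
have nn0 : 0 < n%:R :> R by rewrite ltr0n.
(* [K] is positive on the bump, which therefore lies strictly inside the support; this keeps the
   selected indices between 1 and [n - 1]. *)
have bump_in z : `|z - x0| <= eta -> -1 < z < 1.
  move=> /K_bump cz; rewrite -ltr_norml ltNge; apply/negP => /(kernel_out K_ge0 K_lip K_supp Lk_gt0) z0.
  by move: cz; rewrite z0; lra.
have /andP[_ xe1] : -1 < x0 + eta < 1.
  by apply: bump_in; have -> : x0 + eta - x0 = eta by [ring|]; rewrite ger0_norm // ltW.
have /andP[xe2 _] : -1 < x0 - eta < 1.
  by apply: bump_in; have -> : x0 - eta - x0 = - eta by [ring|]; rewrite normrN ger0_norm // ltW.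
(* For [m] between [lo] and [lo + 2 * eta * (n h)], the kernel argument [(u - m / n) / h] is within
   [eta] of [x0]. *)
pose lo := n%:R * (u - h * (x0 + eta)).
have hx1 : h * (x0 + eta) <= h by rewrite ger_pMr // ltW.
have hx2 : - h <= h * (x0 - eta).
  by rewrite -[- h]mulrN1 ler_pM2l // ltW.
have lo0 : 0 <= lo by rewrite mulr_ge0 //; lra.
pose i := (Num.truncn lo).+1.
set kk := Num.truncn (2 * eta * (n%:R * h)).
have /andP[i1 i2] := truncn_itv lo0.
have kk0 : 0 <= 2 * eta * (n%:R * h) by lra.
have /andP[k1 k2] := truncn_itv kk0; rewrite -/kk in k1 k2.
have kk1 : (0 < kk)%N by rewrite truncn_gt0.
have win m : (i <= m)%N -> (m < i + kk)%N -> lo <= m%:R /\ m%:R <= n%:R * (u - h * (x0 - eta)).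
  move=> im mi; split; first by rewrite (le_trans (ltW i2)) // ler_nat.
  have : m%:R <= (Num.truncn lo)%:R + kk%:R :> R.
    by rewrite -natrD ler_nat -ltnS -addSn.
  have -> : n%:R * (u - h * (x0 - eta)) = lo + 2 * eta * (n%:R * h) by rewrite /lo; ring.
  lra.
have ikn : (i + kk <= n)%N.
  have im : (i <= (i + kk).-1)%N by rewrite -ltnS prednK ?addn_gt0 // -addn1 leq_add2l.
  have mi : ((i + kk).-1 < i + kk)%N by rewrite ltn_predL.
  have [_ hm] := win _ im mi.
  rewrite -[(i + kk)%N]prednK // -(ltr_nat R) (le_lt_trans hm) //.
  rewrite -[ltRHS]mulr1 ltr_pM2l //.
  have : - h < h * (x0 - eta) by rewrite -[- h]mulrN1 ltr_pM2l.
  lra.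
exists i; split => //.
have tel : beta (i + kk) - beta i = \sum_(i <= m < i + kk) (beta m.+1 - beta m).
  by rewrite telescope_sumr // leq_addr.
rewrite tel mulr_sumr.
have P1 m : (1 <= m < n)%N -> 0 <= k m * (beta m.+1 - beta m).
  move=> /andP[m0 mn]; rewrite mulr_ge0 ?subr_ge0 ?beta_incr //.
  exact: kweight_ge0.
have i_n : (i <= n)%N by rewrite (leq_trans _ ikn) // leq_addr.
rewrite /qsum (big_cat_nat (n := i) _ i_n) //=.
rewrite (big_cat_nat (n := (i + kk)%N) (m := i) _ ikn) ?leq_addr //=.
apply: (@le_trans _ _ (\sum_(i <= m < i + kk) k m * (beta m.+1 - beta m))).
  rewrite !big_nat; apply: ler_sum => m /andP[im mi].
  have mn : (m < n)%N by apply: leq_trans ikn.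
  have m0 : (0 < m)%N by apply: leq_trans im.
  rewrite ler_wpM2r ?subr_ge0 ?beta_incr //.
  rewrite /k /kweight /Kh mulrC ler_pM2l ?invr_gt0 //; apply: K_bump.
  have [w1 w2] := win m im mi.
  have m1 : u - h * (x0 + eta) <= m%:R / n%:R by rewrite ler_pdivlMr // mulrC.
  have m2 : m%:R / n%:R <= u - h * (x0 - eta) by rewrite ler_pdivrMr // mulrC.
  have -> : (u - m%:R / n%:R) / h - x0 = (u - m%:R / n%:R - h * x0) / h.
    by field; rewrite !gt_eqF.
  rewrite normrM normfV (gtr0_norm h0) ler_pdivrMr // ler_norml.
  by apply/andP; split; lra.
have s1 : 0 <= \sum_(1 <= m < i) k m * (beta m.+1 - beta m).
  rewrite big_nat sumr_ge0 // => m /andP[m1 mi]; apply: P1; rewrite m1 /=.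
  exact: leq_trans i_n.
have s2 : 0 <= \sum_(i + kk <= m < n) k m * (beta m.+1 - beta m).
  rewrite big_nat sumr_ge0 // => m /andP[m1 mi]; apply: P1; rewrite mi andbT.
  by rewrite (leq_trans _ m1) // addn_gt0.
lra.
Qed.

(** An interval with more than [2 eta n h - 1] points and mean [mu] satisfies
    [2 eta n h < 2 mu + 197 L]; since [197 L <= eta n h], its length is at least [eta h / 2]. *)
Lemma qsum_ge_const : modulus_bound U n -> 1 <= ln n%:R :> R ->
  1 <= 2 * eta * (n%:R * h) -> 197 * ln n%:R <= eta * (n%:R * h) ->
  c0 * c1 * eta / 2 <= qsum.
Proof.
move=> md L1 e1 Le; have [i [i0 ikn qs]] := qsum_ge_spacing e1.
have [h0 [c00 [eta0 c10]]] := conj h_gt0 (conj c0_gt0 (conj eta_gt0 c1_gt0)).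
have nn0 : 0 < n%:R :> R by rewrite ltr0n.
have kk0 : 0 <= 2 * eta * (n%:R * h) by lra.
have /andP[k1 k2] := truncn_itv kk0.
set kk := Num.truncn _ in ikn qs k1 k2.
have i_n : (i <= n)%N by rewrite (leq_trans _ ikn) // leq_addr.
set y := ostat U n (i + kk); set x := ostat U n i.
have xy : x <= y by apply: ostat_mono => //; exact: leq_addr.
have y1 : y <= 1 by apply: ostat_le1 => //; rewrite addn_gt0 i0.
have xpos : 0 < x by apply: ostat_gt0.
have key z : 0 <= z -> z < x -> eta * h / 2 <= y - z.
  move=> z0 zx; have zy : z <= y by lra.
  have := cnt_between_ostat U_gt0 i0 (leq_addr kk i) ikn z0 zx.
  rewrite addKn -/y -(ltr_nat R) => c1'.
  have := md 0%N z y (leq0n _) z0 zy y1; rewrite subn0 => /ler_normlP[_].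
  set mu := n%:R * (y - z) => c2.
  have mu0 : 0 <= mu by rewrite mulr_ge0 // subr_ge0.
  have L0 : 0 <= ln n%:R :> R by lra.
  (* Arithmetic-geometric mean, weighted so that 28 times the right side is [mu + 197 L]. *)
  have dv : dev (ln n%:R) mu <= (mu + ln n%:R) / 28 + 7 * ln n%:R.
    apply: dev_le_sqrt; first lra.
    by have := sqr_ge0 ((mu + ln n%:R) / 28 - 7 * ln n%:R); lra.
  have c3 : kk.+1%:R <= (cnt_itv U z y 0 n)%:R :> R by rewrite ler_nat -(ltr_nat R).
  have : eta * (n%:R * h) / 2 <= mu.
    by move: dv c2 c3 k2 Le; move: (dev _ _) => dd; lra.
  rewrite /mu => e2.
  have : n%:R * (eta * h / 2) <= n%:R * (y - z) by lra.
  by rewrite ler_pM2l.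
(* Counting intervals are open on the left, so [key] reaches only [z < x]; the case [z = x] follows
   by taking [z] close to [x]. *)
have yx : eta * h / 2 <= y - x.
  rewrite leNgt; apply/negP => lt.
  pose z := Num.max 0 (x - (eta * h / 2 - (y - x)) / 2).
  have z0 : 0 <= z by rewrite le_max lexx.
  have zx : z < x by rewrite gt_max xpos /=; lra.
  have := key z z0 zx.
  have : x - (eta * h / 2 - (y - x)) / 2 <= z by rewrite le_max lexx orbT.
  lra.
apply: le_trans qs.
have b1 := beta_mono i0 (leq_addr kk i) ikn; rewrite -/x -/y in b1.
apply: (@le_trans _ _ (c0 / h * (c1 * (eta * h / 2)))).
  by have -> : c0 * c1 * eta / 2 = c0 / h * (c1 * (eta * h / 2)) by field; rewrite gt_eqF.
rewrite ler_wpM2l ?divr_ge0 ?(ltW c00) ?(ltW h0) //.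
by apply: le_trans b1; rewrite ler_pM2l.
Qed.

(** The selected spacing spans at least 40 steps, hence is longer than [mesh n]: otherwise two
    neighbouring mesh cells would hold 40 points. *)
Lemma qsum_ge_mesh : 
  (forall i, (i <= n ^ 2)%N -> i%:R * mesh n <= 1 :> R ->
  (cnt_itv U (i%:R * mesh n) (Num.min 1 (i.+2%:R * mesh n))%R 0 n < 40)%N) ->
  40 <= 2 * eta * (n%:R * h) -> c0 * c1 * mesh n / h <= qsum.
Proof.
move=> mb e40; have e1 : 1 <= 2 * eta * (n%:R * h) by lra.
have [i [i0 ikn qs]] := qsum_ge_spacing e1.
have [h0 [c00 [eta0 c10]]] := conj h_gt0 (conj c0_gt0 (conj eta_gt0 c1_gt0)).
have nn0 : 0 < n%:R :> R by rewrite ltr0n.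
have t1 := @root16_ge1 R _ n_gt0.
have t0 : 0 < root16 n :> R by lra.
have m0 : 0 < mesh n :> R by rewrite invr_gt0 mulr_gt0 // exprn_gt0.
set kk := Num.truncn _ in ikn qs.
have kk40 : (40 <= kk)%N by rewrite /kk truncn_ge_nat //; lra.
have i_n : (i <= n)%N by rewrite (leq_trans _ ikn) // leq_addr.
set y := ostat U n (i + kk); set x := ostat U n i.
have xy : x <= y by apply: ostat_mono => //; exact: leq_addr.
have y1 : y <= 1 by apply: ostat_le1 => //; rewrite addn_gt0 i0.
have xpos : 0 < x by apply: ostat_gt0.
have yx : mesh n <= y - x.
  rewrite leNgt; apply/negP => lt.
  (* Left-open intervals require [p * mesh n < x] strictly; if [x] is a mesh point, the preceding
     one is taken. *)
  have [p px xp] : exists2 p, p%:R * mesh n < x & x <= p.+1%:R * mesh n.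
    have xm0 : 0 <= x / mesh n by rewrite divr_ge0 // ltW.
    have /andP[] := truncn_itv xm0; set p := Num.truncn _.
    rewrite ler_pdivlMr // ltr_pdivrMr // le_eqVlt => /orP[/eqP px|px] xp; last first.
      by exists p => //; exact: ltW.
    move: px xp; case: p => [|p] px xp; first by move: xpos; rewrite -px mul0r ltxx.
    by exists p; rewrite -px // ltr_pM2r // ltr_nat.
  have p1 : p%:R * mesh n <= 1 :> R by lra.
  have pn : (p <= n ^ 2)%N.
    rewrite -(ler_nat R) natrX; move: p1; rewrite /mesh ler_pdivrMr ?mul1r; last first.
      by rewrite mulr_gt0 // exprn_gt0.
    move=> /le_trans; apply; rewrite [n%:R ^+ 2]expr2 ler_pM2l //.
    by rewrite -(root16_exp n) ler_weXn2l.
  have := mb p pn p1; rewrite ltnNge => /negP; apply.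
  have pm0 : 0 <= p%:R * mesh n :> R by rewrite mulr_ge0 // ltW.
  have := cnt_between_ostat U_gt0 i0 (leq_addr kk i) ikn pm0 px.
  rewrite addKn -/y => c; rewrite (leq_trans kk40) // (leq_trans (ltnW c)) //.
  apply: cnt_itv_sub => //; rewrite le_min y1 /= -addn1 natrD mulrDl mul1r.
  lra.
apply: le_trans qs.
have b1 := beta_mono i0 (leq_addr kk i) ikn; rewrite -/x -/y in b1.
have -> : c0 * c1 * mesh n / h = c0 / h * (c1 * mesh n) by ring.
rewrite ler_wpM2l ?divr_ge0 ?(ltW c00) ?(ltW h0) //.
by apply: le_trans b1; rewrite ler_pM2l.
Qed.

End quantile_density.

(** * Rates *)

Section rates.
Context {R : realType}.

(* With t = n^(1/16), s = h^(1/2), a = (ln n)^(1/2) and c = (ln ln n)^(1/4), all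
   rates become monomials. *)
Section monomials.
Variables s t a c : R.
Hypothesis s_gt0 : 0 < s.
Hypothesis t_ge1 : 1 <= t.
Hypothesis a_ge1 : 1 <= a.
Hypothesis c_ge1 : 1 <= c.
Hypothesis a_t : a ^+ 2 <= 16 * t.
Hypothesis c_a : c ^+ 4 <= a ^+ 2.

(** [kiefer] and [bias] are the rate terms [h^(-1/2) n^(-1/4) ell n] and [n^(1/2) h^(3/2)]. *)
Definition kiefer : R := a * c / (s * t ^+ 4).
Definition bias : R := t ^+ 8 * s ^+ 3.

Let t_gt0 : 0 < t. Proof. exact: lt_le_trans t_ge1. Qed.
Let a_gt0 : 0 < a. Proof. exact: lt_le_trans a_ge1. Qed.
Let c_gt0 : 0 < c. Proof. exact: lt_le_trans c_ge1. Qed.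

Lemma kiefer_gt0 : 0 < kiefer.
Proof. by rewrite divr_gt0 ?mulr_gt0 ?exprn_gt0. Qed.

Lemma bias_ge0 : 0 <= bias.
Proof. by rewrite mulr_ge0 ?exprn_ge0 // ltW. Qed.

Let le_t k l : (k <= l)%N -> t ^+ k <= t ^+ l. Proof. exact: ler_weXn2l. Qed.

Let t_exp_ge1 k : 1 <= t ^+ k. Proof. exact: exprn_ege1. Qed.

Lemma quot_le_kiefer (x C : R) : x <= C * (a * c * t ^+ 4) -> x / (t ^+ 8 * s) <= C * kiefer.
Proof.
move=> xC; have -> : C * kiefer = C * (a * c * t ^+ 4) / (t ^+ 8 * s).
  by rewrite /kiefer; field; rewrite !gt_eqF.
by rewrite ler_pM2r // invr_gt0 mulr_gt0 // exprn_gt0.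
Qed.

Lemma ac_ge1 : 1 <= a * c.
Proof. by rewrite -[1]mulr1 ler_pM. Qed.

Lemma act_ge (x : R) k : 0 <= x -> (k <= 4)%N -> x <= t ^+ k -> x <= a * c * t ^+ 4.
Proof.
move=> x0 k4 xt; rewrite -[leLHS]mul1r ler_pM //; first exact: ac_ge1.
exact: le_trans xt (le_t k4).
Qed.

Lemma inv_le_kiefer : (t ^+ 8 * s)^-1 <= kiefer.
Proof.
rewrite -[leLHS]mul1r -[leRHS]mul1r; apply: quot_le_kiefer; rewrite mul1r.
exact: (act_ge (k := 4)).
Qed.

Lemma log_le_kiefer : a ^+ 2 / (t ^+ 8 * s) <= 16 * kiefer.
Proof.
apply: quot_le_kiefer; apply: le_trans a_t _; rewrite ler_pM2l //.
by apply: (act_ge (k := 1)); rewrite ?expr1 // ltW.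
Qed.

Lemma log2_le_kiefer : a ^+ 4 * t ^+ 2 / (t ^+ 8 * s) <= 256 * kiefer.
Proof.
apply: quot_le_kiefer.
have a4 : a ^+ 4 <= 256 * t ^+ 2.
  have -> : a ^+ 4 = (a ^+ 2) ^+ 2 by rewrite -exprM.
  have -> : 256 * t ^+ 2 = (16 * t) ^+ 2 by ring.
  by rewrite lerXn2r // nnegrE ?sqr_ge0 // mulr_ge0 // ltW.
apply: (@le_trans _ _ (256 * t ^+ 2 * t ^+ 2)).
  by rewrite ler_wpM2r // sqr_ge0.
rewrite -mulrA ler_pM2l // -exprD.
by apply: (act_ge (k := 4)); rewrite ?exprn_ge0 // ltW.
Qed.

(** The uniform error of the empirical quantile contributes [sqrt (h * ln (ln n))], which can exceed
    [h^(1/2)]. It is absorbed by the geometric mean [s * t^2] of [bias] and [(s * t^4)^-1]. *)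
Lemma mean_le_rate : s * c ^+ 2 <= 8 * (bias + kiefer).
Proof.
have ct : c ^+ 2 <= 16 * t ^+ 2.
  apply: (@le_trans _ _ (c ^+ 4)); first by rewrite ler_weXn2l.
  apply: le_trans c_a _; apply: le_trans a_t _.
  by rewrite ler_pM2l // -[leLHS]expr1 le_t.
apply: (@le_trans _ _ (s * (16 * t ^+ 2))); first by rewrite ler_pM2l.
have k1 : (s * t ^+ 4)^-1 <= kiefer.
  rewrite -[leLHS]mul1r /kiefer ler_pM2r ?invr_gt0 ?mulr_gt0 ?exprn_gt0 //.
  exact: ac_ge1.
have amgm : 2 * (s * t ^+ 2) <= bias + (s * t ^+ 4)^-1.
  rewrite -subr_ge0.
  have -> : bias + (s * t ^+ 4)^-1 - 2 * (s * t ^+ 2) =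
      (t ^+ 6 * s ^+ 2 - 1) ^+ 2 / (s * t ^+ 4).
    by rewrite /bias; field; rewrite !gt_eqF.
  by rewrite divr_ge0 ?sqr_ge0 // mulr_ge0 ?exprn_ge0 // ltW.
lra.
Qed.

End monomials.

(** The coefficient of [A * sg] is [(qh - qq) / qh + Y + dl]; times [qh] it equals [(qh - qq + qq *
    Y) + Y * (qh - qq) + dl * qh]. The first-order terms cancel in the first bracket, and the second
    product is quadratic in [Y] up to [E]. *)
Lemma estimation_error (sg qh qq Qd A Am Y dl E B1 cq : R) :
  0 <= sg -> 0 < cq -> cq <= qh -> 0 <= qq -> qq <= B1 -> `|A| <= Am ->
  `|qh - qq + qq * Y| <= E ->
  `|sg * (Qd + A * (qh - qq)) / qh - (- A * (sg * (Y + dl)))|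
   <= cq^-1 * (sg * `|Qd| + Am * (sg * E * (1 + `|Y| + `|dl|) + B1 * (sg * Y ^+ 2)
        + B1 * (1 + `|Y|) * (sg * `|dl|))).
Proof.
move=> sg0 cq0 cqh qq0 qqB AAm hE.
have qh0 : 0 < qh by exact: lt_le_trans cqh.
have Am0 : 0 <= Am by exact: le_trans AAm.
have E0 : 0 <= E by exact: le_trans hE.
have -> : sg * (Qd + A * (qh - qq)) / qh - (- A * (sg * (Y + dl))) =
   qh^-1 * (sg * Qd + A * (sg * ((qh - qq + qq * Y) + Y * (qh - qq) + dl * qh))).
  by field; rewrite gt_eqF.
rewrite normrM normfV (gtr0_norm qh0).
apply: ler_pM; rewrite ?invr_ge0 ?normr_ge0 ?(ltW qh0) //.
  by rewrite lef_pV2 ?posrE.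
apply: le_trans (ler_normD _ _) _; rewrite !normrM (ger0_norm sg0); apply: lerD => //.
apply: ler_pM => //.
  by rewrite mulr_ge0.
have hY : `|qh - qq| <= E + B1 * `|Y|.
  have -> : qh - qq = (qh - qq + qq * Y) - qq * Y by ring.
  apply: le_trans (ler_normB _ _) _; apply: lerD => //.
  by rewrite normrM (ger0_norm qq0) ler_wpM2r.
have hq : `|qh| <= B1 + E + B1 * `|Y|.
  have -> : qh = qq + (qh - qq) by ring.
  by apply: le_trans (ler_normD _ _) _; rewrite (ger0_norm qq0); lra.
have -> : sg * E * (1 + `|Y| + `|dl|) + B1 * (sg * Y ^+ 2) + B1 * (1 + `|Y|) * (sg * `|dl|) =
   sg * (E + `|Y| * (E + B1 * `|Y|) + `|dl| * (B1 + E + B1 * `|Y|)).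
  by rewrite -[Y ^+ 2]real_normK ?num_real //; ring.
rewrite ler_wpM2l //.
apply: le_trans (ler_normD _ _) _; apply: lerD; last by rewrite normrM ler_wpM2l.
apply: le_trans (ler_normD _ _) _; apply: lerD => //.
by rewrite normrM ler_wpM2l.
Qed.

(** No cancellation is sought: [qh] drops out of [A * qh / qh] and the rest of the numerator is
    merely bounded, so a weak lower bound [cq] suffices. *)
Lemma crude_error (sg qh qq Qd A Am G B0 B1 cq : R) :
  0 <= sg -> 0 < cq -> cq <= qh -> 0 <= qq -> qq <= B1 -> `|A| <= Am -> `|Qd| <= B0 ->
  `|sg * (Qd + A * (qh - qq)) / qh - (- A * G)|
   <= (B0 + Am * B1) * (sg / cq) + Am * sg + Am * `|G|.
Proof.
move=> sg0 cq0 cqh qq0 qqB AAm QB.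
have qh0 : 0 < qh by exact: lt_le_trans cqh.
have Am0 : 0 <= Am by exact: le_trans AAm.
have -> : sg * (Qd + A * (qh - qq)) / qh - (- A * G) =
   (Qd - A * qq) * (sg / qh) + A * sg + A * G.
  by field; rewrite gt_eqF.
apply: le_trans (ler_normD _ _) _; apply: lerD; last by rewrite normrM ler_wpM2r.
apply: le_trans (ler_normD _ _) _; apply: lerD; last first.
  by rewrite normrM (ger0_norm sg0) ler_wpM2r.
rewrite normrM; apply: ler_pM => //.
  apply: le_trans (ler_normB _ _) _; apply: lerD => //.
  by rewrite normrM (ger0_norm qq0) ler_pM.
rewrite ger0_norm ?divr_ge0 // ?(ltW qh0) // ler_wpM2l // lef_pV2 ?posrE //.
Qed.

End rates.

Lemma quad_bound (R : realType) (k x y z : R) :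
  1 <= k -> 1 <= y -> x <= k * y + 1 -> z <= 16 * y -> x + z <= (k + 17) ^+ 2 * y.
Proof.
move=> k1 y1 xy zy; have : (k + 17) * y * 1 <= (k + 17) * y * (k + 17).
  apply: ler_wpM2l; last lra.
  by apply: mulr_ge0; lra.
lra.
Qed.

(** * The two bandwidth regimes for a fixed sample *)

Section regimes.
Context {R : realType}.
Variables (K : R -> R) (Lk : R).
Hypothesis K_ge0 : forall x, 0 <= K x.
Hypothesis K_lip : forall x y, `|K x - K y| <= Lk * `|x - y|.
Hypothesis K_supp : forall x, 1 < `|x| -> K x = 0.
Hypothesis Lk_gt0 : 0 < Lk.
Hypothesis K_int : (\int[lebesgue_measure]_x (K x)%:E = 1)%E.
Variables (x0 c0 eta : R).
Hypothesis c0_gt0 : 0 < c0.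
Hypothesis eta_gt0 : 0 < eta.
Hypothesis K_bump : forall z, `|z - x0| <= eta -> c0 <= K z.
Variables (Q q : R -> R) (B0 B1 B2 c1 : R).
Hypothesis B2_ge0 : 0 <= B2.
Hypothesis c1_gt0 : 0 < c1.
Hypothesis Q_bound : forall x : R, 0 <= x -> x <= 1 -> `|Q x| <= B0.
Hypothesis q_bounds : forall x : R, 0 <= x -> x <= 1 -> 0 <= q x /\ q x <= B1.
Hypothesis q_lip : forall x y : R, 0 <= x -> x <= 1 -> 0 <= y -> y <= 1 ->
  `|q y - q x| <= B2 * `|y - x|.
Hypothesis Q_taylor : forall x y : R, 0 <= x -> x <= 1 -> 0 <= y -> y <= 1 ->
  `|Q y - Q x - q x * (y - x)| <= B2 * (y - x) ^+ 2.
Hypothesis Q_incr : forall x y : R, 0 <= x -> x <= y -> y <= 1 -> c1 * (y - x) <= Q y - Q x.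
Variables (n : nat) (h u : R).
Hypothesis n_gt0 : (0 < n)%N.
Hypothesis h_gt0 : 0 < h.
Hypothesis hu : h <= u.
Hypothesis uh : u <= 1 - h.
Hypothesis nh_ge1 : 1 <= n%:R * h.
Variable U : nat -> R.
Hypothesis U_gt0 : forall l, 0 < U l.
Hypothesis U_le1 : forall l, U l <= 1.
Hypothesis U_mod : modulus_bound U n.
Variable kD : R.
Hypothesis kD_ge1 : 1 <= kD.
Variable E : nat -> R.
Hypothesis E_near : forall l, `|E l - n%:R^-1 * \sum_(0 <= i < n) Kh K h (u - i%:R / n%:R)|
  <= 5 * Lk / (n%:R * h).
Variables (A Am : R).
Hypothesis A_le : `|A| <= Am.
Variables s t a c : R.
Hypothesis s_gt0 : 0 < s.
Hypothesis t_ge1 : 1 <= t.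
Hypothesis a_ge1 : 1 <= a.
Hypothesis c_ge1 : 1 <= c.
Hypothesis a_t : a ^+ 2 <= 16 * t.
Hypothesis c_a : c ^+ 4 <= a ^+ 2.
Hypothesis nE : n%:R = t ^+ 16.
Hypothesis hE : h = s ^+ 2.
Hypothesis LE : ln n%:R = a ^+ 2 :> R.
Hypothesis LLE : ln (ln n%:R) = c ^+ 4 :> R.

Definition Gsum : R := Num.sqrt (n%:R * h) *
  (n%:R^-1 * \sum_(0 <= l < n) (Kh K h (u - U l) - E l)).

(** [Zn - Zstar] for one sample with bids [Q (U l)]; the expectations appear as numbers [E l], known
    only through [E_near]. *)
Definition Zdiff : R :=
  Num.sqrt (n%:R * h) * (Q (ostat U n (Num.truncn (n%:R * u)).+1) - Q u
    + A * (qsum K Q n h u U - q u)) / qsum K Q n h u U - (- A * Gsum).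

Lemma riemann_bound : `|1 - n%:R^-1 * \sum_(0 <= i < n) kweight K n h u i|
  <= 5 * Lk / (n%:R * h).
Proof. exact: (kernel_riemann_sum K_ge0 K_lip K_supp Lk_gt0 K_int). Qed.

Lemma sqrt_nh : Num.sqrt (n%:R * h) = t ^+ 8 * s.
Proof.
have -> : n%:R * h = (t ^+ 8 * s) ^+ 2 by rewrite nE hE; ring.
rewrite sqrtr_sqr ger0_norm // mulr_ge0 ?exprn_ge0 ?(ltW s_gt0) //.
exact: le_trans t_ge1.
Qed.

Lemma mean_E : `|n%:R^-1 * \sum_(0 <= l < n) E l -
   n%:R^-1 * \sum_(0 <= i < n) kweight K n h u i| <= 5 * Lk / (n%:R * h).
Proof.
have nn0 : 0 < n%:R :> R by rewrite ltr0n.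
set rs := (X in `|_ - X|).
have -> : rs = n%:R^-1 * \sum_(0 <= l < n) rs.
  by rewrite big_const_nat subn0 iter_addr_0 -[rs *+ n]mulr_natl mulKf // gt_eqF.
rewrite -mulrBr -sumrB normrM gtr0_norm ?invr_gt0 // mulrC ler_pdivrMr //.
apply: le_trans (ler_norm_sum _ _ _) _.
apply: (@le_trans _ _ (\sum_(0 <= l < n) 5 * Lk / (n%:R * h))).
  by apply: ler_sum => l _; exact: E_near.
by rewrite big_const_nat subn0 iter_addr_0 -[_ *+ n]mulr_natr.
Qed.

Lemma t_gt0 : 0 < t. Proof. exact: lt_le_trans t_ge1. Qed.
Lemma a_gt0 : 0 < a. Proof. exact: lt_le_trans a_ge1. Qed.
Lemma c_gt0 : 0 < c. Proof. exact: lt_le_trans c_ge1. Qed.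
Lemma nR_gt0 : 0 < n%:R :> R. Proof. by rewrite ltr0n. Qed.

Definition sigma : R := t ^+ 8 * s.

Lemma sigma_gt0 : 0 < sigma.
Proof. by rewrite mulr_gt0 // exprn_gt0 // t_gt0. Qed.

Lemma nh_sigma : n%:R * h = sigma ^+ 2.
Proof. by rewrite /sigma nE hE; ring. Qed.

Lemma sigma_ge1 : 1 <= sigma.
Proof.
rewrite leNgt; apply/negP => lt; move: nh_ge1; rewrite nh_sigma leNgt.
by rewrite exprn_ilt1 // ltW // sigma_gt0.
Qed.

Definition rho : R := bias s t + kiefer s t a c.

Lemma bias_le_rho : bias s t <= rho.
Proof. by rewrite lerDl ltW // kiefer_gt0. Qed.

Lemma kiefer_le_rho : kiefer s t a c <= rho.
Proof. by rewrite lerDr bias_ge0. Qed.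

Lemma rho_ge0 : 0 <= rho.
Proof. by apply: le_trans bias_le_rho; exact: bias_ge0. Qed.

Lemma sigmaV_le : sigma^-1 <= rho.
Proof. by apply: le_trans kiefer_le_rho; exact: inv_le_kiefer. Qed.

Lemma log_sigma_le : a ^+ 2 / sigma <= 16 * rho.
Proof.
apply: (@le_trans _ _ (16 * kiefer s t a c)); first exact: log_le_kiefer.
by apply: ler_wpM2l; [exact: ler0n | exact: kiefer_le_rho].
Qed.

Lemma log2_sigma_le : a ^+ 4 * t ^+ 2 / sigma <= 256 * rho.
Proof.
apply: (@le_trans _ _ (256 * kiefer s t a c)); first exact: log2_le_kiefer.
by apply: ler_wpM2l; [exact: ler0n | exact: kiefer_le_rho].
Qed.

Lemma h_le1 : h <= 1.
Proof. have h1 := hu; have h2 := uh; lra. Qed.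

Definition dbound : R := kD * (c ^+ 2 / t ^+ 8).

(** The modulus of continuity at scale [dbound], of order [n^(-3/4) * ell n]; 28 is that of
    [modulus_bound], [kD + 17] that of [quad_bound]. *)
Definition ombound : R := 28 * (kD + 17) * (a * c / t ^+ 12).

Lemma kD_ge0 : 0 <= kD. Proof. exact: le_trans kD_ge1. Qed.

Lemma dbound_ge0 : 0 <= dbound.
Proof. by rewrite mulr_ge0 ?kD_ge0 // divr_ge0 // exprn_ge0 // ltW // ?c_gt0 ?t_gt0. Qed.

Hypothesis U_unif : forall x, 0 <= x -> x <= 1 ->
  `|(cnt_itv U 0 x 0 n)%:R - n%:R * x| <= kD * Num.sqrt (n%:R * ln (ln n%:R)).

Lemma edev_dbound x : 0 <= x -> x <= 1 -> `|edev n U x| <= dbound.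
Proof.
move=> xx0 xx1; have := U_unif xx0 xx1.
have nn0 := nR_gt0; have t0 := t_gt0; have cc0 := c_gt0.
have -> : edev n U x = ((cnt_itv U 0 x 0 n)%:R - n%:R * x) / n%:R.
  by rewrite /edev /ecdf; field; rewrite gt_eqF.
rewrite normrM (gtr0_norm (x := n%:R^-1)) ?invr_gt0 // => h1.
have -> : dbound = kD * (t ^+ 8 * c ^+ 2) / n%:R.
  by rewrite /dbound nE; field; rewrite gt_eqF.
rewrite ler_pM2r ?invr_gt0 //; apply: le_trans h1 _; rewrite LLE ler_wpM2l ?kD_ge0 //.
have -> : n%:R * c ^+ 4 = (t ^+ 8 * c ^+ 2) ^+ 2 by rewrite nE; ring.
by rewrite sqrtr_sqr ger0_norm // mulr_ge0 ?exprn_ge0 // ltW.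
Qed.

Lemma edev_ombound x y : 0 <= x -> x <= 1 -> 0 <= y -> y <= 1 ->
  `|y - x| <= dbound + n%:R^-1 -> `|edev n U y - edev n U x| <= ombound.
Proof.
move=> xx0 xx1 yy0 yy1 yx.
have nn0 := nR_gt0; have t0 := t_gt0; have cc0 := c_gt0; have a0 := a_gt0.
have k1 := kD_ge1.
apply: le_trans (edev_diff n_gt0 U_mod xx0 xx1 yy0 yy1) _.
have -> : ombound = 28 * ((kD + 17) * (a * c * t ^+ 4)) / n%:R.
  by rewrite /ombound nE; field; rewrite gt_eqF.
rewrite ler_pM2r ?invr_gt0 // ler_pM2l //; apply: dev_le_sqrt.
  apply: mulr_ge0; first lra.
  by rewrite mulr_ge0 ?exprn_ge0 ?(ltW t0) // mulr_ge0 // ltW.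
rewrite LE; have c2t : 1 <= c ^+ 2 * t ^+ 8.
  by rewrite -[1]mulr1 ler_pM // exprn_ege1.
have m1 : n%:R * `|y - x| <= kD * (c ^+ 2 * t ^+ 8) + 1.
  have -> : kD * (c ^+ 2 * t ^+ 8) + 1 = n%:R * (dbound + n%:R^-1).
    by rewrite /dbound mulrDr divff ?gt_eqF // nE; congr (_ + _); field; rewrite gt_eqF.
  by rewrite ler_pM2l.
have a2t : a ^+ 2 <= 16 * (c ^+ 2 * t ^+ 8).
  apply: le_trans a_t _; rewrite ler_pM2l // -[leLHS]mul1r ler_pM ?exprn_ege1 //; first exact: ltW.
  by rewrite -[leLHS]expr1 ler_weXn2l.
have -> : ((kD + 17) * (a * c * t ^+ 4)) ^+ 2 = (kD + 17) ^+ 2 * (c ^+ 2 * t ^+ 8) * a ^+ 2 by ring.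
rewrite ler_wpM2r ?sqr_ge0 //; exact: quad_bound.
Qed.

Let Y : R := \sum_(0 <= i < n) kweight K n h u i *
   (edev n U (i.+1%:R / n%:R) - edev n U (i%:R / n%:R)).

Let dl : R := n%:R^-1 * \sum_(0 <= l < n) (Kh K h (u - U l) - E l) - Y.

Lemma log_ge1 : 1 <= ln n%:R :> R. Proof. by rewrite LE exprn_ege1. Qed.

(** [280 = 5 * 28 * 2] comes from [edev_increment_sum]. In [kd], [179 = 29 * 6 + 5] adds the window
    count for [ln n <= n h] and the error of the expectations. *)
Definition kY : R := 280 * Lk.
Definition kd : R := 179 * Lk.

Lemma kY_gt0 : 0 < kY. Proof. exact: mulr_gt0 (ltr0Sn _ _) Lk_gt0. Qed.
Lemma kd_gt0 : 0 < kd. Proof. exact: mulr_gt0 (ltr0Sn _ _) Lk_gt0. Qed.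

Lemma increment_bound : ln n%:R <= n%:R * h -> `|Y| <= kY * (a / sigma).
Proof.
move=> Lnh; apply: le_trans (edev_increment_sum K_ge0 K_lip K_supp Lk_gt0 n_gt0 h_gt0 hu uh nh_ge1
     U_mod log_ge1 Lnh) _.
have nn0 := nR_gt0; have sg0 := sigma_gt0; have a0 := a_gt0; have h0 := h_gt0.
have -> : Num.sqrt (n%:R * h * ln n%:R) = sigma * a.
  have -> : n%:R * h * ln n%:R = (sigma * a) ^+ 2 by rewrite nh_sigma LE; ring.
  by rewrite sqrtr_sqr ger0_norm // mulr_ge0 // ltW.
have -> : 5 * Lk / h * (28 * (2 * (sigma * a)) / n%:R) = kY * (sigma * a / (n%:R * h)).
  by rewrite /kY; field; rewrite !gt_eqF.
rewrite nh_sigma.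
by have -> : sigma * a / sigma ^+ 2 = a / sigma by field; rewrite gt_eqF.
Qed.

Lemma a_le_sigma : ln n%:R <= n%:R * h -> a <= sigma.
Proof.
move=> Lnh; rewrite leNgt; apply/negP => lt; move: Lnh; rewrite LE nh_sigma leNgt.
by rewrite ltrXn2r // ltW // sigma_gt0.
Qed.

Lemma increment_bound1 : ln n%:R <= n%:R * h -> `|Y| <= kY.
Proof.
move=> Lnh; apply: le_trans (increment_bound Lnh) _.
rewrite ger_pMr ?kY_gt0 //.
by rewrite ler_pdivrMr ?sigma_gt0 // mul1r a_le_sigma.
Qed.

(** The quadratic term left by the linearization is of order [ln n / sqrt (n h)], below
    [n^(1/4) / sqrt (n h)]. *)
Lemma increment_sqr : ln n%:R <= n%:R * h ->
  sigma * Y ^+ 2 <= 16 * kY ^+ 2 * rho.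
Proof.
move=> Lnh; have sg0 := sigma_gt0.
have Yb := increment_bound Lnh.
apply: (@le_trans _ _ (sigma * (kY * (a / sigma)) ^+ 2)).
  rewrite ler_pM2l // -[Y ^+ 2]real_normK ?num_real // lerXn2r // nnegrE //.
  exact: le_trans Yb.
have -> : sigma * (kY * (a / sigma)) ^+ 2 = kY ^+ 2 * (a ^+ 2 / sigma).
  by field; rewrite gt_eqF.
have -> : 16 * kY ^+ 2 * rho = kY ^+ 2 * (16 * rho) by ring.
by apply: ler_wpM2l; [exact: sqr_ge0 | exact: log_sigma_le].
Qed.

Lemma remainder_bound : ln n%:R <= n%:R * h -> `|dl| <= kd / sigma ^+ 2.
Proof.
move=> Lnh.
have k1 := kernel_sum_repr K_ge0 K_lip K_supp Lk_gt0 n_gt0 h_gt0 hu uh U.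
rewrite -/Y in k1.
have w1 := window_le n_gt0 h_gt0 hu uh U_mod log_ge1.
have nh1 := nh_ge1; have sg0 := sigma_gt0.
have -> : dl = (n%:R^-1 * \sum_(0 <= l < n) Kh K h (u - U l)
   - n%:R^-1 * \sum_(0 <= i < n) kweight K n h u i - Y)
   - (n%:R^-1 * \sum_(0 <= l < n) E l - n%:R^-1 * \sum_(0 <= i < n) kweight K n h u i).
  by rewrite /dl sumrB; ring.
apply: le_trans (ler_normB _ _) _.
apply: (@le_trans _ _ (Lk / (n%:R * h) ^+ 2 * (174 * (n%:R * h)) + 5 * Lk / (n%:R * h))).
  apply: lerD; last exact: mean_E.
  apply: le_trans k1 _; apply: ler_wpM2l; last by lra.
  by rewrite divr_ge0 ?sqr_ge0 // ltW.
rewrite nh_sigma /kd le_eqVlt; apply/orP; left; apply/eqP; field.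
by rewrite gt_eqF.
Qed.

Lemma remainder_bound1 : ln n%:R <= n%:R * h -> `|dl| <= kd.
Proof.
move=> Lnh; apply: le_trans (remainder_bound Lnh) _.
rewrite ger_pMr ?kd_gt0 //.
by rewrite invf_le1 ?exprn_gt0 ?sigma_gt0 // exprn_ege1 // sigma_ge1.
Qed.

Lemma remainder_scaled : ln n%:R <= n%:R * h -> sigma * `|dl| <= kd * rho.
Proof.
move=> Lnh; have sg0 := sigma_gt0.
apply: (@le_trans _ _ (sigma * (kd / sigma ^+ 2))).
  by rewrite ler_pM2l // remainder_bound.
have -> : sigma * (kd / sigma ^+ 2) = kd * sigma^-1 by field; rewrite gt_eqF.
by rewrite ler_pM2l ?kd_gt0 // sigmaV_le.
Qed.

Lemma sigma_dbound : sigma * dbound <= 8 * kD * rho.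
Proof.
have t0 := t_gt0.
have -> : sigma * dbound = kD * (s * c ^+ 2) by rewrite /sigma /dbound; field; rewrite gt_eqF.
have -> : 8 * kD * rho = kD * (8 * rho) by ring.
by apply: ler_wpM2l; [exact: kD_ge0 | exact: mean_le_rate].
Qed.

Lemma sigma_dbound2 : sigma * dbound ^+ 2 / h <= 16 * kD ^+ 2 * rho.
Proof.
have t0 := t_gt0; have sg0 := sigma_gt0; have s0 := s_gt0.
have -> : sigma * dbound ^+ 2 / h = kD ^+ 2 * (c ^+ 4 / sigma).
  by rewrite /sigma /dbound hE; field; rewrite !gt_eqF.
have -> : 16 * kD ^+ 2 * rho = kD ^+ 2 * (16 * rho) by ring.
apply: ler_wpM2l; first exact: sqr_ge0.
apply: le_trans log_sigma_le.
by rewrite ler_pM2r // invr_gt0.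
Qed.

(** The Bahadur error times the [1 / h] of Abel summation is [kiefer] up to a constant: this term
    dictates the last summand of the rate. *)
Lemma sigma_ombound : sigma * ombound / h <= 28 * (kD + 17) * rho.
Proof.
have t0 := t_gt0; have s0 := s_gt0; have k0 := kD_ge0.
have -> : sigma * ombound / h = 28 * (kD + 17) * kiefer s t a c.
  by rewrite /sigma /ombound /kiefer hE; field; rewrite !gt_eqF.
by apply: ler_wpM2l; [lra | exact: kiefer_le_rho].
Qed.

Lemma sigma_inv_nh : sigma * n%:R^-1 / h <= rho.
Proof.
have nn0 := nR_gt0; have h0 := h_gt0; have sg0 := sigma_gt0.
have -> : sigma * n%:R^-1 / h = sigma^-1.
  have -> : sigma * n%:R^-1 / h = sigma / (n%:R * h) by field; rewrite !gt_eqF.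
  by rewrite nh_sigma; field; rewrite gt_eqF.
exact: sigmaV_le.
Qed.

Lemma sigma_inv_n : sigma * n%:R^-1 <= rho.
Proof.
apply: le_trans sigma_inv_nh; rewrite ler_pdivlMr // ger_pMr ?h_le1 //.
by rewrite mulr_gt0 ?sigma_gt0 // invr_gt0 nR_gt0.
Qed.

Lemma sigma_h : sigma * h <= rho.
Proof.
have -> : sigma * h = bias s t by rewrite /sigma /bias hE; ring.
exact: bias_le_rho.
Qed.

Definition err_const : R := 5 * B1 * Lk + 2 * B2 * (1 + 5 * Lk) +
  5 * Lk * (16 * kD ^+ 2 * B2 + (28 * (kD + 17) + 1) * B1 + 24 * kD * B2).

Lemma err_bound :
  sigma * (B1 * (5 * Lk / (n%:R * h)) + B2 * (h + n%:R^-1) * (1 + 5 * Lk / (n%:R * h))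
     + 5 * Lk / h * (B2 * dbound ^+ 2 + B1 * (ombound + n%:R^-1) + B2 * (h + 2 / n%:R) * dbound))
  <= err_const * rho.
Proof.
have nn0 := nR_gt0; have h0 := h_gt0; have sg0 := sigma_gt0; have Lk0 := Lk_gt0.
have B20 := B2_ge0; have nh1 := nh_ge1; have r0 := rho_ge0; have D0 := dbound_ge0.
have u0 : 0 <= u by apply: le_trans hu; exact: ltW.
have u1 : u <= 1 by apply: le_trans uh _; rewrite gerBl ltW.
have [qu0 qu1] := q_bounds u0 u1.
have B10 : 0 <= B1 by exact: le_trans qu1.
have nhV0 : 0 <= (n%:R * h)^-1 by rewrite invr_ge0 mulr_ge0 // ltW.
have nhV : (n%:R * h)^-1 <= 1 by rewrite invf_le1 // mulr_gt0.
have x1 := sigmaV_le; have x2 := sigma_h; have x3 := sigma_inv_n.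
have x4 := sigma_dbound2; have x5 := sigma_ombound; have x6 := sigma_inv_nh.
have x7 := sigma_dbound.
(* Every summand is rewritten around a product already bounded by a multiple of [rho], so that the
   inequality splits termwise. *)
have -> : sigma * (B1 * (5 * Lk / (n%:R * h)) + B2 * (h + n%:R^-1) * (1 + 5 * Lk / (n%:R * h))
     + 5 * Lk / h * (B2 * dbound ^+ 2 + B1 * (ombound + n%:R^-1) + B2 * (h + 2 / n%:R) * dbound)) =
   5 * B1 * Lk * (sigma * n%:R^-1 / h)
   + B2 * (1 + 5 * Lk * (n%:R * h)^-1) * (sigma * h + sigma * n%:R^-1)
   + 5 * Lk * (B2 * (sigma * dbound ^+ 2 / h) + (sigma * ombound / h + sigma * n%:R^-1 / h) * B1
       + B2 * (1 + 2 * (n%:R * h)^-1) * (sigma * dbound)).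
  by field; rewrite !gt_eqF.
have -> : err_const * rho = 5 * B1 * Lk * rho + B2 * (1 + 5 * Lk) * (rho + rho)
   + 5 * Lk * (B2 * (16 * kD ^+ 2 * rho) + (28 * (kD + 17) * rho + rho) * B1
       + B2 * 3 * (8 * kD * rho)).
  by rewrite /err_const; ring.
have Lk5 : 5 * Lk * (n%:R * h)^-1 <= 5 * Lk by rewrite ger_pMr // mulr_gt0.
have Lk50 : 0 <= 5 * Lk * (n%:R * h)^-1 by rewrite mulr_ge0 // mulr_ge0 // ltW.
apply: lerD; first apply: lerD.
- by apply: ler_wpM2l => //; rewrite mulr_ge0 ?(ltW Lk0) // mulr_ge0.
- apply: ler_pM.
  + by rewrite mulr_ge0 // addr_ge0.
  + by rewrite addr_ge0 // mulr_ge0 ?(ltW sg0) ?invr_ge0 // ltW.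
  + by apply: ler_wpM2l => //; rewrite lerD2l.
  + exact: lerD.
- apply: ler_wpM2l; first by rewrite mulr_ge0 // ltW.
  apply: lerD; first apply: lerD.
  + exact: ler_wpM2l.
  + by apply: ler_wpM2r => //; exact: lerD.
  + apply: ler_pM => //.
    * by rewrite mulr_ge0 // addr_ge0 // mulr_ge0.
    * by rewrite mulr_ge0 // ltW.
    * by apply: ler_wpM2l => //; lra.
Qed.

Lemma quantile_error :
  sigma * `|Q (ostat U n (Num.truncn (n%:R * u)).+1) - Q u| <= (B1 + B2) * (8 * kD + 1) * rho.
Proof.
have nn0 := nR_gt0; have sg0 := sigma_gt0; have B20 := B2_ge0; have h0 := h_gt0.
have ni0 : 0 < n%:R^-1 :> R by rewrite invr_gt0.
have u0 : 0 <= u by apply: le_trans hu; exact: ltW.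
have u1' : u < 1 by apply: le_lt_trans uh _; rewrite gtrBl.
have u1 := ltW u1'.
have [qu0 qu1] := q_bounds u0 u1.
have B10 : 0 <= B1 by exact: le_trans qu1.
have [k1 k2] := truncn_scaled u0 n_gt0.
have kn : ((Num.truncn (n%:R * u)).+1 <= n)%N.
  rewrite -(ltr_nat R) -(ltr_pM2r (x := n%:R^-1)) // (le_lt_trans k1) // divff //.
  by rewrite gt_eqF.
have oc := ostat_close n_gt0 U_gt0 U_le1 edev_dbound (ltn0Sn _) kn.
have op := ostat_gt0 U_gt0 (ltn0Sn _) kn.
have ol := ostat_le1 U_le1 (ltn0Sn _) kn.
set k := Num.truncn _ in k1 k2 kn oc op ol *; set x := ostat U n k.+1 in oc op ol *.
have xu : `|x - u| <= dbound + n%:R^-1.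
  apply: le_trans (ler_distD (k.+1%:R / n%:R) x u) _; apply: lerD => //.
  move: k2; rewrite -addn1 natrD mulrDl mul1r ler_norml => k2.
  by apply/andP; split; lra.
have xu1 : `|x - u| <= 1 by rewrite ler_norml; apply/andP; split; lra.
have Qx : `|Q x - Q u| <= (B1 + B2) * `|x - u|.
  have tq := Q_taylor u0 u1 (ltW op) ol.
  have -> : Q x - Q u = q u * (x - u) + (Q x - Q u - q u * (x - u)) by ring.
  apply: le_trans (ler_normD _ _) _; rewrite normrM (ger0_norm qu0) mulrDl.
  apply: lerD; first exact: ler_wpM2r.
  apply: le_trans tq _; apply: ler_wpM2l => //.
  by rewrite -real_normK ?num_real // expr2 ler_piMl.
apply: (@le_trans _ _ ((B1 + B2) * (sigma * dbound + sigma * n%:R^-1))).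
  rewrite -mulrDr mulrCA ler_pM2l //; apply: le_trans Qx _.
  by apply: ler_wpM2l => //; exact: addr_ge0.
rewrite -mulrA; apply: ler_wpM2l; first exact: addr_ge0.
by rewrite mulrDl mul1r; apply: lerD; [exact: sigma_dbound | exact: sigma_inv_n].
Qed.

Definition large_const : R := (c0 * c1 * eta / 2)^-1 *
  ((B1 + B2) * (8 * kD + 1) + Am * (err_const * (1 + kY + kd)
    + B1 * (16 * kY ^+ 2) + B1 * (1 + kY) * kd)).

Lemma large_bandwidth :
  ln n%:R <= n%:R * h -> 1 <= 2 * eta * (n%:R * h) -> 197 * ln n%:R <= eta * (n%:R * h) ->
  `|Zdiff| <= large_const * rho.
Proof.
move=> Lnh e1 e197.
have sg0 := sigma_gt0.
have u0 : 0 <= u by apply: le_trans hu; exact: ltW.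
have u1 : u <= 1 by apply: le_trans uh _; rewrite gerBl ltW.
have [qu0 qu1] := q_bounds u0 u1.
have B10 : 0 <= B1 by exact: le_trans qu1.
have Am0 : 0 <= Am by exact: le_trans A_le.
have qr := qsum_repr K_ge0 K_lip K_supp Lk_gt0 B2_ge0 q_bounds q_lip Q_taylor n_gt0
  h_gt0 hu uh nh_ge1 U_gt0 U_le1 edev_dbound edev_ombound riemann_bound.
rewrite -/Y in qr.
have qh := qsum_ge_const K_ge0 K_lip K_supp Lk_gt0 c1_gt0 Q_incr n_gt0 h_gt0 hu uh nh_ge1
  U_gt0 U_le1 c0_gt0 eta_gt0 K_bump U_mod log_ge1 e1 e197.
have cq0 : 0 < c0 * c1 * eta / 2 by rewrite !mulr_gt0.
have GE : Gsum = sigma * (Y + dl).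
  by rewrite /Gsum sqrt_nh -/sigma /dl; congr (_ * _); ring.
rewrite /Zdiff GE sqrt_nh -/sigma.
apply: le_trans (estimation_error _ _ (ltW sg0) cq0 qh qu0 qu1 A_le qr) _.
have Eb := err_bound; have Yb := increment_bound1 Lnh; have db := remainder_bound1 Lnh.
have Y2 := increment_sqr Lnh; have sd := remainder_scaled Lnh; have r0 := rho_ge0.
have kY0 := ltW kY_gt0; have kd0 := ltW kd_gt0.
set Eq := (X in sigma * X) in Eb *.
have Eq0 : 0 <= sigma * Eq by rewrite mulr_ge0 ?(ltW sg0) //; exact: le_trans qr.
rewrite /large_const -[leRHS]mulrA; apply: ler_wpM2l; first by rewrite invr_ge0 ltW.
rewrite [leRHS]mulrDl; apply: lerD; first exact: quantile_error.
rewrite -[leRHS]mulrA; apply: ler_wpM2l => //.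
rewrite [leRHS]mulrDl [X in _ <= X + _]mulrDl; apply: lerD; first apply: lerD.
- have -> : err_const * (1 + kY + kd) * rho = err_const * rho * (1 + kY + kd) by ring.
  apply: ler_pM => //.
  by apply: lerD => //; apply: lerD.
- have -> : B1 * (16 * kY ^+ 2) * rho = B1 * (16 * kY ^+ 2 * rho) by ring.
  exact: ler_wpM2l.
- have -> : B1 * (1 + kY) * kd * rho = B1 * (1 + kY) * (kd * rho) by ring.
  apply: ler_pM => //.
  + by rewrite mulr_ge0 // addr_ge0.
  + by rewrite mulr_ge0 // ltW.
  + by apply: ler_wpM2l => //; rewrite lerD2l.
Qed.

(** [300 = 116 + 174 + 10]: the window bound contributes the first two, the expectations the last;
    in [kw], [58 = 2 * 29] multiplies the logarithm of the window bound. *)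
Definition kS : R := 300 * Lk.
Definition kw : R := 58 * Lk.

Lemma Gsum_bound : `|Gsum| <= sigma * (kS + 1) + kw * (a ^+ 2 / sigma).
Proof.
have nn0 := nR_gt0; have sg0 := sigma_gt0; have Lk0 := Lk_gt0; have nh1 := nh_ge1.
have h0 := h_gt0.
have nh0 : 0 < n%:R * h by rewrite mulr_gt0.
have nhV0 : 0 < (n%:R * h)^-1 by rewrite invr_gt0.
have nhV : (n%:R * h)^-1 <= 1 by rewrite invf_le1.
have w1 := window_le n_gt0 h_gt0 hu uh U_mod log_ge1.
have S1 := kernel_sum_le K_ge0 K_lip K_supp Lk_gt0 u n_gt0 h_gt0 U_gt0 U_le1.
set S := (X in X <= _) in S1.
have S0 : 0 <= S.
  rewrite mulr_ge0 ?invr_ge0 //; apply: sumr_ge0 => l _; exact: Kh_ge0.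
have M1 := mean_E; have rb := riemann_bound.
set M := n%:R^-1 * \sum_(0 <= l < n) E l in M1.
set rs := n%:R^-1 * _ in M1 rb.
have e5 : 5 * Lk / (n%:R * h) <= 5 * Lk by rewrite ger_pMr // mulr_gt0.
have Mb : `|M| <= 1 + 10 * Lk.
  move: M1 rb; rewrite !ler_distl ler_norml => /andP[m1 m2] /andP[r1 r2].
  by apply/andP; split; lra.
have Sb : S <= 290 * Lk + kw * (a ^+ 2 / sigma ^+ 2).
  apply: le_trans S1 _.
  apply: (@le_trans _ _ (2 * Lk / (n%:R * h) * (29 * (2 * (n%:R * h) + 3 + ln n%:R)))).
    by apply: ler_wpM2l => //; rewrite mulr_ge0 ?(ltW nhV0) // mulr_ge0 // ltW.
  have -> : 2 * Lk / (n%:R * h) * (29 * (2 * (n%:R * h) + 3 + ln n%:R)) =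
     116 * Lk + 174 * Lk * (n%:R * h)^-1 + kw * (a ^+ 2 / (n%:R * h)).
    by rewrite LE /kw; field; rewrite !gt_eqF.
  rewrite -nh_sigma lerD2r.
  have : 174 * Lk * (n%:R * h)^-1 <= 174 * Lk.
    by rewrite ger_pMr //; exact: mulr_gt0 (ltr0Sn _ _) Lk0.
  lra.
rewrite /Gsum sqrt_nh -/sigma sumrB mulrBr normrM (gtr0_norm sg0).
have -> : sigma * (kS + 1) + kw * (a ^+ 2 / sigma) =
    sigma * (kS + 1 + kw * (a ^+ 2 / sigma ^+ 2)) by field; rewrite gt_eqF.
rewrite ler_pM2l //; apply: le_trans (ler_normB _ _) _.
by rewrite (ger0_norm S0) /kS; lra.
Qed.

Definition small_const (C1 : R) : R :=
  (2 * B0 + Am * B1) * (256 * C1 ^+ 2 / (c0 * c1)) + Am * (16 * C1)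
  + Am * (16 * C1 * (kS + 1) + kw * 16).

(** With [sigma^2 <= C1 * ln n], dividing [sigma] by the lower bound [c0 c1 / (sigma^2 t^2)] gives
    at most a multiple of [(ln n)^2 n^(1/8) / sigma], which the rate absorbs. The kernel process is
    bounded without centering its sum. *)
Lemma small_bandwidth (C1 : R) :
  (forall i, (i <= n ^ 2)%N -> i%:R * mesh n <= 1 :> R ->
  (cnt_itv U (i%:R * mesh n) (Num.min 1 (i.+2%:R * mesh n))%R 0 n < 40)%N) ->
  t = root16 n -> n%:R * h <= C1 * ln n%:R -> 40 <= 2 * eta * (n%:R * h) ->
  `|Zdiff| <= small_const C1 * rho.
Proof.
move=> mb tE nhC e40.
have nn0 := nR_gt0; have sg0 := sigma_gt0; have h0 := h_gt0; have t0 := t_gt0.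
have u0 : 0 <= u by apply: le_trans hu; exact: ltW.
have u1' : u < 1 by apply: le_lt_trans uh _; rewrite gtrBl.
have u1 := ltW u1'.
have [qu0 qu1] := q_bounds u0 u1.
have B10 : 0 <= B1 by exact: le_trans qu1.
have B00 : 0 <= B0 by apply: le_trans (Q_bound u0 u1).
have Am0 : 0 <= Am by exact: le_trans A_le.
have a2 : 0 < a ^+ 2 by rewrite exprn_gt0 // a_gt0.
have sC : sigma ^+ 2 <= C1 * a ^+ 2 by rewrite -nh_sigma -LE.
have C10 : 0 <= C1.
  by rewrite -(pmulr_lge0 _ a2); apply: le_trans sC; exact: sqr_ge0.
have qh := qsum_ge_mesh K_ge0 K_lip K_supp Lk_gt0 c1_gt0 Q_incr n_gt0 h_gt0 hu uh nh_ge1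
  U_gt0 U_le1 c0_gt0 eta_gt0 K_bump mb e40.
have cc0 : 0 < c0 * c1 by rewrite mulr_gt0.
have mE : c0 * c1 * mesh n / h = c0 * c1 / (sigma ^+ 2 * t ^+ 2).
  by rewrite /mesh -tE -nh_sigma; field; rewrite !gt_eqF.
rewrite mE in qh.
have cq0 : 0 < c0 * c1 / (sigma ^+ 2 * t ^+ 2) by rewrite divr_gt0 // mulr_gt0 // exprn_gt0.
have [k1 k2] := truncn_scaled u0 n_gt0.
have kn : ((Num.truncn (n%:R * u)).+1 <= n)%N.
  rewrite -(ltr_nat R) -(ltr_pM2r (x := n%:R^-1)) ?invr_gt0 // (le_lt_trans k1) // divff //.
  by rewrite gt_eqF.
have op := ostat_gt0 U_gt0 (ltn0Sn _) kn.
have ol := ostat_le1 U_le1 (ltn0Sn _) kn.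
have Qd : `|Q (ostat U n (Num.truncn (n%:R * u)).+1) - Q u| <= 2 * B0.
  apply: le_trans (ler_normB _ _) _.
  by have -> : 2 * B0 = B0 + B0 by [ring|]; rewrite lerD // Q_bound // ltW.
rewrite /Zdiff sqrt_nh -/sigma.
apply: le_trans (crude_error _ (ltW sg0) cq0 qh qu0 qu1 A_le Qd) _.
have sr : sigma <= 16 * C1 * rho.
  have -> : 16 * C1 * rho = C1 * (16 * rho) by ring.
  apply: (@le_trans _ _ (C1 * (a ^+ 2 / sigma))).
    by rewrite mulrA ler_pdivlMr // -expr2.
  by apply: ler_wpM2l => //; exact: log_sigma_le.
have s4 : sigma / (c0 * c1 / (sigma ^+ 2 * t ^+ 2)) <= 256 * C1 ^+ 2 / (c0 * c1) * rho.
  have -> : sigma / (c0 * c1 / (sigma ^+ 2 * t ^+ 2)) =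
     (c0 * c1)^-1 * ((sigma ^+ 2) ^+ 2 * t ^+ 2 / sigma).
    by field; rewrite !gt_eqF.
  have -> : 256 * C1 ^+ 2 / (c0 * c1) * rho = (c0 * c1)^-1 * (C1 ^+ 2 * (256 * rho)).
    by field; rewrite !gt_eqF.
  rewrite ler_pM2l ?invr_gt0 //.
  apply: (@le_trans _ _ (C1 ^+ 2 * (a ^+ 4 * t ^+ 2 / sigma))); last first.
    by apply: ler_wpM2l; [exact: sqr_ge0 | exact: log2_sigma_le].
  have -> : C1 ^+ 2 * (a ^+ 4 * t ^+ 2 / sigma) = (C1 * a ^+ 2) ^+ 2 * t ^+ 2 / sigma.
    by field; rewrite gt_eqF.
  rewrite ler_pM2r ?invr_gt0 // ler_pM2r ?exprn_gt0 // lerXn2r // ?nnegrE ?sqr_ge0 //.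
  by rewrite mulr_ge0 // ltW.
have kS0 : 0 <= kS + 1.
  by apply: addr_ge0 => //; apply: mulr_ge0 (ler0n _ _) (ltW Lk_gt0).
have kw0 : 0 <= kw by apply: mulr_ge0 (ler0n _ _) (ltW Lk_gt0).
have Gb : `|Gsum| <= (16 * C1 * (kS + 1) + kw * 16) * rho.
  apply: le_trans Gsum_bound _.
  have -> : (16 * C1 * (kS + 1) + kw * 16) * rho = 16 * C1 * rho * (kS + 1) + kw * (16 * rho) by ring.
  apply: lerD; first exact: ler_wpM2r.
  by apply: ler_wpM2l => //; exact: log_sigma_le.
rewrite /small_const [leRHS]mulrDl [X in _ <= X + _]mulrDl.
apply: lerD; first apply: lerD.
- rewrite -[leRHS]mulrA; apply: ler_wpM2l => //.
  by rewrite addr_ge0 // mulr_ge0.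
- by rewrite -[leRHS]mulrA; apply: ler_wpM2l.
- by rewrite -[leRHS]mulrA; apply: ler_wpM2l.
Qed.

End regimes.

(** * The quantile function and the theorem *)

Section quantile_regularity.
Context {R : realType}.
Implicit Types x y : R.

(** The bound on [z - x], in either order of the points, is what turns the Lipschitz bound for [q]
    into the quadratic Taylor bound for [Q]. *)
Lemma mvt_unit (f : R -> R) : (forall u : R, 0 <= u <= 1 -> derivable f u 1) ->
  forall x y, 0 <= x -> x <= 1 -> 0 <= y -> y <= 1 ->
  exists z, [/\ 0 <= z <= 1, `|z - x| <= `|y - x| & f y - f x = derive1 f z * (y - x)].
Proof.
move=> df.
have main x y : 0 <= x -> x <= y -> y <= 1 ->
    exists2 z, z \in `[x, y]%R & f y - f x = derive1 f z * (y - x).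
  move=> x0 xy y1; apply: MVT_segment => //.
    move=> z; rewrite in_itv /= => /andP[xz zy].
    rewrite derive1E; apply: derivableP; apply: df; lra.
  apply: derivable_within_continuous => z; rewrite in_itv /= => /andP[xz zy].
  by apply: df; lra.
move=> x y x0 x1 y0 y1; case: (leP x y) => xy.
  have [z + ->] := main _ _ x0 xy y1; rewrite in_itv /= => /andP[xz zy].
  by exists z; split => //; [lra | rewrite !ger0_norm; lra].
have [z + e] := main _ _ y0 (ltW xy) x1; rewrite in_itv /= => /andP[xz zy].
exists z; split; [lra | by rewrite !ler0_norm; lra |].
by rewrite -opprB e; ring.
Qed.

Lemma bounded_unit (f : R -> R) : {within `[0, 1], continuous f} ->
  exists2 B, 0 <= B & forall x, 0 <= x -> x <= 1 -> `|f x| <= B.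
Proof.
move=> cf; have [x1 _ h1] := EVT_max (ler01 : 0 <= 1 :> R) cf.
have [x2 _ h2] := EVT_min (ler01 : 0 <= 1 :> R) cf.
exists (`|f x1| + `|f x2|); first exact: addr_ge0.
move=> x x0 x1'; have xI : x \in `[0, 1]%R by rewrite in_itv /= x0 x1'.
have := h1 x xI; have := h2 x xI; have := ler_norm (f x1).
have := normr_ge0 (f x1); have := normr_ge0 (f x2); have := ler_norm (- f x2).
rewrite normrN ler_norml => *; apply/andP; split; lra.
Qed.

(** [B2] bounds the second derivative of [Q], serving as Lipschitz and Taylor constant alike; [c1]
    is the minimum of [q]. *)
Lemma quantile_regular (Q : R -> R) :
  (forall u : R, 0 <= u <= 1 -> derivable Q u 1) ->
  (forall u : R, 0 <= u <= 1 -> derivable (derive1 Q) u 1) ->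
  {within `[0, 1], continuous (derive1 (derive1 Q))} ->
  (forall u : R, 0 <= u <= 1 -> 0 < derive1 Q u) ->
  exists B0 B1 B2 c1 : R, [/\ 0 <= B2, 0 < c1,
   forall x, 0 <= x -> x <= 1 -> `|Q x| <= B0,
   forall x, 0 <= x -> x <= 1 -> 0 <= derive1 Q x /\ derive1 Q x <= B1 &
   [/\ forall x y, 0 <= x -> x <= 1 -> 0 <= y -> y <= 1 ->
         `|derive1 Q y - derive1 Q x| <= B2 * `|y - x|,
       forall x y, 0 <= x -> x <= 1 -> 0 <= y -> y <= 1 ->
         `|Q y - Q x - derive1 Q x * (y - x)| <= B2 * (y - x) ^+ 2 &
       forall x y, 0 <= x -> x <= y -> y <= 1 -> c1 * (y - x) <= Q y - Q x]].
Proof.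
move=> d1 d2 c2 qpos.
have cQ : {within `[0, 1], continuous Q}.
  by apply: derivable_within_continuous => z; rewrite in_itv /=; exact: d1.
have cq : {within `[0, 1], continuous (derive1 Q)}.
  by apply: derivable_within_continuous => z; rewrite in_itv /=; exact: d2.
have [B0 _ HB0] := bounded_unit cQ.
have [B1 _ HB1] := bounded_unit cq.
have [B2 B20 HB2] := bounded_unit c2.
have [xm + hm] := EVT_min (ler01 : 0 <= 1 :> R) cq; rewrite in_itv /= => /qpos c10.
have qlip x y : 0 <= x -> x <= 1 -> 0 <= y -> y <= 1 ->
    `|derive1 Q y - derive1 Q x| <= B2 * `|y - x|.
  move=> x0 x1 y0 y1; have [z [/andP[z0 z1] _ ->]] := mvt_unit d2 x0 x1 y0 y1.
  by rewrite normrM ler_wpM2r // HB2.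
exists B0, B1, B2, (derive1 Q xm); split => //.
  move=> x x0 x1; split; first by rewrite ltW // qpos // x0 x1.
  by apply: le_trans (HB1 x x0 x1); exact: ler_norm.
split => // x y x0.
- move=> x1 y0 y1; have [z [/andP[z0 z1] zx ->]] := mvt_unit d1 x0 x1 y0 y1.
  rewrite -mulrBl normrM -real_normK ?num_real // expr2 mulrA ler_wpM2r //.
  by apply: le_trans (qlip _ _ x0 x1 z0 z1) _; rewrite ler_wpM2l.
- move=> xy y1; have y0 := le_trans x0 xy; have x1 := le_trans xy y1.
  have [z [/andP[z0 z1] _ ->]] := mvt_unit d1 x0 x1 y0 y1.
  by rewrite ler_wpM2r ?subr_ge0 // hm // in_itv /= z0 z1.
Qed.

End quantile_regularity.

Section known_weights.
Context {R : realType}.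

(** Nonnegative coefficients make [A1] and [A1'] nondecreasing, so the quotient is largest with
    numerator at 1 and denominator at 0. *)
Lemma Afun_bounded (p : nat -> R) (M : nat) :
  (forall m, (1 <= m <= M)%N -> 0 <= p m) ->
  (forall u : R, 0 <= u <= 1 -> A1' p M u != 0) ->
  exists Am, forall u : R, 0 <= u -> u <= 1 -> `|Afun p M u| <= Am.
Proof.
move=> p0 A0.
have pos (m : nat) : (1 <= m < M.+1)%N -> 0 <= p m by rewrite ltnS; exact: p0.
have d_ge u : 0 <= u -> A1' p M 0 <= A1' p M u.
  move=> u0; rewrite /A1' !big_nat; apply: ler_sum => m /pos pm.
  apply: ler_wpM2l; first by rewrite mulr_ge0.
  by case: (m - 2)%N => [|k]; rewrite ?expr0 // expr0n /= exprn_ge0.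
have d0 : 0 < A1' p M 0.
  rewrite lt_neqAle eq_sym A0 ?lexx ?ler01 //= /A1' big_nat sumr_ge0 // => m /pos pm.
  by rewrite mulr_ge0 ?exprn_ge0 // mulr_ge0.
exists (A1 p M 1 / A1' p M 0) => u u0 u1.
have dpos : 0 < A1' p M u by apply: lt_le_trans (d_ge u u0).
have n0 : 0 <= A1 p M u.
  by rewrite /A1 big_nat sumr_ge0 // => m /pos pm; rewrite mulr_ge0 ?exprn_ge0.
rewrite /Afun ger0_norm; last by rewrite divr_ge0 // ltW.
apply: ler_pM => //; first by rewrite invr_ge0 ltW.
  rewrite /A1 !big_nat; apply: ler_sum => m /pos pm; apply: ler_wpM2l => //.
  by rewrite expr1n exprn_ile1.
by rewrite lef_pV2 ?posrE // d_ge.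
Qed.

(** [K] is positive at some [x0] because its integral is not 0, and the Lipschitz bound keeps it
    above [K x0 / 2] within distance [K x0 / (2 Lk)]. *)
Lemma kernel_bump (K : R -> R) (Lk : R) :
  (forall x, 0 <= K x) -> (forall x y, `|K x - K y| <= Lk * `|x - y|) -> 0 < Lk ->
  (\int[lebesgue_measure]_x (K x)%:E = 1)%E ->
  exists x0 c0 eta : R, [/\ 0 < c0, 0 < eta & forall z, `|z - x0| <= eta -> c0 <= K z].
Proof.
move=> K0 Klip Lk0 K1.
have [x0 Kx0] : exists x, 0 < K x.
  apply: contrapT => /forallNP nK.
  have Kz x : K x = 0.
    by apply/eqP; rewrite eq_le K0 andbT leNgt; apply/negP; exact: nK.
  move: K1; under eq_integral do rewrite Kz.
  by rewrite integral0 => /eqP; rewrite eq_sym onee_eq0.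
exists x0, (K x0 / 2), (K x0 / 2 / Lk); split; rewrite ?divr_gt0 //.
move=> z zx; have := Klip z x0; rewrite ler_distl => /andP[+ _].
have : Lk * `|z - x0| <= K x0 / 2 by rewrite mulrC -ler_pdivlMr.
lra.
Qed.

Lemma monomial_parameters : exists N, forall n, (N <= n)%N ->
  [/\ (0 < n)%N, 1 <= root16 n :> R, 1 <= Num.sqrt (ln n%:R) :> R,
      1 <= (ln (ln n%:R)) `^ (1 / 4) :> R &
  [/\ (Num.sqrt (ln n%:R)) ^+ 2 <= 16 * root16 n :> R,
      ((ln (ln n%:R)) `^ (1 / 4)) ^+ 4 <= (Num.sqrt (ln n%:R)) ^+ 2 :> R,
      ln n%:R = (Num.sqrt (ln n%:R)) ^+ 2 :> R &
      ln (ln n%:R) = ((ln (ln n%:R)) `^ (1 / 4)) ^+ 4 :> R]].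
Proof.
have [N1 H1] := @ln_large R (expR 1).
exists (maxn 1 N1) => n; rewrite geq_max => /andP[n0 /H1 Le].
have e1 : 1 <= expR 1 :> R by have := expR_ge1Dx (1 : R); lra.
have L1 : 1 <= ln n%:R :> R by lra.
have LL1 : 1 <= ln (ln n%:R) :> R by rewrite -ler_expR lnK // posrE; lra.
have La : ln n%:R = (Num.sqrt (ln n%:R)) ^+ 2 :> R by rewrite sqr_sqrtr //; lra.
have LLc : ln (ln n%:R) = ((ln (ln n%:R)) `^ (1 / 4)) ^+ 4 :> R.
  rewrite -powR_mulrn ?powR_ge0 // -powRrM.
  have -> : 1 / 4 * 4 = 1 :> R by field.
  by rewrite powRr1 //; lra.
split => //.
- exact: root16_ge1.
- by rewrite -[leLHS]sqrtr1 ler_wsqrtr.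
- rewrite leNgt; apply/negP => lt.
  have : ((ln (ln n%:R)) `^ (1 / 4)) ^+ 4 < 1 :> R by rewrite exprn_ilt1 // powR_ge0.
  by rewrite -LLc; lra.
split => //; first by rewrite -La; exact: ln_le_root16.
by rewrite -La -LLc; apply: ln_le_id; lra.
Qed.

Lemma sqrt_natr_root16 n : Num.sqrt n%:R = root16 n ^+ 8 :> R.
Proof.
rewrite -(root16_exp n) (exprM _ 8 2) sqrtr_sqr ger0_norm //.
by rewrite exprn_ge0 // powR_ge0.
Qed.

Lemma powR_root16 n : n%:R `^ (1 / 4) = root16 n ^+ 4 :> R.
Proof.
rewrite /root16 -powR_mulrn ?powR_ge0 // -powRrM.
by congr (_ `^ _); field.
Qed.

Lemma powR_three_halves (h : R) : 0 < h -> h `^ (3 / 2) = Num.sqrt h ^+ 3.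
Proof.
move=> h0; rewrite -powR12_sqrt ?(ltW h0) // -powR_mulrn ?powR_ge0 // -powRrM.
by congr (_ `^ _); field.
Qed.

End known_weights.

(** * From bids to uniform variables *)

Section bids.
Context {d : measure_display} {T : measurableType d} {R : realType}.
Variables (P : probability T R) (b : nat -> T -> R) (F Q : R -> R) (c1 : R).
Hypothesis b_meas : forall i, measurable_fun setT (b i).
Hypothesis b_cdf : forall i x, P [set w | b i w <= x] = (F x)%:E.
Hypothesis F_Q : forall u : R, 0 <= u <= 1 -> F (Q u) = u.
Hypothesis c1_gt0 : 0 < c1.
Hypothesis Q_incr : forall x y : R, 0 <= x -> x <= y -> y <= 1 -> c1 * (y - x) <= Q y - Q x.
Hypothesis Q_cont : {within `[0, 1], continuous Q}.

Lemma Q_le x y : 0 <= x -> x <= y -> y <= 1 -> Q x <= Q y.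
Proof.
move=> x0 xy y1; rewrite -subr_ge0; apply: le_trans (Q_incr x0 xy y1).
by rewrite mulr_ge0 ?(ltW c1_gt0) // subr_ge0.
Qed.

Lemma Q_ltE x y : 0 <= x -> x <= 1 -> 0 <= y -> y <= 1 -> (Q x < Q y) = (x < y).
Proof.
move=> x0 x1 y0 y1; apply/idP/idP => [|xy].
  by apply: contraTT; rewrite -!leNgt => yx; exact: Q_le.
rewrite -subr_gt0; apply: lt_le_trans (Q_incr x0 (ltW xy) y1).
by rewrite mulr_gt0 // subr_gt0.
Qed.

Lemma measurable_bid_le l x : measurable [set w | b l w <= x].
Proof.
have -> : [set w | b l w <= x] = b l @^-1` `]-oo, x]%classic.
  by apply/seteqP; split => w /=; rewrite in_itv.
exact: (measurable_preim b_meas).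
Qed.

Lemma prob_quantile_itv l x y : 0 <= x -> x <= y -> y <= 1 ->
  P (b l @^-1` [set r | [pred r | Q x < r <= Q y] r]) = (y - x)%:E.
Proof.
move=> x0 xy y1; have x1 := le_trans xy y1; have y0 := le_trans x0 xy.
have -> : b l @^-1` [set r | [pred r | Q x < r <= Q y] r] =
    [set w | b l w <= Q y] `\` [set w | b l w <= Q x].
  apply/seteqP; split => w /=.
    by move=> /andP[h1 h2]; split => //; rewrite leNgt h1.
  by move=> [-> /negP]; rewrite -ltNge => ->.
rewrite measureD; [|exact: measurable_bid_le|exact: measurable_bid_le|]; last first.
  exact: le_lt_trans (probability_le1 _ (measurable_bid_le _ _)) (ltry _).
have -> : [set w | b l w <= Q y] `&` [set w | b l w <= Q x] = [set w | b l w <= Q x].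
  apply/seteqP; split => w /=; first by case.
  by move=> wx; split => //; apply: le_trans wx _; exact: Q_le.
rewrite EFinB -[in RHS](F_Q (u := y)) ?y0 // -[in RHS](F_Q (u := x)) ?x0 //.
by rewrite -!(b_cdf l).
Qed.

(** [F (Q 0) = 0] and [F (Q 1) = 1] confine the bids to []Q 0, Q 1]] almost surely; there the
    intermediate value theorem writes a bid as [Q u], and [F] recovers [u]. *)
Lemma ae_bid_quantile : {ae P, forall w, forall l,
  [/\ 0 < F (b l w), F (b l w) <= 1 & b l w = Q (F (b l w))]}.
Proof.
apply: ae_foralln => l.
have n0 : P.-negligible [set w | b l w <= Q 0].
  exists [set w | b l w <= Q 0]; split => //; first exact: measurable_bid_le.
  by rewrite b_cdf F_Q ?lexx ?ler01.
have n1 : P.-negligible (~` [set w | b l w <= Q 1]).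
  exists (~` [set w | b l w <= Q 1]); split => //.
    exact: measurableC (measurable_bid_le _ _).
  rewrite probability_setC ?b_cdf; last exact: measurable_bid_le.
  by rewrite F_Q ?ler01 ?lexx // subee.
apply: negligibleS (negligibleU n0 n1) => w /=.
move=> nw; apply: contrapT => /not_orP[/negP w0 /contrapT w1]; apply: nw.
rewrite -ltNge in w0.
have [u ub Qu] : exists2 u, u \in `[0, 1]%R & Q u = b l w.
  apply: IVT => //.
  have Q01 : Q 0 <= Q 1 by exact: Q_le.
  by rewrite min_l // max_r // (ltW w0).
move: ub; rewrite in_itv /= => u01; rewrite -Qu F_Q //.
move: u01 => /andP[u0 u1]; split => //.
by rewrite -(Q_ltE (lexx 0) ler01 u0 u1) Qu.
Qed.

Lemma ae_quantile_itv : {ae P, forall w, forall l (x y : R), 0 <= x -> x <= y -> y <= 1 ->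
  [pred r | Q x < r <= Q y] (b l w) = (x < F (b l w) <= y)}.
Proof.
move: ae_bid_quantile; apply: filterS => w H l x y x0 xy y1 /=.
have [U0 U1 bE] := H l; rewrite {1 2}bE.
have x1 := le_trans xy y1; have y0 := le_trans x0 xy.
by rewrite Q_ltE ?(ltW U0) // leNgt Q_ltE ?(ltW U0) // -leNgt.
Qed.

End bids.

Unset Implicit Arguments.

Theorem mainTheorem2
  (R : realType) (d : measure_display) (T : measurableType d) (P : probability T R)
  (b : nat -> T -> R) (F Q : R -> R) (p : nat -> R) (M : nat)
  (K : R -> R) (h : nat -> R)
  (* i.i.d. bids with CDF F *)
  (hb_meas : forall i, measurable_fun setT (b i))
  (hb_indep : mutually_independent P b)
  (hb_cdf : forall i x, P [set w | b i w <= x] = (F x)%:E)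
  (hF_cont : continuous F)
  (* Q = F^{-1} on [0,1], twice continuously differentiable with q = Q' > 0 *)
  (hQ_inv : forall u : R, 0 <= u <= 1 -> F (Q u) = u)
  (hQ_d1 : forall u : R, 0 <= u <= 1 -> derivable Q u 1)
  (hQ_d2 : forall u : R, 0 <= u <= 1 -> derivable (derive1 Q) u 1)
  (hQ_c2 : {within `[0, 1], continuous (derive1 (derive1 Q))})
  (hq_pos : forall u : R, 0 <= u <= 1 -> 0 < derive1 Q u)
  (* the known numbers p_m and the function A *)
  (hM : (2 <= M)%N)
  (hp : forall m, (1 <= m <= M)%N -> 0 <= p m)
  (hA1' : forall u : R, 0 <= u <= 1 -> A1' p M u != 0)
  (* Assumption 2 on the kernel *)
  (hK_nonneg : forall x, 0 <= K x)
  (hK_int : (\int[lebesgue_measure]_x (K x)%:E = 1)%E)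
  (hK_sq : (\int[lebesgue_measure]_x ((K x) ^+ 2)%:E < +oo)%E)
  (hK_lip : exists L : R, forall x y, `|K x - K y| <= L * `|x - y|)
  (hK_supp : forall x, 1 < `|x| -> K x = 0)
  (* bandwidth *)
  (hh_pos : forall n, 0 < h n)
  (hh0 : h @ \oo --> 0)
  (hnh : (fun n => n%:R * h n) @ \oo --> +oo) :
  let v := fun u => Q u + Afun p M u * derive1 Q u in
  let Zn := fun n u w =>
    Num.sqrt (n%:R * h n) * (vhat p M K b n (h n) u w - v u) / qhat K b n (h n) u w in
  let Zstar := fun n u w => - Afun p M u * Gnh P K F b n (h n) u w in
  let rate := fun n : nat =>
    Num.sqrt n%:R * (h n) `^ (3 / 2) + Num.sqrt (h n)
    + ell n / (Num.sqrt (h n) * (n%:R) `^ (1 / 4)) in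
  {ae P, forall w, exists (C : R) (N : nat), forall n, (N <= n)%N ->
      forall u : R, h n <= u <= 1 - h n ->
        `|Zn n u w - Zstar n u w| <= C * rate n}.
Proof.
move=> v Zn Zstar rate.
have [L0 hL0] := hK_lip.
pose Lk := `|L0| + 1.
have Lk0 : 0 < Lk by rewrite ltr_wpDl.
have Klip x y : `|K x - K y| <= Lk * `|x - y|.
  apply: le_trans (hL0 x y) _; rewrite ler_wpM2r //.
  by rewrite (le_trans (ler_norm _)) // lerDl.
have [x0 [c0 [eta [c00 eta0 bump]]]] := kernel_bump hK_nonneg Klip Lk0 hK_int.
have [B0 [B1 [B2 [c1 [B20 c10 Qb qb [qlip Qt Qi]]]]]] :=
  quantile_regular hQ_d1 hQ_d2 hQ_c2 hq_pos.
have [Am HAm] := Afun_bounded hp hA1'.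
have cQ : {within `[0, 1], continuous Q}.
  by apply: derivable_within_continuous => z; rewrite in_itv /=; exact: hQ_d1.
have pI := prob_quantile_itv hb_meas hb_cdf hQ_inv c10 Qi.
have aI := ae_quantile_itv hb_meas hb_cdf hQ_inv c10 Qi cQ.
have aQ := ae_bid_quantile hb_meas hb_cdf hQ_inv c10 Qi cQ.
have [N1 HN1] := @monomial_parameters R.
(* [C1 * ln n] separates the regimes: above it [197 * ln n <= eta * (n h)]. [H0] ensures
   [40 <= 2 * eta * (n h)], so that 40 spacings fit under the bump. *)
pose C1 := Num.max 1 (197 / eta).
pose H0 := Num.max 1 (20 / eta).
have [N2 _ HN2] : \forall n \near \oo, H0 <= n%:R * h n by move/cvgryPge: hnh; exact.
have g1 := ae_grid_bound hb_meas hb_indep pI aI.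
have g2 := ae_block_bound hb_meas hb_indep pI aI.
have g3 := ae_mesh_bound hb_meas hb_indep pI aI.
have mF l : measurable_fun setT (fun w => F (b l w)).
  apply: measurableT_comp => //; exact: continuous_measurable_fun.
have expect n u l : (0 < n)%N -> 1 <= n%:R * h n -> h n <= u -> u <= 1 - h n ->
    `|fine ('E_P[fun w => Kh K (h n) (u - F (b l w))])%E
     - n%:R^-1 * \sum_(0 <= i < n) Kh K (h n) (u - i%:R / n%:R)| <= 5 * Lk / (n%:R * h n).
  move=> n0 nh1 hu uh; have nn0 : 0 < n%:R :> R by rewrite ltr0n.
  pose A i := b l @^-1` [set r | [pred r | Q (i%:R / n%:R) < r <= Q (i.+1%:R / n%:R)] r].
  have iI i : (i < n)%N -> [/\ 0 <= i%:R / n%:R :> R, i%:R / n%:R <= i.+1%:R / n%:R :> R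
      & i.+1%:R / n%:R <= 1 :> R].
    move=> i_n; split; first by rewrite divr_ge0.
      by rewrite ler_pM2r ?invr_gt0 // ler_nat.
    by rewrite ler_pdivrMr // mul1r ler_nat.
  apply: (@kernel_expectation R K Lk hK_nonneg Klip hK_supp Lk0 d T P (fun w => F (b l w)) A) => //.
  - by move=> i; apply: (measurable_preim hb_meas); exact: measurable_quantile_itv.
  - move=> i i_n; have [i1 i2 i3] := iI i i_n.
    rewrite /A pI //; congr (_%:E).
    by rewrite -addn1 natrD mulrDl mul1r; ring.
  - move: aI; apply: filterS => w wI i i_n; have [i1 i2 i3] := iI i i_n.
    by rewrite /cell -(wI l _ _ i1 i2 i3) /A mem_setE.
(* From here on the sample is fixed and the argument deterministic. *)
near=> w.
have wg1 : grid_bound (fun l => F (b l w)) by near: w.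
have wg2 : block_bound (fun l => F (b l w)) by near: w.
have wg3 : mesh_bound (fun l => F (b l w)) by near: w.
have wQ : forall l, [/\ 0 < F (b l w), F (b l w) <= 1 & b l w = Q (F (b l w))] by near: w.
have wmod := grid_modulus_bound wg1.
have [N4 HN4] := block_uniform_bound wg2 wmod.
have [N3 HN3] := wmod.
have [N5 HN5] := wg3.
pose CL := large_const Lk c0 eta B1 B2 c1 1000 Am.
pose CS := small_const Lk c0 B0 B1 c1 Am C1.
exists (`|CL| + `|CS|), (maxn N1 (maxn N2 (maxn N3 (maxn N4 N5)))) => n.
rewrite !geq_max => /andP[/HN1 [n0 t1 a1 cc1 [atx ca La LLc]]].
move=> /andP[/HN2 nhH /andP[/HN3 md /andP[/HN4 un /HN5 me]]] u /andP[hu uh].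
have [nh1 nh20] : 1 <= n%:R * h n /\ 20 / eta <= n%:R * h n.
  by move: nhH; rewrite /= ge_max => /andP[].
have h0 := hh_pos n.
set t := root16 n in t1 atx; set a := Num.sqrt (ln n%:R) in a1 atx ca La.
set c := ln (ln n%:R) `^ (1 / 4) in cc1 ca LLc.
pose s := Num.sqrt (h n).
have s0 : 0 < s by rewrite sqrtr_gt0.
have hE : h n = s ^+ 2 by rewrite sqr_sqrtr // ltW.
have nE : n%:R = t ^+ 16 :> R by rewrite /t root16_exp.
pose U l := F (b l w).
have U0 l : 0 < U l by have [] := wQ l.
have U1 l : U l <= 1 by have [] := wQ l.
have bU : b^~ w = (fun l => Q (U l)) by apply/funext => l; have [] := wQ l.
have ord k : (0 < k)%N -> (k <= n)%N -> ord_stat b n w k = Q (ostat U n k).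
  move=> k0 kn; rewrite -(ostat_map (Q := Q)) // => [|l l' ll']; last first.
    by apply: (Q_le c10 Qi) => //; rewrite ltW.
  by rewrite /ord_stat /ostat -bU.
have u0 : 0 <= u by apply: le_trans hu; exact: ltW.
have u1 : u < 1 by apply: le_lt_trans uh _; rewrite gtrBl.
have kn : ((Num.truncn (n%:R * u)).+1 <= n)%N.
  have nn0 : 0 < n%:R :> R by rewrite ltr0n.
  have [k1 _] := truncn_scaled u0 n0.
  rewrite -(ltr_nat R) -(ltr_pM2r (x := n%:R^-1)) ?invr_gt0 // (le_lt_trans k1) // divff //.
  by rewrite gt_eqF.
pose E l := fine ('E_P[fun w' => Kh K (h n) (u - F (b l w'))])%E.
have qE : qhat K b n (h n) u w = qsum K Q n (h n) u U.
  rewrite /qhat /qsum !big_nat; apply: eq_bigr => i /andP[i1 i2].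
  by rewrite !ord // ltnW.
have ZE : Zn n u w - Zstar n u w = Zdiff K Q (derive1 Q) n (h n) u U E (Afun p M u).
  rewrite /Zn /Zstar /Zdiff /vhat qE /Qhat u1 ord // /v; congr (_ * _ / _ - _).
  by ring.
have nearE l := expect n u l n0 nh1 hu uh.
have rho_le : rho s t a c <= rate n.
  rewrite /rho /rate /bias /kiefer sqrt_natr_root16 powR_three_halves // powR_root16.
  by rewrite /ell -/t -/s -/a -/c lerD2r lerDl ltW.
have rho0 : 0 <= rho s t a c by exact: rho_ge0.
have Cb (C : R) : `|Zn n u w - Zstar n u w| <= C * rho s t a c -> `|C| <= `|CL| + `|CS| ->
    `|Zn n u w - Zstar n u w| <= (`|CL| + `|CS|) * rate n.
  move=> /le_trans CC Cle; apply: CC; apply: le_trans (ler_wpM2r rho0 (ler_norm C)) _.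
  by apply: ler_pM.
have k1000 : 1 <= 1000 :> R by rewrite ler1n.
have L0' : 0 < ln n%:R :> R by rewrite La exprn_gt0 // (lt_le_trans ltr01 a1).
have [nhC|nhC] := leP (C1 * ln n%:R) (n%:R * h n).
- apply: (Cb CL); last by rewrite lerDl.
  have C1L : ln n%:R <= n%:R * h n.
    by apply: le_trans nhC; rewrite ler_peMl ?(ltW L0') // le_max lexx.
  have C1e : 197 * ln n%:R <= eta * (n%:R * h n).
    rewrite mulrC [eta * _]mulrC -ler_pdivrMr // -mulrA mulrC.
    by apply: le_trans nhC; rewrite ler_pM2r // le_max lexx orbT.
  have e20 : 1 <= 2 * eta * (n%:R * h n).
    by move: nh20; rewrite ler_pdivrMr //; lra.
  rewrite ZE; exact: (large_bandwidth hK_nonneg Klip hK_supp Lk0 hK_int c00 eta0 bump B20 c10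
     qb qlip Qt Qi n0 h0 hu uh nh1 U0 U1 md k1000 nearE (HAm u u0 (ltW u1)) s0 t1 a1 cc1 atx ca nE
     hE La LLc un C1L e20 C1e).
- apply: (Cb CS); last by rewrite lerDr.
  have e40 : 40 <= 2 * eta * (n%:R * h n).
    by move: nh20; rewrite ler_pdivrMr //; lra.
  rewrite ZE; exact: (small_bandwidth hK_nonneg Klip hK_supp Lk0 hK_int c00 eta0 bump c10
     Qb qb Qi n0 h0 hu uh nh1 U0 U1 md nearE (HAm u u0 (ltW u1)) s0 t1 a1 cc1 atx nE
     hE La me erefl (ltW nhC) e40).
Unshelve. all: by end_near.
Qed.
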